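(* Assume that the innovations $(U_i)_{i\ge1}$ satisfy the Gaussian concentration property $GC(\beta)$ for some $\beta>0$ and that $b,\sigma$ satisfy (HS) and (HD$_\alpha$) for some $\alpha\in[\frac12,1]$. Let $\mu_T^{\Delta,0,x}$ be the law of $X_T^{\Delta,0,x}$, the value at time $T$ of the Euler like scheme started from $x$ at time $0$. There exists $\varepsilon_\beta>0$ depending only on $\mu$, with $\mathbb{E}[\exp(\varepsilon_\beta|U_1|^2)]<\infty$, such that, with the constants defined in the context, $\mu_T^{\Delta,0,x}$ satisfies the transport-entropy inequality $T_{\Phi_\alpha^*}$, where $\Phi^*_\alpha(\lambda)=\sup_{\rho\ge0}\{\lambda\rho-\Phi_\alpha(\rho)\}$, $\lambda\ge 0$, and: (i) if $\alpha\in(\frac12,1]$, for all $\rho\ge0$, $$\Phi_\alpha(\rho)=K_{3.1}\left(\varphi(T,b,\sigma,\Delta)\vee\varphi(T,b,\sigma,\Delta)^{\frac{\alpha}{2\alpha-1}}\right)\left(\rho^2\vee\rho^{\frac{2\alpha}{2\alpha-1}}\right);$$ (ii) if $\alpha=\frac12$, for all $\rho\in[0,\varphi(T,b,\sigma,\Delta)^{-1/2}\lambda_{3.2})$, $$\Phi_{1/2}(\rho)=K_{3.2}\,\frac{(\rho\,\varphi(T,b,\sigma,\Delta)^{1/2}/\lambda_{3.2})^2}{1-(\rho\,\varphi(T,b,\sigma,\Delta)^{1/2}/\lambda_{3.2})},$$ and $\Phi_{1/2}(\rho)=+\infty$ otherwise.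
   Context: Transport-entropy inequality: for $\Phi:\mathbb{R}_+\to\mathbb{R}_+$ convex, increasing, $\Phi(0)=0$, a probability measure $\mu$ on $\mathbb{R}^d$ satisfies $T_\Phi$ if $\Phi(W_1(\nu,\mu))\le \mathcal{H}(\nu,\mu)$ for all probability measures $\nu$ on $\mathbb{R}^d$, where $W_1$ is the Wasserstein distance of order 1 (for the Euclidean distance) and $\mathcal{H}(\nu,\mu)=\int\log(d\nu/d\mu)\,d\nu$ if $\nu\ll\mu$, $+\infty$ otherwise. Setting: $d,q\ge1$, $T>0$, $x\in\mathbb{R}^d$, $N\in\mathbb{N}^*$, $\Delta=T/N$, $t_i=i\Delta$; $b:[0,T]\times\mathbb{R}^d\to\mathbb{R}^d$ and $\sigma:[0,T]\times\mathbb{R}^d\to\mathbb{R}^{d\times q}$ are measurable in time, $a=\sigma\sigma^*$; $(U_i)_{i\ge1}$ are i.i.d. $\mathbb{R}^q$-valued with law $\mu$, $\mathbb{E}[U_1]=0$, $\mathbb{E}[U_1U_1^*]=I_q$. The Euler like scheme is $X_0^\Delta=x$, $X^\Delta_{t_{i+1}}=X^\Delta_{t_i}+b(t_i,X^\Delta_{t_i})\Delta+\sigma(t_i,X^\Delta_{t_i})\Delta^{1/2}U_{i+1}$, $0\le i\le N-1$. $GC(\beta)$: for every 1-Lipschitz $f:\mathbb{R}^q\to\mathbb{R}$ and all $\lambda\ge0$, $\mathbb{E}[\exp(\lambda f(U_1))]\le\exp(\lambda\mathbb{E}[f(U_1)]+\beta\lambda^2/4)$. (HS): $b,\sigma$ are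 Lipschitz continuous in space, uniformly in time, with Lipschitz moduli $[b]_1,[\sigma]_1$ (Euclidean norm on $\mathbb{R}^d$, Hilbert–Schmidt norm on matrices). (HD$_\alpha$): there is a $C^2$ function $V:\mathbb{R}^d\to(0,\infty)$ and $C_V>0$ with $|\nabla V|^2\le C_VV$, $\eta:=\frac12\sup_x\|\nabla^2V(x)\|<\infty$, and constants $C_b,C_\sigma>0$ such that for all $x$, $\sup_{t\in[0,T]}|b(t,x)|^2\le C_bV(x)$ and $\sup_{t\in[0,T]}\mathrm{Tr}(a(t,x))\le C_\sigma V^{1-\alpha}(x)$ (with $\alpha\in(0,1]$). Constants: $C(\Delta)=2[b]_1+[\sigma]_1^2+\Delta[b]_1^2$ (assumed nonzero, so that $\varphi$ is defined), $\varphi(T,b,\sigma,\Delta)=C_\sigma\beta\frac{1+C(\Delta)\Delta}{4C(\Delta)}e^{3C(\Delta)T}$; $C=\alpha(C_VC_b)^{1/2}+\beta C_\sigma\alpha^2(1+2\eta\Delta)^2(C_V+C_b)+\alpha\eta C_b\Delta$; $K=(C_VC_b)^{1/2}+\eta C_b\Delta$; $\underline\rho=\frac12\min(1,\varepsilon_\beta(2\eta\alpha C_\sigma Te^{CT})^{-1})$; with $U\sim\mu$, $$\Psi_1=e^{\frac{2\alpha-1}{\alpha}\underline\rho^{-\frac{1-\alpha}{2\alpha-1}}}\exp\Big(\underline\rho\tfrac{1-\alpha}{\alpha}e^{CT}V^\alpha(x)+\tfrac12\log\mathbb{E}[e^{\frac{\varepsilon_\beta(1-\alpha)}{2\alpha}|U|^2}]\Big)+\Big(V^{1-\alpha}(x)+\big(\tfrac{C_\sigma\mathbb{E}[|U|^2]}{K}\big)^{\frac{1-\alpha}{\alpha}}\Big)e^{(1-\alpha)KT},$$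 $$\Psi_2=\underline\rho^{-\frac{1-\alpha}{2\alpha-1}}\tfrac{2\alpha-1}{\alpha}+\underline\rho\tfrac{1-\alpha}{\alpha}e^{CT}V^\alpha(x)+\tfrac12\log\mathbb{E}\big[e^{\frac{\varepsilon_\beta(1-\alpha)}{2\alpha}|U|^2}\big],$$ and $K_{3.1}=\max(\Psi_1,\Psi_2)$ (for $\alpha\in(\frac12,1]$). For $\alpha=\frac12$: $\lambda_{3.2}>0$ is a constant satisfying $\mathbb{E}[\exp(\lambda_{3.2}^2\,2\eta\alpha C_\sigma Te^{CT}|U_1|^2)]\le2$ and $K_{3.2}=\lambda_{3.2}^2e^{CT}(2V^{1/2}(x)+2\eta\alpha C_\sigma\mathbb{E}[|U_1|^2]T)$ (with $\alpha=\frac12$, also in $C$). *)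

(* Defs.v *)
From HB Require Import structures.
From mathcomp Require Import all_boot all_order all_algebra.
From mathcomp Require Import all_classical all_reals all_analysis.

Set Implicit Arguments.
Unset Strict Implicit.
Unset Printing Implicit Defensive.

Import Order.TTheory GRing.Theory Num.Theory.
Import numFieldNormedType.Exports.

Local Open Scope classical_set_scope.
Local Open Scope ring_scope.

(* [g_sigma_algebraType G] is convertible to its carrier. The sup norm that
   the library puts on matrices induces the usual topology, so the sigma-algebra
   is the usual Borel one; [R^d] is ['cV[R]_d]. *)
Definition borel_mx (R : realType) (m n : nat) :=
  g_sigma_algebraType (@open 'M[R]_(m, n)).

Notation borel_cV R d := (borel_mx R d 1).

(* Hilbert-Schmidt norm; on column vectors it is the Euclidean norm. (The
   library norm [`|A|] on matrices is the sup norm.) *)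
Definition hsnorm (R : realType) (m n : nat) (A : 'M[R]_(m, n)) : R :=
  Num.sqrt (\sum_i \sum_j A i j ^+ 2).

Section transport_entropy.
Context {R : realType} {d : nat}.
Local Notation E := (borel_cV R d).

Definition coupling (pi : probability (E * E)%type R) (nu mu : probability E R)
    : Prop :=
  (forall A : set E, measurable A -> pi (A `*` setT) = nu A) /\
  (forall A : set E, measurable A -> pi (setT `*` A) = mu A).

Definition W1 (nu mu : probability E R) : \bar R :=
  ereal_inf [set (\int[pi]_z (hsnorm ((z.1 : 'cV[R]_d) - z.2))%:E)%E
            | pi in [set pi | coupling pi nu mu]].

Definition rel_entropy (nu mu : probability E R) : \bar R :=
  if `[< nu `<< mu >]
  then (\int[nu]_z lne (Radon_Nikodym (charge_of_finite_measure nu) mu z))%E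
  else +oo%E.

(* [W1 nu mu] may be [+oo], hence the type of [Phi]. *)
Definition transport_entropy (Phi : \bar R -> \bar R) (mu : probability E R)
    : Prop :=
  forall nu : probability E R, (Phi (W1 nu mu) <= rel_entropy nu mu)%E.

End transport_entropy.

(* [sup_(r >= 0) (l r - Phi r)]; at [l = +oo] it is [+oo] as soon as [Phi] is
   finite at some [r > 0]. A point where [Phi r = +oo] contributes [-oo]. *)
Definition legendre (R : realType) (Phi : R -> \bar R) (l : \bar R) : \bar R :=
  ereal_sup [set (l * r%:E - Phi r)%E | r in [set r : R | 0 <= r]].

Section innovations.
Context {R : realType} {q : nat}.
Local Notation E := (borel_cV R q).

Definition centered (mu : probability E R) : Prop :=
  forall i : 'I_q, (\int[mu]_u ((u : 'cV[R]_q) i ord0)%:E = 0)%E.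

Definition unit_covariance (mu : probability E R) : Prop :=
  forall i j : 'I_q,
    (\int[mu]_u ((u : 'cV[R]_q) i ord0 * (u : 'cV[R]_q) j ord0)%:E
     = (1%:M i j : R)%:E)%E.

Definition lipschitz1 (f : 'cV[R]_q -> R) : Prop :=
  forall u v, `|f u - f v| <= hsnorm (u - v).

Definition gaussian_concentration (mu : probability E R) (beta : R) : Prop :=
  forall (f : 'cV[R]_q -> R) (lam : R), lipschitz1 f -> 0 <= lam ->
    (\int[mu]_u (expR (lam * f u))%:E
     <= (expR (lam * (\int[mu]_u f u)%R + beta * lam ^+ 2 / 4))%:E)%E.

Definition iid_with_law (dO : measure_display) (Omega : measurableType dO)
    (P : probability Omega R) (U : nat -> {RV P >-> E})
    (mu : probability E R) : Prop :=
  (forall i (A : set E), measurable A -> distribution P (U i) A = mu A) /\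
  (forall (s : seq nat) (A : nat -> set E), uniq s ->
     (forall i, measurable (A i)) ->
     P (\bigcap_(i in [set` s]) (U i @^-1` A i))
     = (\prod_(i <- s) P (U i @^-1` A i))%E).

(* [E[exp(c |U|^2)]] and [E[|U|^2]] for [U] of law [mu]. *)
Definition exp_sq_moment (mu : probability E R) (c : R) : \bar R :=
  (\int[mu]_u (expR (c * hsnorm (u : 'cV[R]_q) ^+ 2))%:E)%E.

Definition sq_moment (mu : probability E R) : R :=
  \int[mu]_u (hsnorm (u : 'cV[R]_q) ^+ 2).

End innovations.

Section coefficients.
Context {R : realType} {d : nat}.

Definition measurable_in_time (T : R) (m n : nat)
    (g : R -> 'cV[R]_d -> 'M[R]_(m, n)) : Prop :=
  forall y, measurable_fun `[0, T] (fun t => g t y : borel_mx R m n).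

Definition lip_quotients (T : R) (m n : nat)
    (g : R -> 'cV[R]_d -> 'M[R]_(m, n)) : set R :=
  [set r | exists t y z, [/\ 0 <= t <= T, y != z &
    r = hsnorm (g t y - g t z) / hsnorm (y - z)]].

Definition unif_lipschitz (T : R) (m n : nat)
    (g : R -> 'cV[R]_d -> 'M[R]_(m, n)) : Prop :=
  has_ubound (lip_quotients T g).

Definition lip_modulus (T : R) (m n : nat)
    (g : R -> 'cV[R]_d -> 'M[R]_(m, n)) : R :=
  sup (lip_quotients T g).

Definition partial (f : 'cV[R]_d -> R) (i : 'I_d) (y : 'cV[R]_d) : R :=
  derive f y (delta_mx i ord0 : 'cV[R]_d).

Definition gradient (f : 'cV[R]_d -> R) (y : 'cV[R]_d) : 'cV[R]_d :=
  \col_i partial f i y.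

Definition hessian (f : 'cV[R]_d -> R) (y : 'cV[R]_d) : 'M[R]_d :=
  \matrix_(i, j) partial (partial f i) j y.

Definition C2 (f : 'cV[R]_d -> R) : Prop :=
  continuous f /\
  (forall i, (forall y, derivable f y (delta_mx i ord0 : 'cV[R]_d)) /\
             continuous (partial f i)) /\
  (forall i j,
     (forall y, derivable (partial f i) y (delta_mx j ord0 : 'cV[R]_d)) /\
     continuous (partial (partial f i) j)).

Definition hessian_norms (V : 'cV[R]_d -> R) : set R :=
  range (fun y => hsnorm (hessian V y)).

Definition half_hessian_sup (V : 'cV[R]_d -> R) : R :=
  sup (hessian_norms V) / 2.

Record HD (q : nat) (T : R) (b : R -> 'cV[R]_d -> 'cV[R]_d)
    (sigma : R -> 'cV[R]_d -> 'M[R]_(d, q)) (alpha : R)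
    (V : 'cV[R]_d -> R) (CV Cb Csigma : R) : Prop := {
  HD_C2 : C2 V ;
  HD_pos : forall y, 0 < V y ;
  HD_CV : 0 < CV ;
  HD_grad : forall y, hsnorm (gradient V y) ^+ 2 <= CV * V y ;
  HD_hess : has_ubound (hessian_norms V) ;
  HD_Cb : 0 < Cb ;
  HD_Csigma : 0 < Csigma ;
  HD_b : forall t y, 0 <= t <= T -> hsnorm (b t y) ^+ 2 <= Cb * V y ;
  HD_sigma : forall t y, 0 <= t <= T ->
    \tr (sigma t y *m (sigma t y)^T) <= Csigma * (V y `^ (1 - alpha)) }.

(* [U i] is the innovation written [U_{i+1}] on paper. *)
Definition euler_scheme (q : nat) (dO : measure_display)
    (Omega : measurableType dO) (P : probability Omega R)
    (b : R -> 'cV[R]_d -> 'cV[R]_d) (sigma : R -> 'cV[R]_d -> 'M[R]_(d, q))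
    (x : 'cV[R]_d) (Delta : R) (N : nat)
    (U : nat -> {RV P >-> borel_cV R q}) (X : nat -> {RV P >-> borel_cV R d})
    : Prop :=
  (forall w, X 0%N w = x) /\
  (forall i w, (i < N)%N ->
     let t := i%:R * Delta in
     let y : 'cV[R]_d := X i w in
     X i.+1 w = y + Delta *: b t y
                  + Num.sqrt Delta *: (sigma t y *m (U i w : 'cV[R]_q))).

End coefficients.

Section constants.
Context {R : realType}.

(* [lb], [ls] stand for the Lipschitz moduli of [b], [sigma]. *)
Definition CDelta (lb ls Delta : R) : R :=
  2 * lb + ls ^+ 2 + Delta * lb ^+ 2.

Definition varphi (Csigma beta lb ls Delta T : R) : R :=
  let C := CDelta lb ls Delta in
  Csigma * beta * ((1 + C * Delta) / (4 * C)) * expR (3 * C * T).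

Variables (T Delta alpha beta CV Cb Csigma eta : R).

Definition constC : R :=
  alpha * Num.sqrt (CV * Cb)
  + beta * Csigma * alpha ^+ 2 * (1 + 2 * eta * Delta) ^+ 2 * (CV + Cb)
  + alpha * eta * Cb * Delta.

Definition constK : R := Num.sqrt (CV * Cb) + eta * Cb * Delta.

(* For [eta = 0] the inverse is read as [+oo], whereas [0^-1 = 0] here. *)
Definition rho_low (eps : R) : R :=
  if eta == 0 then 1 / 2
  else 1 / 2 * Num.min 1
    (eps * (2 * eta * alpha * Csigma * T * expR (constC * T))^-1).

(* [v] stands for [V x] and [m2] for [E[|U|^2]]; the expectation inside [Psi1]
   and [Psi2] is finite since [(1 - alpha) / (2 alpha) <= 1]. *)
Variables (q : nat) (mu : probability (borel_cV R q) R) (v : R).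
Let m2 : R := sq_moment mu.

Definition half_log_moment (eps : R) : R :=
  1 / 2 * ln (fine (exp_sq_moment mu (eps * (1 - alpha) / (2 * alpha)))).

Definition Psi1 (eps : R) : R :=
  let rho := rho_low eps in
  expR ((2 * alpha - 1) / alpha * (rho `^ (- ((1 - alpha) / (2 * alpha - 1)))))
  * expR (rho * ((1 - alpha) / alpha) * expR (constC * T) * (v `^ alpha)
          + half_log_moment eps)
  + (v `^ (1 - alpha) + (Csigma * m2 / constK) `^ ((1 - alpha) / alpha))
    * expR ((1 - alpha) * constK * T).

Definition Psi2 (eps : R) : R :=
  let rho := rho_low eps in
  rho `^ (- ((1 - alpha) / (2 * alpha - 1))) * ((2 * alpha - 1) / alpha)
  + rho * ((1 - alpha) / alpha) * expR (constC * T) * (v `^ alpha)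
  + half_log_moment eps.

Definition K31 (eps : R) : R := Num.max (Psi1 eps) (Psi2 eps).

Definition lam32_exponent : R :=
  2 * eta * alpha * Csigma * T * expR (constC * T).

Definition K32 (lam : R) : R :=
  lam ^+ 2 * expR (constC * T)
  * (2 * (v `^ (1 / 2)) + 2 * eta * alpha * Csigma * m2 * T).

End constants.

Definition Phi_super (R : realType) (alpha K phi : R) (rho : R) : \bar R :=
  (K * Num.max phi (phi `^ (alpha / (2 * alpha - 1)))
     * Num.max (rho ^+ 2) (rho `^ (2 * alpha / (2 * alpha - 1))))%:E.

Definition Phi_half (R : realType) (K lam phi : R) (rho : R) : \bar R :=
  if 0 <= rho < (Num.sqrt phi)^-1 * lam then
    let u := rho * Num.sqrt phi / lam in (K * (u ^+ 2 / (1 - u)))%:E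
  else +oo%E.

(* Main.v *)
(* By Kantorovich-Rubinstein duality and the Donsker-Varadhan inequality, a
   transport-entropy inequality follows from a bound on
   [log E exp (lam (f (X_N) - E f (X_N)))], uniform over 1-Lipschitz [f].
   Let [v_i y = E (f (X_N) | X_i = y)]; it is Lipschitz with constant
   [(1 + C Delta)^((N - i)/2)], so that by GC the fluctuation of
   [lam v_{i+1} (X_{i+1})] given [X_i = y] costs at most
   [k_i y = beta lam^2 (1 + C Delta)^(N - 1 - i) Delta |sigma(t_i, y)|^2] after a
   Cauchy-Schwarz splitting. This cost is not bounded; it is absorbed by weights
   [H_i] with [E (exp (H_{i+1} (X_{i+1})) | X_i = y) <= exp (H_i y - k_i y)], which make
   [exp (lam v_i + H_i / 2)] a supermartingale along the scheme. The weights are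
   [H_i = rho_i V^alpha + c_i], where the Lyapunov function satisfies an
   exponential one-step bound and [rho_i] solves a discrete Riccati inequality.
   For [alpha > 1/2], Young's inequality bounds [V^(1 - alpha)] by a small multiple
   of [V^alpha]. For [alpha = 1/2], the condition [E exp (kap |U|^2) <= 2] with
   [kap = lam32^2 lam32_exponent] is turned into GC with constant [27 / (4 kap)],
   which keeps the Riccati solution finite up to the stated threshold. *)
From HB Require Import structures.
Require Import Defs.
From mathcomp Require Import all_boot all_order all_algebra.
From mathcomp Require Import all_classical all_reals all_analysis.
From mathcomp Require Import measurable_realfun ring lra.
Import Order.TTheory GRing.Theory Num.Theory.
Import numFieldNormedType.Exports.
Local Open Scope classical_set_scope.
Local Open Scope ring_scope.

Set Implicit Arguments.
Unset Strict Implicit.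
Unset Printing Implicit Defensive.

(** * Euclidean norm *)

(** Two concentration constants are at work. [beta] prices the fluctuation of the conditional
    expectations of [f]; a separate [b0] controls the Lyapunov function. For [alpha > 1/2], [b0] is
    fixed from [mu] before [beta] is quantified, so that [eps = 1 / (2 * b0)] depends on [mu] alone.
    For [alpha = 1/2] it is recovered from the condition on [lam32], which ties the blow-up of the
    Riccati solution to the threshold. The slack in the constants has one main source: the
    accumulated variance is at most 16/27 of what [varphi] allows, because [e - 1 <= 4/27 * e^3].
    The reciprocal 27/16 pays for a growth factor [exp (1/8)] of the weights when [alpha > 1/2], and
    is the value that [b0 * kap / 4] may reach when [alpha = 1/2]. Large [lam] is an obstacle for
    [alpha > 1/2]: a bound on an exponential moment can be raised only to powers at most 1. So
    [varphi * lam^2] is split into its minimum and its maximum with 1. The minimum serves as such a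
    power, the maximum enters Young's inequality, and this produces the two maxima in
    [Phi_super]. *)

Lemma sum_CauchySchwarz (R : realType) (I : finType) (a b : I -> R) :
  (\sum_i a i * b i) ^+ 2 <= (\sum_i a i ^+ 2) * (\sum_i b i ^+ 2).
Proof.
(* Lagrange's identity: this double sum is twice the gap between the two sides. *)
have : 0 <= \sum_i \sum_j (a i * b j - a j * b i) ^+ 2.
  by apply: sumr_ge0 => i _; apply: sumr_ge0 => j _; exact: sqr_ge0.
rewrite (eq_bigr (fun i => a i ^+ 2 * (\sum_j b j ^+ 2)
  - 2 * (a i * b i) * (\sum_j a j * b j) + b i ^+ 2 * \sum_j a j ^+ 2)); last first.
  move=> i _; rewrite !mulr_sumr -sumrB -big_split /=.
  by apply: eq_bigr => j _; ring.
rewrite big_split sumrB /= -!mulr_suml -mulr_sumr.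
set s := \sum_i a i * b i; nra.
Qed.

Section hsnorm.
Context {R : realType}.

Lemma hsnorm_ge0 m n (A : 'M[R]_(m, n)) : 0 <= hsnorm A.
Proof. exact: sqrtr_ge0. Qed.

Lemma hsnorm_sqr m n (A : 'M[R]_(m, n)) :
  hsnorm A ^+ 2 = \sum_(p : 'I_m * 'I_n) A p.1 p.2 ^+ 2.
Proof.
rewrite sqr_sqrtr; last first.
  by apply: sumr_ge0 => i _; apply: sumr_ge0 => j _; exact: sqr_ge0.
by rewrite (pair_bigA _ (fun i j => A i j ^+ 2)).
Qed.

Lemma hsnorm_col_sqr n (u : 'cV[R]_n) : hsnorm u ^+ 2 = \sum_i u i ord0 ^+ 2.
Proof.
rewrite hsnorm_sqr -(pair_bigA _ (fun i j => u i j ^+ 2))/=.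
by apply: eq_bigr => i _; rewrite big_ord1.
Qed.

Lemma hsnorm0 m n : hsnorm (0 : 'M[R]_(m, n)) = 0.
Proof.
rewrite /hsnorm big1 ?sqrtr0// => i _.
by rewrite big1// => j _; rewrite mxE expr0n.
Qed.

Lemma hsnormZ m n (k : R) (A : 'M[R]_(m, n)) : hsnorm (k *: A) = `|k| * hsnorm A.
Proof.
apply/eqP; rewrite -(eqrXn2 (n := 2))// ?mulr_ge0 ?hsnorm_ge0//.
rewrite exprMn !hsnorm_sqr mulr_sumr; apply/eqP/eq_bigr => i _.
by rewrite mxE exprMn real_normK// num_real.
Qed.

Lemma hsnormN m n (A : 'M[R]_(m, n)) : hsnorm (- A) = hsnorm A.
Proof. by rewrite -scaleN1r hsnormZ normrN1 mul1r. Qed.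

Lemma hsnormBC m n (A B : 'M[R]_(m, n)) : hsnorm (A - B) = hsnorm (B - A).
Proof. by rewrite -hsnormN opprB. Qed.

Lemma le_dot_hsnorm m n (A B : 'M[R]_(m, n)) :
  \sum_(p : 'I_m * 'I_n) A p.1 p.2 * B p.1 p.2 <= hsnorm A * hsnorm B.
Proof.
apply: le_trans (ler_norm _) _.
rewrite -(ler_pXn2r (n := 2)) ?nnegrE ?mulr_ge0 ?hsnorm_ge0//.
rewrite real_normK ?num_real// exprMn !hsnorm_sqr.
exact: (sum_CauchySchwarz (fun p => A p.1 p.2) (fun p => B p.1 p.2)).
Qed.

Lemma le_dot_hsnorm_col n (u v : 'cV[R]_n) :
  \sum_i u i ord0 * v i ord0 <= hsnorm u * hsnorm v.
Proof.
apply: le_trans (le_dot_hsnorm u v).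
rewrite -(pair_bigA _ (fun i j => u i j * v i j))/=.
by rewrite le_eqVlt; apply/orP; left; apply/eqP/eq_bigr => i _; rewrite big_ord1.
Qed.

Lemma hsnormD_sqr m n (A B : 'M[R]_(m, n)) :
  hsnorm (A + B) ^+ 2 = hsnorm A ^+ 2
    + 2 * (\sum_(p : 'I_m * 'I_n) A p.1 p.2 * B p.1 p.2) + hsnorm B ^+ 2.
Proof.
rewrite !hsnorm_sqr mulr_sumr -!big_split/=; apply: eq_bigr => p _.
by rewrite mxE; ring.
Qed.

Lemma ler_hsnormD m n (A B : 'M[R]_(m, n)) :
  hsnorm (A + B) <= hsnorm A + hsnorm B.
Proof.
rewrite -(ler_pXn2r (n := 2)) ?nnegrE ?addr_ge0 ?hsnorm_ge0//.
rewrite hsnormD_sqr sqrrD lerD2r lerD2l mulr2n.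
have := le_dot_hsnorm A B; lra.
Qed.

Lemma ler_hsnorm_dist m n (A B : 'M[R]_(m, n)) :
  `|hsnorm A - hsnorm B| <= hsnorm (A - B).
Proof.
rewrite ler_norml; apply/andP; split.
  have := ler_hsnormD (B - A) A; rewrite subrK hsnormBC; lra.
have := ler_hsnormD (A - B) B; rewrite subrK; lra.
Qed.

Lemma hsnorm_mulmx m n p (A : 'M[R]_(m, n)) (B : 'M[R]_(n, p)) :
  hsnorm (A *m B) <= hsnorm A * hsnorm B.
Proof.
rewrite -(ler_pXn2r (n := 2)) ?nnegrE ?mulr_ge0 ?hsnorm_ge0//.
rewrite exprMn !hsnorm_sqr.
rewrite -(pair_bigA _ (fun i j => A i j ^+ 2)) -(pair_bigA _ (fun i j => B i j ^+ 2)).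
rewrite -(pair_bigA _ (fun i j => (A *m B) i j ^+ 2))/= mulr_suml.
apply: ler_sum => i _; rewrite exchange_big /= mulr_sumr; apply: ler_sum => j _.
rewrite mxE; exact: sum_CauchySchwarz.
Qed.

Lemma mxtrace_mulmx_tr m n (A : 'M[R]_(m, n)) : \tr (A *m A^T) = hsnorm A ^+ 2.
Proof.
rewrite hsnorm_sqr -(pair_bigA _ (fun i j => A i j ^+ 2))/=.
by apply: eq_bigr => i _; rewrite mxE; apply: eq_bigr => j _; rewrite mxE.
Qed.

Lemma norm_coord_le_hsnorm m n (A : 'M[R]_(m, n)) i j : `|A i j| <= hsnorm A.
Proof.
rewrite -(ler_pXn2r (n := 2)) ?nnegrE ?hsnorm_ge0//.
rewrite real_normK ?num_real// hsnorm_sqr (bigD1 (i, j))//= lerDl.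
by apply: sumr_ge0 => p _; exact: sqr_ge0.
Qed.

Lemma hsnorm_eq0 m n (A : 'M[R]_(m, n)) : (hsnorm A == 0) = (A == 0).
Proof.
apply/eqP/eqP => [A0|->]; last exact: hsnorm0.
apply/matrixP => i j; apply/eqP; rewrite mxE -normr_le0 -A0.
exact: norm_coord_le_hsnorm.
Qed.

Lemma hsnorm_gt0 m n (A : 'M[R]_(m, n)) : (0 < hsnorm A) = (A != 0).
Proof. by rewrite lt0r hsnorm_eq0 hsnorm_ge0 andbT. Qed.

Lemma hsnorm_le_mx_norm m n (A : 'M[R]_(m, n)) :
  hsnorm A <= (m * n)%:R * `|A|.
Proof.
have N0 : 0 <= (m * n)%:R * `|A| :> R by rewrite mulr_ge0.
rewrite -(ler_pXn2r (n := 2)) ?nnegrE ?hsnorm_ge0// hsnorm_sqr exprMn.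
apply: (@le_trans _ _ (\sum_(p : 'I_m * 'I_n) `|A| ^+ 2)).
  apply: ler_sum => p _; rewrite -real_normK ?num_real// ler_pXn2r ?nnegrE//.
  have -> : `|A| = mx_norm A by [].
  by rewrite mx_normrE; exact: (le_bigmax_cond _ (fun i : 'I_m * 'I_n => `|A i.1 i.2|) (isT : xpredT p)).
rewrite sumr_const card_prod !card_ord -[_ *+ (m * n)]mulr_natl ler_wpM2r//.
by rewrite -natrX ler_nat expnS expn1; case: (m * n)%N => // k; rewrite leq_pmulr.
Qed.

End hsnorm.

Definition lipschitz_hs (R : realType) (d : nat) (L : R) (f : 'cV[R]_d -> R) :=
  forall u v, `|f u - f v| <= L * hsnorm (u - v).

Section lipschitz_hs.
Context {R : realType} {d : nat}.
Implicit Types (f g : 'cV[R]_d -> R) (L : R).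

Lemma lipschitz1P f : lipschitz1 f <-> lipschitz_hs 1 f.
Proof. by split => h u v; have := h u v; rewrite mul1r. Qed.

Lemma le_lipschitz_hs L f : (forall u v, f u - f v <= L * hsnorm (u - v)) ->
  lipschitz_hs L f.
Proof.
move=> h u v; rewrite ler_norml; apply/andP; split => //.
have := h v u; rewrite hsnormBC; lra.
Qed.

Lemma hsnorm_lipschitz1 : lipschitz1 (@hsnorm R d 1).
Proof. by move=> u v; exact: ler_hsnorm_dist. Qed.

Lemma lipschitz_hs_continuous L f : lipschitz_hs L f -> continuous f.
Proof.
move=> lf x.
(* The topology comes from the sup norm, hence the factor [d]; adding 1 keeps the divisor positive
   when [L] or [d] vanishes. *)
have K0 : 0 < `|L| * (d * 1)%:R + 1 by rewrite ltr_wpDl// mulr_ge0.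
move=> A /(nbhs_ballP (f x)) [e /= e0 eA].
apply/(nbhs_ballP x); exists (e / (`|L| * (d * 1)%:R + 1)); first exact: divr_gt0.
move=> y; rewrite -ball_normE /= => xy; apply: eA; rewrite -ball_normE /=.
apply: (le_lt_trans (lf x y)).
apply: (@le_lt_trans _ _ ((`|L| * (d * 1)%:R + 1) * `|x - y|)).
  rewrite mulrDl mul1r -mulrA.
  apply: le_trans (_ : _ <= `|L| * ((d * 1)%:R * `|x - y|)) _; last by rewrite lerDl.
  apply: (@le_trans _ _ (`|L| * hsnorm (x - y))).
    by rewrite ler_wpM2r ?hsnorm_ge0// ler_norm.
  by rewrite ler_wpM2l// hsnorm_le_mx_norm.
by rewrite mulrC -ltr_pdivlMr.
Qed.

End lipschitz_hs.

(** * Borel measurability and exponential moments *)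

Section borel_mx.
Context {R : realType}.

Lemma continuous_borel_measurable m n (f : 'M[R]_(m, n) -> R) :
  continuous f -> measurable_fun [set: borel_mx R m n] f.
Proof.
move=> /continuousP cf; apply: (measurability _ (RGenOpens.measurableE R)).
move=> _ [_ [a [b ->] <-]]; rewrite setTI; apply: sub_sigma_algebra.
exact/cf/interval_open.
Qed.

Lemma rat_cV_dense n (y : 'cV[R]_n) (e : R) : 0 < e ->
  exists c : 'cV[rat]_n, forall i, `|y i ord0 - ratr (c i ord0)| < e.
Proof.
move=> e0.
have h i : {q : rat | `|y i ord0 - ratr q| < e}.
  apply: cid; have /rat_in_itvoo[q] : y i ord0 - e < y i ord0 + e by lra.
  by rewrite in_itv/= => /andP[h1 h2]; exists q; rewrite ltr_norml; lra.
by exists (\col_i sval (h i)) => i; rewrite mxE; case: (h i).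
Qed.

(** The Borel sets are generated by all open sets, not by rectangles. An open set is the countable
    union of the boxes with rational centre and radius [1 / n.+1] that it contains, and preimages of
    boxes are finite intersections of coordinate preimages. *)
Lemma measurable_coord_cV dT (T : measurableType dT) n (F : T -> 'cV[R]_n) :
  (forall i, measurable_fun setT (fun t => F t i ord0)) ->
  measurable_fun setT (F : T -> borel_cV R n).
Proof.
move=> mF; apply: (@measurability _ _ T (borel_cV R n) setT F (@open 'cV[R]_n) erefl).
move=> _ [B oB <-]; rewrite setTI.
pose box (p : 'cV[rat]_n * nat) := [set y : 'cV[R]_n |
  forall i, `|y i ord0 - ratr (p.1 i ord0)| < p.2.+1%:R^-1].
have mbox p : measurable (F @^-1` box p).
  rewrite (_ : _ @^-1` _ = \bigcap_(i in [set: 'I_n])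
      [set t | `|F t i ord0 - ratr (p.1 i ord0)| < p.2.+1%:R^-1]); last first.
    by apply/seteqP; split=> t /= h i; [move=> _; exact: h|exact: (h i I)].
  apply: fin_bigcap_measurable => // i _.
  rewrite (_ : [set t | _] = (fun t => F t i ord0) @^-1`
    `]ratr (p.1 i ord0) - p.2.+1%:R^-1, ratr (p.1 i ord0) + p.2.+1%:R^-1[%classic).
    by rewrite -[X in measurable X]setTI; exact: mF.
  by apply/seteqP; split=> t /=; rewrite in_itv/= ltr_norml; move: (p.2.+1%:R^-1 : R) (ratr _) (F _ _ _) => k r s /andP[h1 h2]; apply/andP; split; lra.
rewrite (_ : F @^-1` B = \bigcup_p (if `[< box p `<=` B >] then F @^-1` box p else set0)).
  by apply: countable_bigcupT_measurable => // p; case: ifP.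
apply/seteqP; split=> t /=; last first.
  by case=> p _; case: ifPn => // /asboolP; exact.
move=> Bt.
have : nbhs (F t) B by rewrite nbhsE; exists B.
move=> /(nbhs_ballP (F t)) [e /= e0 eB].
have [k _ ke] : exists2 k, True & k.+1%:R^-1 < e / 2.
  have [k] := ltr_add_invr (ltac:(lra) : 0 < e / 2 :> R); rewrite add0r => ?.
  by exists k.
have k0 : 0 < k.+1%:R^-1 :> R by rewrite invr_gt0.
have [c hc] := rat_cV_dense (F t) k0.
exists (c, k) => //; rewrite ifT//; apply/asboolP => z /= hz.
apply: eB; split => // i j; rewrite ord1 -ball_normE /=.
move: (hz i) (hc i); rewrite /= !ltr_norml.
by move: (k.+1%:R^-1 : R) ke => w we /andP[? ?] /andP[? ?]; apply/andP; split; lra.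
Qed.

End borel_mx.

Section expR_facts.
Context {R : realType}.
Implicit Types (x y w : R).

(** Both values lie above the tangent of [expR] at the barycentre [z]; averaging the two tangent
    bounds removes the slope. *)
Lemma convex_expR_le w x y : 0 <= w <= 1 ->
  expR (w * x + (1 - w) * y) <= w * expR x + (1 - w) * expR y.
Proof.
move=> /andP[w0 w1]; set z := w * x + _.
have h (t : R) : expR z * (1 + (t - z)) <= expR t.
  have -> : expR t = expR z * expR (t - z) by rewrite -expRD; congr expR; ring.
  by rewrite ler_pM2l ?expR_gt0// expR_ge1Dx.
have := h x; have := h y; have := expR_gt0 z.
have -> : expR z = w * (expR z * (1 + (x - z))) + (1 - w) * (expR z * (1 + (y - z))).
  by rewrite /z; ring.
move=> _ hy hx; apply: lerD; apply: ler_wpM2l => //; lra.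
Qed.

End expR_facts.

(* [mgf_le P f c] is the inequality [E[exp f] <= exp c]; measurability is
   included because the integral of a nonnegative function is always defined. *)
Definition mgf_le (R : realType) dT (T : measurableType dT) (P : probability T R)
    (f : T -> R) (c : R) : Prop :=
  measurable_fun setT f /\ (\int[P]_t (expR (f t))%:E <= (expR c)%:E)%E.

Section expectation.
Context {R : realType} dT (T : measurableType dT) (P : probability T R).
Implicit Types (f g : T -> R) (a b c w : R).

Lemma prob_integrable_cst c : P.-integrable setT (EFin \o cst c).
Proof. exact: finite_measure_integrable_cst. Qed.

Lemma Rexpect_cst c : \int[P]_t (cst c t) = c.
Proof. by rewrite Rintegral_cst// [X in fine X]probability_setT mulr1. Qed.

Lemma integrable_le f g : measurable_fun setT f ->
  (forall t, `|f t| <= g t) -> P.-integrable setT (EFin \o g) ->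
  P.-integrable setT (EFin \o f).
Proof.
move=> mf fg Ig; apply: le_integrable Ig => //; first exact/measurable_EFinP.
by move=> t _ /=; rewrite lee_fin (le_trans (fg t))// ler_norm.
Qed.

Lemma integrable_EFinZ (k : R) f : P.-integrable setT (EFin \o f) ->
  P.-integrable setT (EFin \o (fun t => k * f t)).
Proof. by move=> If; exact: (@integrableZl _ _ _ _ _ measurableT k _ If). Qed.

Lemma integrable_EFinD f g : P.-integrable setT (EFin \o f) ->
  P.-integrable setT (EFin \o g) ->
  P.-integrable setT (EFin \o (fun t => f t + g t)).
Proof. by move=> If Ig; exact: (@integrableD _ _ _ _ _ measurableT _ _ If Ig). Qed.

Lemma integrable_EFinB f g : P.-integrable setT (EFin \o f) ->
  P.-integrable setT (EFin \o g) ->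
  P.-integrable setT (EFin \o (fun t => f t - g t)).
Proof. by move=> If Ig; exact: (@integrableB _ _ _ _ _ measurableT _ _ If Ig). Qed.

Lemma integrable_measurable f : P.-integrable setT (EFin \o f) ->
  measurable_fun setT f.
Proof. by move=> /measurable_int /measurable_EFinP. Qed.

Lemma Rexpect_EFin f : P.-integrable setT (EFin \o f) ->
  (\int[P]_t (f t)%:E)%E = (\int[P]_t f t)%:E.
Proof. by move=> If; rewrite /Rintegral fineK//; exact: integrable_fin_num. Qed.

Lemma mgf_le_integrable f c : mgf_le P f c ->
  P.-integrable setT (EFin \o (fun t => expR (f t))).
Proof.
move=> [mf le]; apply/integrableP; split.
  by apply/measurable_EFinP; exact: measurableT_comp.
rewrite (eq_integral (fun t => (expR (f t))%:E)); last first.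
  by move=> t _ /=; rewrite ger0_norm// expR_ge0.
exact: le_lt_trans le (ltry _).
Qed.

Lemma integrable_expR_mgf_le f c : measurable_fun setT f ->
  (P.-integrable setT (EFin \o (fun t => expR (f t))) /\
   \int[P]_t expR (f t) <= expR c) <-> mgf_le P f c.
Proof.
move=> mf; split=> [[If le]|le].
  by split=> //; rewrite (Rexpect_EFin If) lee_fin.
split; first exact: mgf_le_integrable le.
by have [_] := le; rewrite (Rexpect_EFin (mgf_le_integrable le)) lee_fin.
Qed.

Lemma mgf_le_le f g c : measurable_fun setT f -> (forall t, f t <= g t) ->
  mgf_le P g c -> mgf_le P f c.
Proof.
move=> mf fg [mg le]; split=> //; apply: le_trans le.
apply: ge0_le_integral => //.
- by apply/measurable_EFinP; exact: measurableT_comp.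
- by apply/measurable_EFinP; exact: measurableT_comp.
- by move=> t _; rewrite lee_fin ler_expR.
Qed.

Lemma mgf_leW f a b : a <= b -> mgf_le P f a -> mgf_le P f b.
Proof. by move=> ab [mf le]; split=> //; apply: le_trans le _; rewrite lee_fin ler_expR. Qed.

Lemma mgf_leD f a c : mgf_le P f a -> mgf_le P (fun t => f t + c) (a + c).
Proof.
move=> fa; have [mf _] := fa; have [If le] := (integrable_expR_mgf_le a mf).2 fa.
have mfc : measurable_fun setT (fun t => f t + c) by exact: measurable_funD.
apply/(integrable_expR_mgf_le _ mfc).
have e : (fun t => expR (f t + c)) = (fun t => expR c * expR (f t)).
  by apply/funext => t; rewrite expRD mulrC.
rewrite e; split; first exact: integrable_EFinZ.
by rewrite RintegralZl// expRD mulrC ler_pM2r ?expR_gt0.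
Qed.

(* Hölder's inequality for exponentials, from the convexity of [expR]. *)
Lemma mgf_le_convex f g a b w : 0 <= w <= 1 ->
  mgf_le P f a -> mgf_le P g b ->
  mgf_le P (fun t => w * f t + (1 - w) * g t) (w * a + (1 - w) * b).
Proof.
move=> w01 fa gb; have [mf _] := fa; have [mg _] := gb.
have /andP[w0 w1] := w01.
have fa' := mgf_leD (- a) fa; have gb' := mgf_leD (- b) gb.
rewrite subrr in fa'; rewrite subrr in gb'.
have [If lf] := (integrable_expR_mgf_le 0 fa'.1).2 fa'.
have [Ig lg] := (integrable_expR_mgf_le 0 gb'.1).2 gb'.
set h := fun t => w * f t + (1 - w) * g t.
have mh : measurable_fun setT h by apply: measurable_funD; exact: measurable_funM.
have mh' : measurable_fun setT (fun t => h t - (w * a + (1 - w) * b)).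
  exact: measurable_funB.
suff : mgf_le P (fun t => h t - (w * a + (1 - w) * b)) 0.
  move=> /(mgf_leD (w * a + (1 - w) * b)); rewrite add0r.
  by congr mgf_le; apply/funext => t; rewrite subrK.
have hle t : expR (h t - (w * a + (1 - w) * b))
    <= w * expR (f t - a) + (1 - w) * expR (g t - b).
  apply: le_trans (convex_expR_le _ _ w01); rewrite ler_expR /h; lra.
have I1 := integrable_EFinZ w If; have I2 := integrable_EFinZ (1 - w) Ig.
have I12 := integrable_EFinD I1 I2.
have Ih : P.-integrable setT (EFin \o (fun t => expR (h t - (w * a + (1 - w) * b)))).
  apply: integrable_le I12 => [|t]; first exact: measurableT_comp.
  by rewrite ger0_norm ?expR_ge0.
apply/(integrable_expR_mgf_le _ mh'); split=> //.
apply: (@le_trans _ _ (\int[P]_t (w * expR (f t - a) + (1 - w) * expR (g t - b)))).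
  by apply: le_Rintegral => // t _; exact: hle.
rewrite RintegralD// !RintegralZl// expR0.
rewrite expR0 in lf; rewrite expR0 in lg.
have := ler_wpM2l w0 lf; have := ler_wpM2l (ltac:(lra) : 0 <= 1 - w) lg; lra.
Qed.

Lemma mgf_le_cst c : mgf_le P (cst c) c.
Proof.
split=> //; rewrite (eq_integral (cst (expR c)%:E))// integral_cst//.
by rewrite [X in (_ * X <= _)%E](probability_setT P) mule1.
Qed.

Lemma mgf_leZ f a w : 0 <= w <= 1 -> mgf_le P f a ->
  mgf_le P (fun t => w * f t) (w * a).
Proof.
move=> w01 fa; have := mgf_le_convex w01 fa (mgf_le_cst 0).
have -> : w * a + (1 - w) * 0 = w * a by lra.
by congr mgf_le; apply/funext => t; rewrite /cst; lra.
Qed.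

Lemma mgf_le_CauchySchwarz f g a b : mgf_le P (fun t => 2 * f t) (2 * a) ->
  mgf_le P (fun t => 2 * g t) (2 * b) -> mgf_le P (fun t => f t + g t) (a + b).
Proof.
move=> fa gb.
have := mgf_le_convex (ltac:(lra) : 0 <= (1 / 2 : R) <= 1) fa gb.
have e (x y : R) : 1 / 2 * (2 * x) + (1 - 1 / 2) * (2 * y) = x + y by lra.
rewrite e; congr mgf_le; apply/funext => t; exact: e.
Qed.

(** Obtained by integrating [1 + x <= exp x] at [x = f - a]. *)
Lemma mgf_le_Jensen f a : P.-integrable setT (EFin \o f) -> mgf_le P f a ->
  \int[P]_t f t <= a.
Proof.
move=> If fa; have [mf _] := fa.
have fa' := mgf_leD (- a) fa; rewrite subrr in fa'.
have [Ie le] := (integrable_expR_mgf_le 0 fa'.1).2 fa'.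
have I1 : P.-integrable setT (EFin \o (fun t => f t + (1 - a))).
  by apply: integrable_EFinD => //; exact: (prob_integrable_cst (1 - a)).
have : \int[P]_t (f t + (1 - a)) <= \int[P]_t expR (f t - a).
  by apply: le_Rintegral => // t _; apply: le_trans (expR_ge1Dx _); lra.
rewrite RintegralD//; last exact: (prob_integrable_cst (1 - a)).
by have := Rexpect_cst (1 - a); rewrite /cst => ->; rewrite expR0 in le; lra.
Qed.

End expectation.

(** * Taylor expansion and Lyapunov functions *)

(** Both signs of [h] are covered because the increments in [C1_alongD] approach 0 from both
    sides. *)
Lemma mean_value_sym (R : realType) (f df : R -> R) (h : R) :
  (forall s : R, is_derive s (1 : R) f (df s)) ->
  exists2 c, `|c| <= `|h| & f h - f 0 = df c * h.
Proof.
move=> fdf.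
have cf (A : set R) : {within A, continuous f}.
  apply: continuous_subspaceT => x.
  by apply: differentiable_continuous; apply/derivable1_diffP; exact: ex_derive.
have [h0|h0|->] := ltgtP h 0.
- have [c] := MVT h0 (fun x _ => fdf x) (cf _).
  rewrite in_itv/= => /andP[c1 c2] e; exists c; last by lra.
  by rewrite !ltr0_norm//; lra.
- have [c] := MVT h0 (fun x _ => fdf x) (cf _).
  rewrite in_itv/= => /andP[c1 c2] e; exists c; last by lra.
  by rewrite !gtr0_norm//; lra.
- by exists 0 => //; rewrite subrr mulr0.
Qed.

Lemma is_deriveP (R : realType) (W : normedModType R) (f : W -> R) (x v : W) (l : R) : is_derive x v f l <->
  (fun h => h^-1 *: ((f \o shift x) (h *: v) - f x)) @ 0^' --> l.
Proof.
split=> [[fx <-]|fl]; first exact: fx.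
split; first by apply/cvg_ex; exists l.
exact: cvg_lim.
Qed.

Section directional_derivatives.
Context {R : realType} {W : normedModType R}.
Implicit Types (f g : W -> R) (x u v : W).

Lemma is_derive_line f x v g (t : R) : (forall y, is_derive y v f (g y)) ->
  is_derive t (1 : R) (fun s : R => f (s *: v + x)) (g (t *: v + x)).
Proof.
move=> fg; apply/is_deriveP; have := (is_deriveP f (t *: v + x) v (g (t *: v + x))).1 (fg _).
have -> // : (fun h : R => h^-1 *: ((f \o shift (t *: v + x)) (h *: v) - f (t *: v + x)))
  = (fun h : R => h^-1 *:
    (((fun s : R => f (s *: v + x)) \o shift t) (h *: (1 : R)) - f (t *: v + x))).
by apply/funext => h /=; rewrite addrA -scalerDl -[h *: 1]/(h * 1) mulr1.
Qed.

(** [C2] only speaks of coordinate directions. Keeping a directional derivative together with its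
    continuity gives a notion stable under scaling and adding directions, so every direction is
    reached from the partial derivatives. *)
Definition C1_along f v g := (forall y, is_derive y v f (g y)) /\ continuous g.

Lemma C1_alongZ f v g (k : R) : C1_along f v g ->
  C1_along f (k *: v) (fun y => k * g y).
Proof.
move=> [fg cg]; split; last first.
  by move=> y; apply: cvgM; [exact: cvg_cst|exact: cg].
move=> y; have [->|k0] := eqVneq k 0.
  by rewrite scale0r mul0r; exact: is_derive0.
apply/is_deriveP/cvgrPdist_lt => e e0.
have /is_deriveP/cvgrPdist_lt := fg y.
have ek : 0 < e / `|k| by rewrite divr_gt0// normr_gt0.
move=> /(_ _ ek) /nbhs_ballP [r /= r0 hr].
apply/nbhs_ballP; exists (r / `|k|); first by rewrite /= divr_gt0// normr_gt0.
move=> h; rewrite /ball /= sub0r normrN => hb h0.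
have := hr (k * h); rewrite /ball /= sub0r normrN normrM => /(_ _)/(_ _).
rewrite mulrC -ltr_pdivlMr ?normr_gt0// => /(_ hb).
rewrite mulf_neq0// => /(_ isT).
rewrite ltr_pdivlMr ?normr_gt0// mulrC -normrM; congr (`|_| < _).
rewrite mulrBr; congr (_ - _).
rewrite /= scalerA [h * k]mulrC; set D := f _ - f y.
change (k * ((k * h)^-1 * D) = h^-1 * D).
by rewrite invfM !mulrA divff// mul1r.
Qed.

Lemma C1_alongD f u v gu gv : C1_along f u gu -> C1_along f v gv ->
  C1_along f (u + v) (fun y => gu y + gv y).
Proof.
move=> [fu cu] [fv cv]; split; last first.
  by move=> y; apply: cvgD; [exact: cu|exact: cv].
move=> y; apply/is_deriveP.
(* [A h] is the difference quotient along [v], but from the moving base point [y + h u]. The mean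
   value theorem turns it into [gv] at a point close to [y], and continuity of [gv] gives the
   limit. *)
pose A h := h^-1 * (f (h *: v + (h *: u + y)) - f (h *: u + y)).
rewrite (_ : (fun h => _) = (fun h : R =>
    h^-1 *: ((f \o shift y) (h *: u) - f y) + A h)); last first.
  apply/funext => h; rewrite /A /= [h *: (u + v)]scalerDr [h *: u + h *: v]addrC -addrA.
  set b := f y; set a := f _; set c := f _.
  change (h^-1 * (a - b) = h^-1 * (c - b) + h^-1 * (a - c)); ring.
apply: cvgD; first by apply/is_deriveP.
apply/cvgrPdist_lt => e e0.
have := cv y; move=> /cvgrPdist_lt => /(_ _ e0) /nbhs_ballP[r /= r0 hr].
have N0 : 0 < `|u| + `|v| + 1 by rewrite ltr_wpDl// addr_ge0.
apply/nbhs_ballP; exists (r / (`|u| + `|v| + 1)); first exact: divr_gt0.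
move=> h; rewrite /ball /= sub0r normrN => hb h0.
have [c ch ec] := mean_value_sym h (fun s => is_derive_line (h *: u + y) s fv).
rewrite scale0r add0r in ec.
rewrite /A ec mulrC mulfK//; apply: hr; rewrite -ball_normE /=.
rewrite distrC addrA addrK; apply: le_lt_trans (ler_normD _ _) _; rewrite !normrZ.
rewrite ltr_pdivlMr// in hb.
have h1 : `|c| * `|v| <= `|h| * `|v| by rewrite ler_wpM2r.
have := normr_gt0 h; rewrite h0 => h2; nra.
Qed.

End directional_derivatives.

(** The intermediate point is strictly positive so that the theorem can be applied a second time on
    [[0, c]]. *)
Lemma mean_value_pos (R : realType) (f df : R -> R) (h : R) :
  (forall s : R, is_derive s (1 : R) f (df s)) -> 0 < h ->
  exists2 c, 0 < c < h & f h - f 0 = df c * h.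
Proof.
move=> fdf h0.
have cf : {within `[0, h], continuous f}.
  apply: continuous_subspaceT => x.
  by apply: differentiable_continuous; apply/derivable1_diffP; exact: ex_derive.
have [c] := MVT h0 (fun x _ => fdf x) cf.
by rewrite in_itv/= subr0; exists c.
Qed.

Section C2_taylor.
Context {R : realType} {d : nat}.
Implicit Types (f V : 'cV[R]_d -> R) (y h : 'cV[R]_d).

Lemma C1_along_partial f h :
  (forall i, (forall y, derivable f y (delta_mx i ord0 : 'cV[R]_d)) /\
             continuous (partial f i)) ->
  C1_along f h (fun y => \sum_i h i ord0 * partial f i y).
Proof.
move=> Hf.
have eh : h = \sum_(i <- index_enum 'I_d) h i ord0 *: delta_mx i ord0.
  by rewrite [LHS]matrix_sum_delta; apply: eq_bigr => i _; rewrite big_ord1.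
suff : C1_along f (\sum_(i <- index_enum 'I_d) h i ord0 *: delta_mx i ord0)
    (fun y => \sum_i h i ord0 * partial f i y) by rewrite -eh.
elim: (index_enum _) => [|i r IH].
  rewrite big_nil; split=> y.
    by rewrite big_nil; exact: is_derive0.
  have -> : (fun y => \sum_(i <- [::]) h i ord0 * partial f i y) = cst 0.
    by apply/funext => z; rewrite big_nil.
  exact: cst_continuous.
rewrite big_cons.
have -> : (fun y => \sum_(j <- i :: r) h j ord0 * partial f j y) =
    (fun y => h i ord0 * partial f i y + \sum_(j <- r) h j ord0 * partial f j y).
  by apply/funext => y; rewrite big_cons.
apply: C1_alongD IH; apply: C1_alongZ; split; last exact: (Hf i).2.
by move=> y; apply: derivableP; exact: (Hf i).1.
Qed.

Lemma C2_taylor V (eta : R) : C2 V ->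
  (forall y, hsnorm (hessian V y) <= 2 * eta) -> forall y h,
  V (y + h) <= V y + \sum_i h i ord0 * gradient V y i ord0 + eta * hsnorm h ^+ 2.
Proof.
move=> [_ [V1 V2]] Veta y h.
pose g1 (s : R) := \sum_i h i ord0 * partial V i (s *: h + y).
pose g2 (s : R) := \sum_i h i ord0 * \sum_j h j ord0 * partial (partial V i) j (s *: h + y).
have dg s : is_derive s (1 : R) (fun s => V (s *: h + y)) (g1 s).
  exact: is_derive_line (C1_along_partial h V1).1.
have dg1 s : is_derive s (1 : R) g1 (g2 s).
  have -> : g1 = \sum_i (fun s => h i ord0 *: partial V i (s *: h + y)).
    by apply/funext => t; rewrite fct_sumE.
  apply: is_derive_sum => i; apply: is_deriveZ.
  exact: is_derive_line (C1_along_partial h (V2 i)).1.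
have g2le s : g2 s <= 2 * eta * hsnorm h ^+ 2.
  (* The quadratic form is the entrywise inner product of [h h^T] with the Hessian, which
     Cauchy-Schwarz bounds by Hilbert-Schmidt norms. *)
  apply: (@le_trans _ _ (hsnorm (h *m h^T) * hsnorm (hessian V (s *: h + y)))).
    apply: le_trans (le_dot_hsnorm _ _).
    rewrite -(pair_bigA _ (fun i j => (h *m h^T) i j * hessian V (s *: h + y) i j))/=.
    apply: ler_sum => i _; rewrite mulr_sumr; apply: ler_sum => j _.
    by rewrite !mxE big_ord1 !mxE mulrA.
  have hh : hsnorm (h *m h^T) <= hsnorm h ^+ 2.
    rewrite expr2; apply: le_trans (hsnorm_mulmx _ _) _.
    rewrite ler_wpM2l ?hsnorm_ge0// -(ler_pXn2r (n := 2)) ?nnegrE ?hsnorm_ge0//.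
    by rewrite -!mxtrace_mulmx_tr trmxK mxtrace_mulC.
  rewrite mulrC; apply: ler_pM; rewrite ?hsnorm_ge0//.
(* Subtracting the claimed expansion leaves a function whose derivative is nonpositive on [[0, 1]];
   a second mean value step, applied to [g1], shows this. *)
pose k (s : R) := V (s *: h + y) - (g1 0 * s + eta * hsnorm h ^+ 2 * s ^+ 2).
have dk s : is_derive s (1 : R) k (g1 s - (g1 0 + 2 * eta * hsnorm h ^+ 2 * s)).
  rewrite /k; apply: is_deriveB.
  apply: is_derive_eq; rewrite /= -![_ *: _]/(_ * _); ring.
have [c /andP[c0 c1]] := mean_value_pos dk ltr01.
have [c' /andP[_ _] ec'] := mean_value_pos dg1 c0.
rewrite /k scale1r scale0r add0r [h + y]addrC => ek.
have : (g1 c - (g1 0 + 2 * eta * hsnorm h ^+ 2 * c)) * 1 <= 0.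
  have -> : g1 c = g1 0 + g2 c' * c by rewrite -ec'; ring.
  have := g2le c'; set A := 2 * eta * _ => le; nra.
rewrite -{}ek.
have -> : g1 0 = \sum_i h i ord0 * gradient V y i ord0.
  by apply: eq_bigr => i _; rewrite scale0r add0r mxE.
lra.
Qed.

End C2_taylor.

Section lyapunov.
Context {R : realType} {d : nat} (V : 'cV[R]_d -> R) (eta : R).
Hypothesis V0 : forall y, 0 < V y.
Hypothesis taylor : forall y h,
  V (y + h) <= V y + \sum_i h i ord0 * gradient V y i ord0 + eta * hsnorm h ^+ 2.
Hypothesis eta0 : 0 <= eta.

(** [V] stays positive after a step [- t * gradient], so the quadratic upper bound in [t] is
    nonnegative; its minimiser [t = 1 / (2 eta)] gives the claim. For [eta = 0] the bound is affine
    in [t], which forces the gradient to vanish. *)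
Lemma gradient_sqr_le y : hsnorm (gradient V y) ^+ 2 <= 4 * eta * V y.
Proof.
set G := hsnorm _ ^+ 2.
have G0 : 0 <= G by exact: sqr_ge0.
have h (t : R) : 0 <= V y - t * G + eta * t ^+ 2 * G.
  apply: le_trans (ltW (V0 (y - t *: gradient V y))) _.
  apply: le_trans (taylor _ _) _; rewrite hsnormN hsnormZ exprMn.
  rewrite real_normK ?num_real// -/G.
  have -> : \sum_i (- (t *: gradient V y)) i ord0 * gradient V y i ord0 = - (t * G).
    rewrite /G hsnorm_col_sqr mulr_sumr -sumrN; apply: eq_bigr => i _.
    by rewrite !mxE; ring.
  lra.
have Vy := V0 y; have [e0|en0] := eqVneq eta 0.
  rewrite leNgt; apply/negP => /[dup] + Gp; rewrite {1}e0 mulr0 mul0r => GP.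
  have := h (2 * V y / G); rewrite e0 !mul0r addr0 mulfVK ?gt_eqF//; lra.
have ep : 0 < eta by rewrite lt_neqAle eq_sym en0.
have := h (1 / (2 * eta)).
have -> : V y - 1 / (2 * eta) * G + eta * (1 / (2 * eta)) ^+ 2 * G = V y - G / (4 * eta).
  by field.
by rewrite subr_ge0 ler_pdivrMr ?mulr_gt0// mulrC.
Qed.

(** By [gradient_sqr_le] the gradient is at most [2 sqrt (eta V)], so the Taylor bound is dominated
    by a perfect square. *)
Lemma sqrt_lyapunov_lip y h :
  Num.sqrt (V (y + h)) <= Num.sqrt (V y) + Num.sqrt eta * hsnorm h.
Proof.
have N0 : 0 <= Num.sqrt (V y) + Num.sqrt eta * hsnorm h.
  by rewrite addr_ge0 ?mulr_ge0 ?sqrtr_ge0 ?hsnorm_ge0.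
rewrite -[leRHS]ger0_norm// -sqrtr_sqr ler_wsqrtr//.
apply: le_trans (taylor _ _) _.
rewrite sqrrD exprMn [Num.sqrt (V y) ^+ 2]sqr_sqrtr ?(ltW (V0 _))//.
rewrite [Num.sqrt eta ^+ 2]sqr_sqrtr// lerD2r lerD2l.
apply: le_trans (le_dot_hsnorm_col _ _) _.
have : hsnorm (gradient V y) <= 2 * (Num.sqrt eta * Num.sqrt (V y)).
  rewrite -(ler_pXn2r (n := 2)) ?nnegrE ?hsnorm_ge0 ?mulr_ge0 ?sqrtr_ge0//.
  rewrite !exprMn [Num.sqrt (V y) ^+ 2]sqr_sqrtr ?(ltW (V0 _))//.
  by rewrite [Num.sqrt eta ^+ 2]sqr_sqrtr// mulrA -natrX; exact: gradient_sqr_le.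
have := hsnorm_ge0 h; set s1 := Num.sqrt _; set s2 := Num.sqrt _ => ? ?.
rewrite mulr2n; nra.
Qed.

End lyapunov.

(** * Kantorovich-Rubinstein inequality *)

Section sublinear.
Context {R : realType} {W : lmodType R}.
Implicit Types (p q : W -> R) (u v h : W) (t : R).

Definition sublinear p := (forall u v, p (u + v) <= p u + p v) /\
  (forall t u, 0 <= t -> p (t *: u) = t * p u).

(** The usual Hahn-Banach improvement of [p]: a sublinear minorant that sends [- v] to at most
    [- p v], hence is linear on the line of [v]. *)
Definition linearize_along p v h : R :=
  inf [set p (h + t *: v) - t * p v | t in [set t | 0 <= t]].

Lemma sublinear0 p : sublinear p -> p 0 = 0.
Proof. by move=> [_ ph]; rewrite -(scale0r 0) ph// mul0r. Qed.

Lemma sublinearN p u : sublinear p -> - p (- u) <= p u.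
Proof. by move=> sp; have := sp.1 u (- u); rewrite subrr sublinear0//; lra. Qed.

Lemma linearize_along_le p v h t : sublinear p -> 0 <= t ->
  linearize_along p v h <= p (h + t *: v) - t * p v.
Proof.
move=> sp t0; apply: ge_inf; last by exists t.
exists (- p (- h)) => _ [s /= s0 <-].
by have := sp.1 (h + s *: v) (- h); rewrite [h + _]addrC addrK sp.2//; lra.
Qed.

Lemma linearize_along_ge p v h c : (forall t, 0 <= t -> c <= p (h + t *: v) - t * p v) ->
  c <= linearize_along p v h.
Proof.
move=> hc; apply: lb_le_inf; first by exists (p (h + 0 *: v) - 0 * p v); exists 0 => /=.
by move=> _ [s /= s0 <-]; exact: hc.
Qed.

Lemma linearize_along_sublinear p v : sublinear p -> sublinear (linearize_along p v).
Proof.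
move=> sp; have [pD pZ] := sp.
(* One inequality of homogeneity suffices: used with [t^-1], it gives the reverse one. *)
have lZ t u : 0 < t -> linearize_along p v (t *: u) <= t * linearize_along p v u.
  move=> t0; rewrite mulrC -ler_pdivrMr//; apply: linearize_along_ge => s s0.
  rewrite ler_pdivrMr//; apply: le_trans (linearize_along_le _ _ sp (mulr_ge0 (ltW t0) s0)) _.
  rewrite -scalerA -scalerDr (pZ _ _ (ltW t0)).
  by move: (p _) (p v) => X Y; rewrite le_eqVlt; apply/orP; left; apply/eqP; ring.
split=> [u w|t u]; last first.
  rewrite le_eqVlt => /predU1P[<-|t0].
    rewrite scale0r mul0r; apply/eqP; rewrite eq_le; apply/andP; split.
      apply: le_trans (linearize_along_le v 0 sp (lexx 0)) _.
      by rewrite scale0r addr0 mul0r subr0 sublinear0.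
    by apply: linearize_along_ge => s s0; rewrite add0r pZ// subrr.
  apply/eqP; rewrite eq_le lZ//= mulrC -ler_pdivlMr//.
  by have := lZ t^-1 (t *: u); rewrite scalerA mulVf ?gt_eqF// scale1r mulrC invr_gt0; apply.
(* The two infima have independent parameters [t] and [s]; the infimum for the sum is tested at
   [t + s]. *)
have h1 t s : 0 <= t -> 0 <= s -> linearize_along p v (u + w) <=
    (p (u + t *: v) - t * p v) + (p (w + s *: v) - s * p v).
  move=> t0 s0; apply: le_trans (linearize_along_le v _ sp (addr_ge0 t0 s0)) _.
  by have := pD (u + t *: v) (w + s *: v); rewrite addrACA -scalerDl; lra.
rewrite -lerBlDr; apply: linearize_along_ge => t t0.
rewrite lerBlDr -lerBlDl; apply: linearize_along_ge => s s0.
by rewrite lerBlDl; exact: h1.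
Qed.

Lemma linearize_along_dominated p v h : sublinear p -> linearize_along p v h <= p h.
Proof.
move=> sp; apply: le_trans (linearize_along_le v h sp (lexx 0)) _.
by rewrite scale0r addr0 mul0r subr0.
Qed.

Lemma linearize_alongN p v : sublinear p -> linearize_along p v (- v) <= - p v.
Proof.
move=> sp; apply: le_trans (linearize_along_le v (- v) sp ler01) _.
by rewrite scale1r addNr sublinear0// mul1r sub0r.
Qed.

(* Hahn-Banach for the span of [v] and of finitely many vectors: a minimal
   sublinear minorant is reached by linearising along one vector at a time. *)
Lemma HahnBanach_fin p v (s : seq W) : sublinear p ->
  exists q, [/\ sublinear q, forall h, q h <= p h, q (- v) = - p v &
    {in s, forall u, q (- u) = - q u}].
Proof.
move=> sp.
suff [q [sq qp qs]] : exists q, [/\ sublinear q,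
    forall h, q h <= linearize_along p v h & {in s, forall u, q (- u) = - q u}].
  have sN := sublinearN v sq; have vN := qp (- v); have vv := qp v.
  exists q; split => // [h|]; first exact: le_trans (qp h) (linearize_along_dominated _ _ sp).
  have := linearize_alongN v sp; have := linearize_along_dominated v v sp.
  by move=> h1 h2; lra.
elim: s (linearize_along p v) (linearize_along_sublinear v sp) => [|u s IH] {v}p' {}sp.
  by exists p'; split.
have [q [sq qp qs]] := IH _ (linearize_along_sublinear u sp).
exists q; split => // [h|w]; first exact: le_trans (qp h) (linearize_along_dominated _ _ sp).
rewrite inE => /orP[/eqP ->|]; last exact: qs.
have := linearize_alongN u sp; have := linearize_along_dominated u u sp.
have := sublinearN u sq; have := qp u; have := qp (- u); lra.
Qed.

(** Subadditivity gives only upper bounds. The induction therefore carries the sum and its opposite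
    together, and the bound on the opposite is the missing lower bound. *)
Lemma sublinear_odd_sum q I (r : seq I) (k : I -> R) (e : I -> W) : sublinear q ->
  (forall i, q (- e i) = - q (e i)) ->
  q (\sum_(i <- r) k i *: e i) = \sum_(i <- r) k i * q (e i).
Proof.
move=> sq oe.
have oZ t i : q (t *: e i) = t * q (e i).
  have [t0|t0] := leP 0 t; first exact: sq.2.
  by rewrite -[t]opprK scaleNr -scalerN sq.2 ?oe; lra.
suff h : q (\sum_(i <- r) k i *: e i) <= \sum_(i <- r) k i * q (e i) /\
    q (- (\sum_(i <- r) k i *: e i)) <= - (\sum_(i <- r) k i * q (e i)).
  by have := sublinearN (\sum_(i <- r) k i *: e i) sq; lra.
elim: r => [|i r [IH1 IH2]]; first by rewrite !big_nil oppr0 sublinear0// oppr0.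
rewrite !big_cons !opprD; split.
  by apply: le_trans (sq.1 _ _) _; rewrite oZ lerD2l.
by apply: le_trans (sq.1 _ _) _; rewrite -scaleNr oZ mulNr lerD2l.
Qed.

End sublinear.

(** * Duality for finite optimal transport *)

Section finite_transport.
Context {R : realType} (n : nat) (a b : 'I_n -> R) (c : 'M[R]_n) (w : R).
Hypothesis a0 : forall i, 0 <= a i.
Hypothesis b0 : forall i, 0 <= b i.
Hypothesis a1 : \sum_i a i = 1.
Hypothesis b1 : \sum_i b i = 1.
Hypothesis dual_le : forall phi psi : 'I_n -> R,
  (forall i j, phi i + psi j <= c i j) ->
  \sum_i phi i * a i + \sum_j psi j * b j <= w.

Let val (fp : ('I_n -> R) * ('I_n -> R)) : R :=
  \sum_i fp.1 i * a i + \sum_j fp.2 j * b j.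

Let feas (h : 'M[R]_n) : set (('I_n -> R) * ('I_n -> R)) :=
  [set fp | forall i j, h i j <= fp.1 i + fp.2 j].

(** The least price, under the marginals [a] and [b], of a pair of potentials whose sum dominates
    [h]. It is sublinear in [h], and a linear minorant of it is a transport plan. *)
Let p (h : 'M[R]_n) : R := inf (val @` feas h).

Let valE fp : val fp = \sum_i \sum_j a i * b j * (fp.1 i + fp.2 j).
Proof.
rewrite /val; have -> : \sum_i fp.1 i * a i = \sum_i \sum_j a i * b j * fp.1 i.
  apply: eq_bigr => i _; rewrite -[LHS]mulr1 -b1 mulr_sumr.
  by apply: eq_bigr => j _; ring.
have -> : \sum_j fp.2 j * b j = \sum_i \sum_j a i * b j * fp.2 j.
  rewrite exchange_big; apply: eq_bigr => j _; rewrite -[LHS]mulr1 -a1 mulr_sumr.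
  by apply: eq_bigr => i _; ring.
rewrite -big_split; apply: eq_bigr => i _ /=; rewrite -big_split.
by apply: eq_bigr => j _ /=; ring.
Qed.

(** The product plan [a i * b j] bounds all prices from below, so the infimum [p] is a genuine
    one. *)
Let val_ge h fp : feas h fp -> \sum_i \sum_j a i * b j * h i j <= val fp.
Proof.
move=> hf; rewrite valE; apply: ler_sum => i _; apply: ler_sum => j _.
by rewrite ler_wpM2l ?mulr_ge0.
Qed.

Let p_le h fp : feas h fp -> p h <= val fp.
Proof.
move=> hf; apply: ge_inf; last by exists fp.
by exists (\sum_i \sum_j a i * b j * h i j) => _ [fp' /= hf' <-]; exact: val_ge.
Qed.

Let p_ge h x : (forall fp, feas h fp -> x <= val fp) -> x <= p h.
Proof.
move=> hx; apply: lb_le_inf; last by move=> _ [fp hf <-]; exact: hx.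
pose M := \sum_i \sum_j `|h i j|.
exists (val (cst M, cst 0)); exists (cst M, cst 0) => //= i j.
rewrite /cst addr0 /M (bigD1 i)//= (bigD1 j)//= -addrA.
apply: le_trans (ler_norm _) _; rewrite lerDl addr_ge0// ?sumr_ge0// => k _.
by rewrite sumr_ge0.
Qed.

Let p_sublinear : sublinear p.
Proof.
have pZ t u : 0 < t -> p (t *: u) <= t * p u.
  move=> t0; rewrite mulrC -ler_pdivrMr//; apply: p_ge => fp hf.
  rewrite ler_pdivrMr//; have -> : val fp * t = val (fun i => t * fp.1 i, fun j => t * fp.2 j).
    rewrite /val mulrDl !mulr_suml; congr (_ + _); apply: eq_bigr => i _ /=; ring.
  by apply: p_le => i j /=; rewrite mxE -mulrDr ler_pM2l.
split=> [u v|t u].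
  rewrite -lerBlDr; apply: p_ge => fp hf.
  rewrite lerBlDr -lerBlDl; apply: p_ge => fq hq; rewrite lerBlDl.
  have -> : val fp + val fq = val (fun i => fp.1 i + fq.1 i, fun j => fp.2 j + fq.2 j).
    transitivity ((\sum_i fp.1 i * a i + \sum_i fq.1 i * a i) +
        (\sum_j fp.2 j * b j + \sum_j fq.2 j * b j)); first by rewrite /val; ring.
    by rewrite /val; congr (_ + _); rewrite -big_split; apply: eq_bigr => i _ /=; ring.
  apply: p_le => i j /=; rewrite mxE; have := hf i j; have := hq i j; lra.
rewrite le_eqVlt => /predU1P[<-|t0].
  rewrite scale0r mul0r; apply/eqP; rewrite eq_le; apply/andP; split.
    have -> : 0 = val (cst 0, cst 0).
      by rewrite /val !big1 ?addr0// => i _; rewrite mul0r.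
    by apply: p_le => i j /=; rewrite mxE /cst addr0.
  apply: p_ge => fp /val_ge; rewrite big1 => // i _.
  by rewrite big1// => j _; rewrite mxE mulr0.
apply/eqP; rewrite eq_le pZ//= mulrC -ler_pdivlMr//.
by have := pZ t^-1 (t *: u); rewrite scalerA mulVf ?gt_eqF// scale1r mulrC invr_gt0; apply.
Qed.

(** A minorant [q] of [p], linear on matrices and touching [p] at [- c], defines the plan by its
    values on elementary matrices. Positivity follows from [p (- e ij) <= 0]. The marginals follow
    from testing indicators of rows and columns with both signs. The cost is [- p (- c)], which is a
    supremum of dual values. *)
Lemma finite_transport_duality : exists pi : 'I_n -> 'I_n -> R,
  [/\ forall i j, 0 <= pi i j, forall i, \sum_j pi i j = a i,
      forall j, \sum_i pi i j = b j & \sum_i \sum_j pi i j * c i j <= w].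
Proof.
pose e (ij : 'I_n * 'I_n) : 'M[R]_n := delta_mx ij.1 ij.2.
have [q [sq qp qc qe]] := HahnBanach_fin (- c) (map e (enum {: 'I_n * 'I_n})) p_sublinear.
have oe ij : q (- e ij) = - q (e ij) by apply: qe; rewrite map_f// mem_enum.
have qE (h : 'M[R]_n) : q h = \sum_ij h ij.1 ij.2 * q (e ij).
  rewrite {1}(matrix_sum_delta h) pair_bigA/=.
  exact: (sublinear_odd_sum _ (fun ij : 'I_n * 'I_n => h ij.1 ij.2) sq oe).
exists (fun i j => q (e (i, j))); split.
- move=> i j; rewrite -oppr_le0 -oe; apply: le_trans (qp _) _.
  have -> : 0 = val (cst 0, cst 0).
    by rewrite /val !big1 ?addr0// => k _; rewrite mul0r.
  apply: p_le => k l /=; rewrite !mxE /cst addr0 oppr_le0.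
  by case: (_ && _).
- move=> i; pose E : 'M[R]_n := \matrix_(k, l) (k == i)%:R.
  have qEi : q E = \sum_j q (e (i, j)).
    rewrite qE -(pair_bigA _ (fun k l => E k l * q (e (k, l))))/= (bigD1 i)//=.
    rewrite [X in _ + X]big1 ?addr0; last first.
      by move=> k /negbTE ki; rewrite big1// => l _; rewrite mxE ki mul0r.
    by apply: eq_bigr => l _; rewrite mxE eqxx mul1r.
  have h1 (s : R) : p (s *: E) <= s * a i.
    have -> : s * a i = val (fun k => s * (k == i)%:R, cst 0).
      rewrite /val [X in _ + X]big1 ?addr0; last by move=> k _; rewrite mul0r.
      rewrite (bigD1 i)//= eqxx mulr1 big1 ?addr0// => k /negbTE ->.
      by rewrite mulr0 mul0r.
    by apply: p_le => k l /=; rewrite !mxE addr0.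
  have qN : q (- E) = - q E.
    by rewrite !qE -sumrN; apply: eq_bigr => ij _; rewrite mxE mulNr.
  rewrite -qEi; have := h1 1; have := h1 (-1); rewrite scale1r scaleN1r.
  have := qp E; have := qp (- E); rewrite qN; lra.
- move=> j; pose E : 'M[R]_n := \matrix_(k, l) (l == j)%:R.
  have qEi : q E = \sum_i q (e (i, j)).
    rewrite qE -(pair_bigA _ (fun k l => E k l * q (e (k, l))))/= exchange_big (bigD1 j)//=.
    rewrite [X in _ + X]big1 ?addr0; last first.
      by move=> k /negbTE ki; rewrite big1// => l _; rewrite mxE ki mul0r.
    by apply: eq_bigr => l _; rewrite mxE eqxx mul1r.
  have h1 (s : R) : p (s *: E) <= s * b j.
    have -> : s * b j = val (cst 0, fun k => s * (k == j)%:R).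
      rewrite /val [X in X + _]big1 ?add0r; last by move=> k _; rewrite mul0r.
      rewrite (bigD1 j)//= eqxx mulr1 big1 ?addr0// => k /negbTE ->.
      by rewrite mulr0 mul0r.
    by apply: p_le => k l /=; rewrite !mxE add0r.
  have qN : q (- E) = - q E.
    by rewrite !qE -sumrN; apply: eq_bigr => ij _; rewrite mxE mulNr.
  rewrite -qEi; have := h1 1; have := h1 (-1); rewrite scale1r scaleN1r.
  have := qp E; have := qp (- E); rewrite qN; lra.
- have -> : \sum_i \sum_j q (e (i, j)) * c i j = q c.
    rewrite qE -(pair_bigA _ (fun k l => c k l * q (e (k, l))))/=.
    by apply: eq_bigr => i _; apply: eq_bigr => j _; rewrite mulrC.
  rewrite -[c]opprK qc -[w]opprK lerN2; apply: p_ge => fp hf.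
  rewrite lerNl; have -> : - val fp = \sum_i (- fp.1 i) * a i + \sum_j (- fp.2 j) * b j.
    by rewrite /val opprD -!sumrN; congr (_ + _); apply: eq_bigr => i _; rewrite mulNr.
  apply: dual_le => i j; have := hf i j; rewrite mxE; lra.
Qed.

End finite_transport.

Lemma measure_preimage_sum (R : realType) dT (T : measurableType dT)
    (P : {measure set T -> \bar R}) n (k : T -> 'I_n) (A : set T) :
  (forall i, measurable (k @^-1` [set i])) -> measurable A ->
  P A = (\sum_i P (A `&` k @^-1` [set i]))%E.
Proof.
move=> mk mA; rewrite -measure_bigsetU_ord//; last 2 first.
- by move=> i; exact: measurableI.
- by move=> i j _ _ [x /= [[_ <-] [_ <-]]].
congr (P _); rewrite -bigcup_seq; apply/seteqP; split=> x /=.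
  by move=> Ax; exists (k x) => //=; rewrite mem_index_enum.
by case=> i _ [].
Qed.

(** * From a plan between cells to a coupling *)

Section coupling_of_plan.
Context {R : realType} dT (T : measurableType dT) (nu mu : probability T R).
Variables (n : nat) (k : T -> 'I_n) (p : 'I_n -> 'I_n -> R).
Hypothesis mk : forall i, measurable (k @^-1` [set i]).
Hypothesis p0 : forall i j, 0 <= p i j.
Let a i := fine (nu (k @^-1` [set i])).
Let b i := fine (mu (k @^-1` [set i])).
Hypothesis pa : forall i, \sum_j p i j = a i.
Hypothesis pb : forall j, \sum_i p i j = b j.

Let nuE (A : set T) : measurable A -> nu A = (fine (nu A))%:E.
Proof. by move=> mA; rewrite fineK// fin_num_measure. Qed.

Let muE (A : set T) : measurable A -> mu A = (fine (mu A))%:E.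
Proof. by move=> mA; rewrite fineK// fin_num_measure. Qed.

Let a0 i : 0 <= a i. Proof. exact: fine_ge0. Qed.
Let b0 i : 0 <= b i. Proof. exact: fine_ge0. Qed.

(** Density with respect to [nu \x mu] of the coupling that spreads the mass [p i j] independently
    over cell [i] times cell [j]. On null cells the quotient is [0 / 0 = 0], consistent with
    [p i j = 0] there. *)
Let g (ij : 'I_n * 'I_n) := p ij.1 ij.2 / (a ij.1 * b ij.2).

Let g0 ij : 0 <= g ij.
Proof. by rewrite /g divr_ge0// mulr_ge0. Qed.

Let s := enum {: 'I_n * 'I_n}.

Let mcell (ij : 'I_n * 'I_n) :
  measurable (k @^-1` [set ij.1] `*` k @^-1` [set ij.2]).
Proof. exact: measurableX. Qed.

Let plan_part (x0 : 'I_n * 'I_n) (l : nat) : {measure set (T * T) -> \bar R} :=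
  mscale (NngNum (g0 (nth x0 s l))) (mrestr (nu \x mu)%E (mcell (nth x0 s l))).

Let plan x0 := msum (plan_part x0) (size s).

Let planE x0 (A B : set T) : measurable A -> measurable B ->
  plan x0 (A `*` B) = (\sum_i \sum_j (g (i, j)
    * (fine (nu (A `&` k @^-1` [set i])) * fine (mu (B `&` k @^-1` [set j])))))%:E.
Proof.
move=> mA mB; rewrite /plan /msum pair_bigA/= -sumEFin.
have sumE (F : 'I_n * 'I_n -> \bar R) :
    (\sum_ij F ij = \sum_(l < size s) F (nth x0 s l))%E.
  by rewrite -(big_mkord xpredT (fun l => F (nth x0 s l))) -(big_nth x0 xpredT F) big_enum.
rewrite sumE.
apply: eq_bigr => l _; rewrite /plan_part /mscale /= /mrestr -setXI.
case: (nth x0 s l) => i j /=; rewrite product_measure1E; [|exact: measurableI..].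
by rewrite !EFinM -(nuE (measurableI _ _ mA (mk i))) -(muE (measurableI _ _ mB (mk j))).
Qed.

Let a_eq0 i A : measurable A -> a i = 0 -> fine (nu (A `&` k @^-1` [set i])) = 0.
Proof.
move=> mA ai; apply/eqP; rewrite eq_le fine_ge0 ?andbT// -ai.
apply: fine_le; [exact: fin_num_measure (measurableI _ _ mA (mk i))|exact: fin_num_measure (mk i)|].
by apply: le_measure; rewrite ?inE//; exact: measurableI.
Qed.

Let b_eq0 i A : measurable A -> b i = 0 -> fine (mu (A `&` k @^-1` [set i])) = 0.
Proof.
move=> mA ai; apply/eqP; rewrite eq_le fine_ge0 ?andbT// -ai.
apply: fine_le; [exact: fin_num_measure (measurableI _ _ mA (mk i))|exact: fin_num_measure (mk i)|].
by apply: le_measure; rewrite ?inE//; exact: measurableI.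
Qed.

Let p_a0 i j : a i = 0 -> p i j = 0.
Proof.
move=> ai; apply/eqP; rewrite eq_le p0 andbT -ai -pa (bigD1 j)//= lerDl.
by apply: sumr_ge0.
Qed.

Let p_b0 i j : b j = 0 -> p i j = 0.
Proof.
move=> bj; apply/eqP; rewrite eq_le p0 andbT -bj -pb (bigD1 i)//= lerDl.
by apply: sumr_ge0.
Qed.

Let gab i j : g (i, j) * (a i * b j) = p i j.
Proof.
rewrite /g /=; have [/p_a0 ->|ai] := eqVneq (a i) 0; first by rewrite mul0r mul0r.
have [/p_b0 ->|bj] := eqVneq (b j) 0; first by rewrite mul0r mul0r.
by rewrite mulfVK// mulf_neq0.
Qed.

Let plan_l x0 (A : set T) : measurable A -> plan x0 (A `*` setT) = nu A.
Proof.
move=> mA; rewrite planE//; under eq_bigr do under eq_bigr do rewrite setTI -/(b _).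
rewrite (measure_preimage_sum nu mk mA) -sumEFin; apply: eq_bigr => i _.
rewrite [RHS](nuE (measurableI _ _ mA (mk i))); congr EFin.
set x := fine _; have [ai|ai] := eqVneq (a i) 0.
  have -> : x = 0 by rewrite /x a_eq0.
  by rewrite big1// => j _; rewrite mul0r mulr0.
rewrite (eq_bigr (fun j => x / a i * p i j)).
  by rewrite -mulr_sumr pa mulfVK.
by move=> j _; rewrite -gab; field.
Qed.

Let plan_r x0 (A : set T) : measurable A -> plan x0 (setT `*` A) = mu A.
Proof.
move=> mA; rewrite planE//; under eq_bigr do under eq_bigr do rewrite setTI -/(a _).
rewrite exchange_big/= (measure_preimage_sum mu mk mA) -sumEFin; apply: eq_bigr => i _.
rewrite [RHS](muE (measurableI _ _ mA (mk i))); congr EFin.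
set x := fine _; have [ai|ai] := eqVneq (b i) 0.
  have -> : x = 0 by rewrite /x b_eq0.
  by rewrite big1// => j _; rewrite mulr0 mulr0.
rewrite (eq_bigr (fun j => x / b i * p j i)).
  by rewrite -mulr_sumr pb mulfVK.
by move=> j _; rewrite -gab; field.
Qed.

Lemma coupling_of_plan : exists pi : probability (T * T)%type R,
  [/\ forall A, measurable A -> pi (A `*` setT) = nu A,
      forall A, measurable A -> pi (setT `*` A) = mu A &
      forall i j, pi (k @^-1` [set i] `*` k @^-1` [set j]) = (p i j)%:E].
Proof.
pose x0 := (k point, k point).
have planT : plan x0 setT = 1%E by rewrite -setXTT plan_l// probability_setT.
(* The total mass is already 1. Normalising only supplies the structure of a probability, and the
   Dirac mass is the default for a degenerate total mass. *)
exists (mnormalize (plan x0) (dirac (point, point))).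
have plan1 C : mnormalize (plan x0) (dirac (point, point)) C = plan x0 C.
  have e : msum (plan_part x0) (size s) [set: T * T] = 1%E by exact: planT.
  by rewrite /mnormalize /= e onee_eq0/= invr1 mule1.
split=> [A mA|A mA|i j]; apply: (etrans (plan1 _)); [exact: plan_l|exact: plan_r|].
rewrite planE// (bigD1 i)//= (bigD1 j)//= !setIid -/(a i) -/(b j) gab.
rewrite big1 ?addr0; last first.
  move=> l /eqP lj; rewrite (_ : k @^-1` [set j] `&` _ = set0).
    by rewrite measure0 /= !mulr0.
  by apply/seteqP; split => // x [/= e1 e2]; case: lj; rewrite -e1 -e2.
rewrite big1 ?addr0// => l /eqP li; rewrite big1// => m _.
rewrite (_ : k @^-1` [set i] `&` _ = set0).
  by rewrite measure0 /= mul0r mulr0.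
by apply/seteqP; split => // x [/= e1 e2]; case: li; rewrite -e1 -e2.
Qed.

End coupling_of_plan.

Section finite_valued.
Context {R : realType} dT (T : measurableType dT) (I : finType) (k : T -> I).
Hypothesis mk : forall i, measurable (k @^-1` [set i]).

Let finE (F : I -> R) x : F (k x) = \sum_i F i * \1_(k @^-1` [set i]) x.
Proof.
rewrite (bigD1 (k x))//= big1 ?addr0; last first.
  by move=> i ik; rewrite indicE memNset ?mulr0//= => /esym/eqP; rewrite (negbTE ik).
by rewrite indicE mem_set// mulr1.
Qed.

Lemma measurable_finite_valued (F : I -> R) : measurable_fun setT (fun x => F (k x)).
Proof.
rewrite (_ : (fun _ => _) = (fun x => \sum_i F i * \1_(k @^-1` [set i]) x)); last first.
  by apply/funext => x; exact: finE.
by apply: measurable_sum => i; apply: measurable_funM => //; exact: measurable_indic.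
Qed.

Lemma expect_finite_valued (P : probability T R) (F : I -> R) :
  P.-integrable setT (EFin \o (fun x => F (k x))) /\
  \int[P]_x F (k x) = \sum_i F i * fine (P (k @^-1` [set i])).
Proof.
have Ii i : P.-integrable setT (EFin \o (fun x => F i * \1_(k @^-1` [set i]) x)).
  by apply: integrable_EFinZ; exact: integrable_indic.
split.
  rewrite (_ : _ \o _ = (fun x => \sum_i (F i * \1_(k @^-1` [set i]) x)%:E)%E).
    by apply: integrable_sum => // i _; exact: Ii.
  by apply/funext => x /=; rewrite finE sumEFin.
rewrite /Rintegral (eq_integral (fun x => \sum_i (F i * \1_(k @^-1` [set i]) x)%:E)%E); last first.
  by move=> x _ /=; rewrite finE sumEFin.
rewrite integral_sum//.
have -> : \sum_i F i * fine (P (k @^-1` [set i])) =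
  fine (\sum_i F i * fine (P (k @^-1` [set i])))%:E by [].
congr fine; rewrite -sumEFin; apply: eq_bigr => i _.
rewrite (@Rexpect_EFin _ _ _ P (fun x => F i * \1_(k @^-1` [set i]) x)) ?Ii//.
rewrite RintegralZl ?integrable_indic// /Rintegral integral_indic// setIT.
by [].
Qed.

End finite_valued.

(** * Quantization of the space *)

Section quantization.
Context {R : realType}.

(** Dominated convergence: at each point the indicator vanishes once [n] exceeds [K x]. *)
Lemma tail_expectation_small dT (T : measurableType dT) (P : probability T R)
    (K : T -> nat) (g : T -> R) (e : R) :
  (forall l, measurable (K @^-1` [set l])) -> (forall x, 0 <= g x) ->
  P.-integrable setT (EFin \o g) -> 0 < e ->
  exists n0, forall n, (n0 <= n)%N ->
    measurable_fun setT (fun x => g x * \1_[set x | (n <= K x)%N] x) /\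
    (\int[P]_x (g x * \1_[set x | (n <= K x)%N] x)%:E <= e%:E)%E.
Proof.
move=> mK g0 Ig e0; have mg := integrable_measurable Ig.
have mtail n : measurable [set x | (n <= K x)%N].
  rewrite (_ : [set x | _] = \bigcup_(l in [set l | (n <= l)%N]) (K @^-1` [set l])).
    by apply: bigcup_measurable.
  by apply/seteqP; split=> [x nx|x [l /= nl Kx]]; [exists (K x)|rewrite /= Kx].
pose f n x := (g x * \1_[set x | (n <= K x)%N] x)%:E.
have mf n : measurable_fun setT (fun x => g x * \1_[set x | (n <= K x)%N] x).
  by apply: measurable_funM => //; exact: measurable_indic.
have f0 x : f ^~ x @ \oo --> 0%E.
  apply: cvg_near_cst; exists (K x).+1 => // n /= Kn.
  by rewrite /f indicE memNset ?mulr0//= leqNgt; apply/negP; rewrite negbK.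
have fg x n : (`|f n x| <= (EFin \o g) x)%E.
  rewrite /f /= lee_fin ger0_norm ?mulr_ge0//.
  by rewrite ler_piMr// indicE lern1 leq_b1.
have [_ _] := @dominated_convergence _ _ _ P setT measurableT f (cst 0%E) (EFin \o g)
  (fun n => (measurable_EFinP _ _).2 (mf n)) (measurable_cst _)
  (aeW _ (fun x _ => f0 x)) Ig (aeW _ (fun x n _ => fg x n)).
rewrite integral0 => /fine_cvgP[_] /cvgrPdist_lt /(_ _ e0) [n0 _ hn0].
exists n0 => n nn0; split; first exact: mf.
have := hn0 n nn0; rewrite /= sub0r normrN => /ltW.
have If : P.-integrable setT (f n).
  apply: le_integrable Ig => //; first exact/measurable_EFinP.
  by move=> x _; apply: le_trans (fg x n) _; rewrite /= lee_fin ler_norm.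
have fi : (\int[P]_x f n x)%E \is a fin_num by exact: integrable_fin_num.
by move=> h; rewrite -/(f n) -(fineK fi) lee_fin; apply: le_trans h; exact: ler_norm.
Qed.

(** [K y] is the least index, in an enumeration of the rational vectors, of a centre closer than
    [e]. Taking the least index makes each cell a ball minus finitely many balls, hence
    measurable. *)
Lemma finite_quantization d (e : R) : 0 < e ->
  exists (K : 'cV[R]_d -> nat) (r : nat -> 'cV[R]_d),
    (forall l, measurable (K @^-1` [set l] : set (borel_cV R d))) /\
    (forall y, hsnorm (y - r (K y)) < e).
Proof.
move=> e0.
have mball (c : 'cV[R]_d) : measurable ([set y | hsnorm (y - c) < e] : set (borel_cV R d)).
  have -> : [set y | hsnorm (y - c) < e] = (fun y => hsnorm (y - c)) @^-1` `]-oo, e[%classic.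
    by apply/seteqP; split => y /=; rewrite in_itv.
  rewrite -[X in measurable X]setTI.
  apply: (@continuous_borel_measurable R d 1 (fun y => hsnorm (y - c))) => //.
  apply: (@lipschitz_hs_continuous _ _ 1) => u v.
  by rewrite mul1r; apply: le_trans (ler_hsnorm_dist _ _) _; rewrite opprB addrA subrK.
pose r l : 'cV[R]_d := map_mx ratr (odflt (0 : 'cV[rat]_d) (unpickle l)).
have dense y : exists l, hsnorm (y - r l) < e.
  have N0 : 0 < (d * 1)%:R + 1 :> R by rewrite ltr_wpDl.
  have [c hc] := rat_cV_dense y (divr_gt0 (ltac:(lra) : 0 < e / 2) N0).
  exists (pickle c); rewrite /r pickleK /=.
  apply: le_lt_trans (hsnorm_le_mx_norm _) _.
  have : `|y - map_mx ratr c| <= e / 2 / ((d * 1)%:R + 1).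
    rewrite /Num.norm/= mx_normrE; apply/bigmax_leP; split; first by rewrite !divr_ge0 ?ltW.
    by case=> i j _ /=; rewrite !mxE ord1; exact/ltW/hc.
  rewrite ler_pdivlMr// mulrC mulrDl mul1r => h.
  have := normr_ge0 (y - map_mx ratr c); lra.
exists (fun y => ex_minn (dense y)), r; split=> [l|y]; last by case: ex_minnP.
rewrite (_ : _ @^-1` _ = [set y | hsnorm (y - r l) < e] `&`
    \bigcap_(j in [set j | (j < l)%N]) ~` [set y | hsnorm (y - r j) < e]).
  apply: measurableI; first exact: mball.
  by apply: bigcap_measurableType => j _; apply: measurableC; exact: mball.
apply/seteqP; split=> y /=.
  case: ex_minnP => m hm mmin <-; split=> // j /= jm hj.
  by have := mmin _ hj; rewrite leqNgt jm.
case=> hl hj; case: ex_minnP => m hm mmin; apply/eqP; rewrite eqn_leq mmin//= leqNgt.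
by apply/negP => ml; exact: (hj m ml).
Qed.

End quantization.

Lemma lipschitz1_measurable (R : realType) (d : nat) (f : 'cV[R]_d -> R) :
  lipschitz1 f -> measurable_fun [set: borel_cV R d] f.
Proof.
by move=> /lipschitz1P lf; apply: continuous_borel_measurable; exact: lipschitz_hs_continuous lf.
Qed.

Lemma quantization_error_measurable (R : realType) (d : nat) (I : finType)
    (k : borel_cV R d -> I) (pt : I -> 'cV[R]_d) :
  (forall i, measurable (k @^-1` [set i])) ->
  measurable_fun setT (fun x : borel_cV R d => hsnorm ((x : 'cV[R]_d) - pt (k x))).
Proof.
move=> mk.
have mf : measurable_fun setT ((fun x : borel_cV R d => (x : 'cV[R]_d) - pt (k x)) : borel_cV R d -> borel_cV R d).
  apply: measurable_coord_cV => i.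
  rewrite (_ : (fun _ => _) = (fun x : borel_cV R d => (x : 'cV[R]_d) i ord0 - pt (k x) i ord0)); last first.
    by apply/funext => x; rewrite !mxE.
  apply: measurable_funB.
    apply: (@continuous_borel_measurable _ _ _ (fun x : 'cV[R]_d => x i ord0)).
    exact: coord_continuous.
  exact: (measurable_finite_valued mk (fun j => pt j i ord0)).
exact: (measurableT_comp (lipschitz1_measurable (@hsnorm_lipschitz1 R d)) mf).
Qed.

Section Kantorovich_Rubinstein.
Context {R : realType} {d : nat}.
Local Notation E := (borel_cV R d).
Variables (nu mu : probability E R) (w : R).
Hypothesis Inu : nu.-integrable setT (EFin \o (fun x : E => hsnorm (x : 'cV[R]_d))).
Hypothesis Imu : mu.-integrable setT (EFin \o (fun x : E => hsnorm (x : 'cV[R]_d))).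
Hypothesis dual : forall f : 'cV[R]_d -> R, lipschitz1 f ->
  (\int[nu]_x f x) - (\int[mu]_x f x) <= w.

Lemma lipschitz1_integrable (P : probability E R) (f : 'cV[R]_d -> R) :
  P.-integrable setT (EFin \o (fun x : E => hsnorm (x : 'cV[R]_d))) ->
  lipschitz1 f -> P.-integrable setT (EFin \o (f : E -> R)).
Proof.
move=> IP lf; have I0 := integrable_EFinD (prob_integrable_cst P `|f 0|) IP.
apply: integrable_le I0; first exact: lipschitz1_measurable.
move=> x; have := lf x 0; rewrite subr0 /cst => h.
have := ler_normD (f 0) (f x - f 0); rewrite addrC subrK; lra.
Qed.

Variable e : R.
Variables (n : nat) (k : E -> 'I_n.+1) (pt : 'I_n.+1 -> 'cV[R]_d).
Hypothesis mk : forall i, measurable (k @^-1` [set i]).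
Let err (x : E) : R := hsnorm ((x : 'cV[R]_d) - pt (k x)).
Hypothesis err_nu : (\int[nu]_x (err x)%:E <= e%:E)%E.
Hypothesis err_mu : (\int[mu]_x (err x)%:E <= e%:E)%E.

Let err_measurable : measurable_fun setT err.
Proof. exact: (quantization_error_measurable pt mk). Qed.

Let err_integrable (P : probability E R) : (\int[P]_x (err x)%:E <= e%:E)%E ->
  P.-integrable setT (EFin \o err).
Proof.
move=> le; apply/integrableP; split; first exact/measurable_EFinP.
rewrite (eq_integral (fun x => (err x)%:E)); first exact: le_lt_trans le (ltry _).
by move=> x _ /=; rewrite ger0_norm// hsnorm_ge0.
Qed.

Let err_expect (P : probability E R) : (\int[P]_x (err x)%:E <= e%:E)%E ->
  \int[P]_x err x <= e.
Proof. by move=> le; rewrite -lee_fin -Rexpect_EFin//; exact: err_integrable. Qed.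

(** Discrete potentials extend to the whole space by [f x = min_j (|x - pt j| - psi j)]. This [f] is
    1-Lipschitz, lies above [phi] and below [- psi] at the centres, and replacing points by centres
    costs [e] under each measure. *)
Lemma quantized_dual (phi psi : 'I_n.+1 -> R) :
  (forall i j, phi i + psi j <= hsnorm (pt i - pt j)) ->
  \sum_i phi i * fine (nu (k @^-1` [set i])) +
  \sum_j psi j * fine (mu (k @^-1` [set j])) <= w + 2 * e.
Proof.
move=> hc.
pose h j (x : 'cV[R]_d) := hsnorm (x - pt j) - psi j.
pose f x := \big[Num.min/h ord0 x]_j h j x.
have lf : lipschitz1 f.
  apply/lipschitz1P/le_lipschitz_hs => u v; rewrite mul1r lerBlDr -lerBlDl.
  have hle j : f u - hsnorm (u - v) <= h j v.
    rewrite lerBlDr; apply: (@le_trans _ _ (h j u)).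
      exact: (bigmin_le_cond _ (fun j => h j u) (isT : xpredT j)).
    rewrite /h; have := ler_hsnormD (u - v) (v - pt j); rewrite addrA subrK; lra.
  by apply: le_bigmin.
have f1 i : phi i <= f (pt i).
  by apply: le_bigmin => [|j _]; rewrite /h lerBrDr; exact: hc.
have f2 j : psi j <= - f (pt j).
  rewrite lerNr; apply: le_trans (bigmin_le_cond _ (fun i => h i (pt j)) (isT : xpredT j)) _.
  by rewrite /h subrr hsnorm0 sub0r.
have [I1 E1] := expect_finite_valued mk nu phi.
have [I2 E2] := expect_finite_valued mk mu psi.
rewrite -E1 -E2.
have Ifn := lipschitz1_integrable Inu lf; have Ifm := lipschitz1_integrable Imu lf.
have h1 : \int[nu]_x phi (k x) <= (\int[nu]_x f x) + e.
  apply: (@le_trans _ _ (\int[nu]_x (f x + err x))).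
    apply: le_Rintegral => //.
      by apply: integrable_EFinD => //; exact: err_integrable.
    move=> x _; apply: le_trans (f1 (k x)) _.
    have := lf (pt (k x)) x; rewrite hsnormBC -/(err x) ler_norml; lra.
  rewrite RintegralD ?err_integrable// lerD2l; exact: err_expect.
have h2 : \int[mu]_x psi (k x) <= - (\int[mu]_x f x) + e.
  have Inf := integrable_EFinZ (-1) Ifm.
  apply: (@le_trans _ _ (\int[mu]_x (-1 * f x + err x))).
    apply: le_Rintegral => //.
      by apply: integrable_EFinD => //; exact: err_integrable.
    move=> x _; apply: le_trans (f2 (k x)) _.
    have := lf (pt (k x)) x; rewrite hsnormBC -/(err x) ler_norml; lra.
  have -> : - (\int[mu]_x f x) = \int[mu]_x (-1 * f x) by rewrite RintegralZl// mulN1r.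
  rewrite RintegralD ?err_integrable// lerD2l; exact: err_expect.
have := dual lf; lra.
Qed.

(** Of the [4 * e], half comes from the dual bound on cells and half from moving each coordinate to
    its centre in the triangle inequality. *)
Lemma quantized_W1_le : (W1 nu mu <= (w + 4 * e)%:E)%E.
Proof.
pose a i := fine (nu (k @^-1` [set i])); pose b i := fine (mu (k @^-1` [set i])).
have s1 (P : probability E R) : \sum_i fine (P (k @^-1` [set i])) = 1.
  have [_ h] := expect_finite_valued mk P (fun=> 1).
  by under eq_bigr do rewrite -[fine _]mul1r; rewrite -h Rexpect_cst.
pose c : 'M[R]_n.+1 := \matrix_(i, j) hsnorm (pt i - pt j).
have cP phi psi : (forall i j, phi i + psi j <= c i j) ->
    \sum_i phi i * a i + \sum_j psi j * b j <= w + 2 * e.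
  by move=> h; apply: quantized_dual => i j; have := h i j; rewrite mxE.
have [p [p0 pa pb pc]] := finite_transport_duality (fun i => fine_ge0 (measure_ge0 nu _))
  (fun i => fine_ge0 (measure_ge0 mu _)) (s1 nu) (s1 mu) cP.
have [pi [pinu pimu pip]] := coupling_of_plan mk p0 pa pb.
apply: (@le_trans _ _ (\int[pi]_z (hsnorm ((z.1 : 'cV[R]_d) - z.2))%:E)%E).
  by apply: ereal_inf_lbound; exists pi.
have mfst : measurable_fun setT (fst : E * E -> E) by exact: measurable_fst.
have msnd : measurable_fun setT (snd : E * E -> E) by exact: measurable_snd.
have merr1 : measurable_fun setT (fun z : E * E => (err z.1)%:E).
  by apply/measurable_EFinP; exact: (measurableT_comp err_measurable mfst).
have merr2 : measurable_fun setT (fun z : E * E => (err z.2)%:E).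
  by apply/measurable_EFinP; exact: (measurableT_comp err_measurable msnd).
have i1 : (\int[pi]_z (err z.1)%:E <= e%:E)%E.
  apply: le_trans err_nu; rewrite -(@ge0_integral_pushforward _ _ _ _ _ _ mfst pi setT (EFin \o err)) ?preimage_setT//; last 2 first.
  - exact/measurable_EFinP.
  - by move=> y _; rewrite lee_fin hsnorm_ge0.
  rewrite (@eq_measure_integral _ _ _ setT nu (pushforward pi fst))// => A mA _.
  by apply: etrans (pinu A mA); rewrite /pushforward setXT.
have i2 : (\int[pi]_z (err z.2)%:E <= e%:E)%E.
  apply: le_trans err_mu; rewrite -(@ge0_integral_pushforward _ _ _ _ _ _ msnd pi setT (EFin \o err)) ?preimage_setT//; last 2 first.
  - exact/measurable_EFinP.
  - by move=> y _; rewrite lee_fin hsnorm_ge0.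
  rewrite (@eq_measure_integral _ _ _ setT mu (pushforward pi snd))// => A mA _.
  by apply: etrans (pimu A mA); rewrite /pushforward setTX.
pose kk (z : E * E) := (k z.1, k z.2).
have kkE ij : kk @^-1` [set ij] = k @^-1` [set ij.1] `*` k @^-1` [set ij.2].
  case: ij => i j; apply/seteqP; split=> z /=; first by case=> <- <-.
  by rewrite /kk; case=> -> ->.
have mkk ij : measurable (kk @^-1` [set ij]) by rewrite kkE; exact: measurableX.
have [Ic Ec] := expect_finite_valued mkk pi (fun ij => c ij.1 ij.2).
have ic : (\int[pi]_z (c (kk z).1 (kk z).2)%:E <= (w + 2 * e)%:E)%E.
  rewrite (Rexpect_EFin Ic) lee_fin Ec; apply: le_trans pc.
  rewrite pair_bigA/= le_eqVlt; apply/orP; left; apply/eqP; apply: eq_bigr => ij _.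
  by rewrite mulrC kkE; congr (_ * _); rewrite (pip ij.1 ij.2).
have mc : measurable_fun setT (fun z : E * E => (c (kk z).1 (kk z).2)%:E).
  by apply/measurable_EFinP; exact: (integrable_measurable Ic).
apply: (@le_trans _ _ (\int[pi]_z ((err z.1)%:E + ((c (kk z).1 (kk z).2)%:E + (err z.2)%:E)))%E).
  apply: ge0_le_integral => //.
  - by move=> z _; rewrite lee_fin hsnorm_ge0.
  - apply/measurable_EFinP.
    have mD : measurable_fun setT ((fun z : E * E => (z.1 : 'cV[R]_d) - z.2) : E * E -> E).
      apply: measurable_coord_cV => i.
      rewrite (_ : (fun _ => _) = (fun z : E * E => (z.1 : 'cV[R]_d) i ord0 - (z.2 : 'cV[R]_d) i ord0)); last first.
        by apply/funext => x; rewrite !mxE.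
      have mco := @continuous_borel_measurable R d 1 (fun x => x i ord0) (@coord_continuous _ _ _ i ord0).
      by apply: measurable_funB; [exact: (measurableT_comp mco mfst)|exact: (measurableT_comp mco msnd)].
    exact: (measurableT_comp (lipschitz1_measurable hsnorm_lipschitz1) mD).
  - by apply: emeasurable_funD => //; exact: emeasurable_funD.
  - move=> z _; rewrite -!EFinD lee_fin /err mxE /=.
    have := ler_hsnormD ((z.1 : 'cV[R]_d) - pt (k z.1)) (pt (k z.1) - pt (k z.2) + (pt (k z.2) - z.2)).
    have := ler_hsnormD (pt (k z.1) - pt (k z.2)) (pt (k z.2) - z.2).
    rewrite !addrA !subrK [hsnorm (pt (k z.2) - z.2)]hsnormBC; lra.
rewrite ge0_integralD//; last 3 first.
- by move=> z _; rewrite lee_fin hsnorm_ge0.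
- by move=> z _; rewrite -EFinD lee_fin mxE addr_ge0 ?hsnorm_ge0.
- exact: emeasurable_funD.
rewrite ge0_integralD//; last 2 first.
- by move=> z _; rewrite lee_fin mxE hsnorm_ge0.
- by move=> z _; rewrite lee_fin hsnorm_ge0.
apply: le_trans (leeD i1 (leeD ic i2)) _.
by rewrite -!EFinD lee_fin; move: e => r; lra.
Qed.

End Kantorovich_Rubinstein.

Lemma Kantorovich_Rubinstein_le (R : realType) (d : nat)
    (nu mu : probability (borel_cV R d) R) (w : R) :
  nu.-integrable setT (EFin \o (fun x : borel_cV R d => hsnorm (x : 'cV[R]_d))) ->
  mu.-integrable setT (EFin \o (fun x : borel_cV R d => hsnorm (x : 'cV[R]_d))) ->
  (forall f : 'cV[R]_d -> R, lipschitz1 f ->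
    (\int[nu]_x f x) - (\int[mu]_x f x) <= w) ->
  (W1 nu mu <= w%:E)%E.
Proof.
move=> Inu Imu dual; apply/lee_addgt0Pr => e0 e00.
pose e := e0 / 4.
have e2 : 0 < e / 2 by rewrite !divr_gt0.
have [K [r [mK Kr]]] := finite_quantization d e2.
have [n1 h1] := tail_expectation_small mK (fun x => hsnorm_ge0 (x : 'cV[R]_d)) Inu e2.
have [n2 h2] := tail_expectation_small mK (fun x => hsnorm_ge0 (x : 'cV[R]_d)) Imu e2.
pose n := maxn n1 n2.
(* The infinitely many cells of index at least [n] are merged into one with centre 0. There the
   error is [|x|], whose integral over the tail is at most [e / 2] under both measures. *)
pose k (x : borel_cV R d) : 'I_n.+1 := inord (minn (K x) n).
pose pt (i : 'I_n.+1) := if (i < n)%N then r i else 0.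
have kE x : k x = minn (K x) n :> nat by rewrite inordK// ltnS geq_minr.
have mk i : measurable (k @^-1` [set i]).
  rewrite (_ : _ @^-1` _ = \bigcup_(l in [set l | minn l n = i]) (K @^-1` [set l])).
    by apply: bigcup_measurable => l _; exact: mK.
  apply/seteqP; split=> x /=; first by move=> <-; exists (K x) => //=; rewrite kE.
  by case=> l /= li Kx; apply/val_inj; rewrite /= kE Kx.
have err_le (P : probability (borel_cV R d) R) :
    measurable_fun setT (fun x : borel_cV R d => hsnorm (x : 'cV[R]_d) * \1_[set x | (n <= K x)%N] x) ->
    (\int[P]_x (hsnorm (x : 'cV[R]_d) * \1_[set x | (n <= K x)%N] x)%:E <= (e / 2)%:E)%E ->
    (\int[P]_x (hsnorm ((x : 'cV[R]_d) - pt (k x)))%:E <= e%:E)%E.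
  move=> mt le.
  apply: (@le_trans _ _ (\int[P]_x ((e / 2)%:E +
      (hsnorm (x : 'cV[R]_d) * \1_[set x | (n <= K x)%N] x)%:E))%E).
    apply: ge0_le_integral => //.
    - by move=> x _; rewrite lee_fin hsnorm_ge0.
    - by apply/measurable_EFinP; exact: (quantization_error_measurable pt mk).
    - by apply: emeasurable_funD => //; exact/measurable_EFinP.
    - move=> x _; rewrite -EFinD lee_fin /pt kE indicE.
      have [nK|Kn] := leqP n (K x).
        by rewrite ltnn subr0 mem_set// mulr1 lerDr ltW.
      rewrite Kn; apply: le_trans (ltW (Kr x)) _.
      by rewrite lerDl mulr_ge0 ?hsnorm_ge0.
  rewrite ge0_integralD//; last 3 first.
  - by move=> x _; rewrite lee_fin ltW.
  - by move=> x _; rewrite lee_fin mulr_ge0 ?hsnorm_ge0.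
  - exact/measurable_EFinP.
  rewrite integral_cst// [X in (_ * X)%E]probability_setT mule1.
  by apply: le_trans (leeD2l _ le) _; rewrite -EFinD lee_fin -splitr.
have [m1 l1] := h1 n (leq_maxl _ _); have [m2 l2] := h2 n (leq_maxr _ _).
have := quantized_W1_le Inu Imu dual mk (err_le nu m1 l1) (err_le mu m2 l2).
by rewrite -EFinD /e; have -> : 4 * (e0 / 4) = e0 by field.
Qed.

(** * Donsker-Varadhan inequality *)

Section DonskerVaradhan.
Context {R : realType} dT (T : measurableType dT) (nu mu : probability T R).
Hypothesis numu : nu `<< mu.
Local Notation h := (Radon_Nikodym_SigmaFinite.f nu mu).

Let h0 x : (0 <= h x)%E. Proof. exact: Radon_Nikodym_SigmaFinite.f_ge0. Qed.

Let hfin x : h x \is a fin_num. Proof. exact: Radon_Nikodym_SigmaFinite.f_fin_num. Qed.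

Let mh : measurable_fun setT h.
Proof. exact: measurable_int (Radon_Nikodym_SigmaFinite.f_integrable numu). Qed.

Let mfh : measurable_fun setT (fun x => fine (h x)).
Proof. exact: (measurableT_comp (fine_measurable measurableT) mh). Qed.

(** The density with its zeros replaced by 1, so that logarithm and inverse make sense everywhere;
    [nu] does not charge the zeros. *)
Let k x : R := if 0 < fine (h x) then fine (h x) else 1.

Let k_gt0 x : 0 < k x. Proof. by rewrite /k; case: ifPn. Qed.

Let mk : measurable_fun setT k.
Proof. by apply: measurable_fun_ifT => //; exact: measurable_fun_ltr. Qed.

Let mL : measurable_fun setT (fun x => ln (k x)).
Proof. exact: (measurableT_comp (@measurable_ln R) mk). Qed.

Let kV x : (k x)^-1 = expR (- ln (k x)).
Proof. by rewrite expRN lnK// posrE. Qed.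

Let mkV : measurable_fun setT (fun x => (k x)^-1).
Proof.
rewrite (_ : (fun _ => _) = (fun x => expR (- ln (k x)))); last first.
  by apply/funext => x; exact: kV.
apply: (measurableT_comp (@measurable_expR R)).
exact: (measurableT_comp (@oppr_measurable R setT) mL).
Qed.

Let hk x : fine (h x) / k x <= 1.
Proof.
rewrite /k; case: ifPn => [x0|]; first by rewrite divff ?gt_eqF.
rewrite -leNgt => x0; rewrite divr1; lra.
Qed.

(** Changing measure turns the left side into the [mu]-integral of [f * h / k], and [h / k <= 1]. *)
Let expect_div (f : T -> R) : (forall x, 0 <= f x) -> measurable_fun setT f ->
  (\int[nu]_x (f x / k x)%:E <= \int[mu]_x (f x)%:E)%E.
Proof.
move=> f0 mf.
have mfk : measurable_fun setT (fun x => f x / k x) by apply: measurable_funM.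
rewrite -(Radon_Nikodym_SigmaFinite.change_of_variables numu)//; last 2 first.
- by move=> x; rewrite lee_fin divr_ge0// ltW.
- exact/measurable_EFinP.
apply: ge0_le_integral => //.
- by move=> x _; rewrite mule_ge0// lee_fin divr_ge0// ltW.
- by apply: emeasurable_funM => //; exact/measurable_EFinP.
- exact/measurable_EFinP.
- move=> x _; rewrite -(fineK (hfin x)) -EFinM lee_fin mulrAC -mulrA.
  by rewrite ler_piMr//; exact: hk.
Qed.

Local Notation rn := (Radon_Nikodym (charge_of_finite_measure nu) mu).

Let ae_rn : ae_eq nu setT h rn.
Proof.
apply: (null_dominates_ae_eq measurableT numu).
exact: ae_eq_Radon_Nikodym_SigmaFinite.
Qed.

Let ae_h_gt0 : {ae nu, forall x, 0 < fine (h x)}.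
Proof.
pose N := [set x | fine (h x) <= 0].
have mN : measurable N.
  have -> : N = (fun x => fine (h x)) @^-1` `]-oo, 0]%classic.
    by apply/seteqP; split => x; rewrite /N /= in_itv.
  by rewrite -[X in measurable X]setTI; exact: mfh.
exists N; split=> //; last by move=> x /= /negP; rewrite -leNgt.
rewrite (Radon_Nikodym_SigmaFinite.f_integral numu)//.
apply: integral0_eq => x; rewrite /N /= => hx.
rewrite -(fineK (hfin x)); congr EFin; apply/eqP; rewrite eq_le hx/=.
by apply: fine_ge0.
Qed.

Let lne_eq : (\int[nu]_z lne (rn z))%E = (\int[nu]_z (ln (k z))%:E)%E.
Proof.
apply: ae_eq_integral => //.
- have mrn : measurable_fun setT (fun x => fine (rn x)).
    by apply: (measurableT_comp (fine_measurable measurableT)); exact: measurable_int (Radon_Nikodym_integrable _).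
  rewrite (_ : (fun _ => _) = (fun z => if fine (rn z) <= 0 then -oo%E else (ln (fine (rn z)))%:E)).
    apply: measurable_fun_ifT => //; first exact: measurable_fun_ler.
    by apply/measurable_EFinP; exact: (measurableT_comp (@measurable_ln R) mrn).
  by apply/funext => z; rewrite -[in LHS](fineK (@Radon_Nikodym_fin_num _ _ _ (charge_of_finite_measure nu) mu z numu)).
- exact/measurable_EFinP.
- apply: filterS2 ae_rn ae_h_gt0 => x /(_ I) <- hx _.
  by rewrite -[in LHS](fineK (hfin x)) lne_EFin// /k hx.
Qed.

Let expect_q g c : mgf_le mu g c ->
  nu.-integrable setT (EFin \o (fun x => expR (g x - c) / k x)) /\
  \int[nu]_x (expR (g x - c) / k x) <= 1.
Proof.
move=> gc; have [mg le] := mgf_leD (- c) gc; rewrite subrr expR0 in le.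
have me : measurable_fun setT (fun x => expR (g x - c)).
  exact: (measurableT_comp (@measurable_expR R) mg).
have le1 := le_trans (expect_div (fun x => expR_ge0 _) me) le.
have Iq : nu.-integrable setT (EFin \o (fun x => expR (g x - c) / k x)).
  apply/integrableP; split; first by apply/measurable_EFinP; exact: measurable_funM.
  rewrite (eq_integral (fun x => (expR (g x - c) / k x)%:E)); first exact: le_lt_trans le1 (ltry _).
  by move=> x _ /=; rewrite ger0_norm// divr_ge0 ?expR_ge0// ltW.
by split=> //; rewrite -lee_fin -Rexpect_EFin.
Qed.

(** This is [1 + t <= exp t] at [t = g x - c - ln (k x)]. Its integral is the Donsker-Varadhan
    inequality, since the exponential term has mean at most 1. *)
Let Young g c x : g x <= ln (k x) + (expR (g x - c) / k x - 1) + c.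
Proof.
have := expR_ge1Dx (g x - c - ln (k x)); rewrite expRD -kV; lra.
Qed.

Lemma DonskerVaradhan : (\int[nu]_z lne (rn z) < +oo)%E ->
  exists H : R, (\int[nu]_z lne (rn z))%E = H%:E /\
  forall g c, mgf_le mu g c ->
    ((forall x, 0 <= g x) -> nu.-integrable setT (EFin \o g)) /\
    (nu.-integrable setT (EFin \o g) -> \int[nu]_x g x <= H + c).
Proof.
rewrite lne_eq => Hfin; set L := fun x => ln (k x).
have [Iq0 _] := expect_q (mgf_le_cst mu 0).
have IL : nu.-integrable setT (EFin \o L).
  (* The Young bound with [g = 0] and [c = 0] dominates the negative part of [L] by [1 / k], which
     is integrable; the positive part is then finite because the entropy is. *)
  have In : nu.-integrable setT ((EFin \o L)^\-)%E.
    apply: le_integrable Iq0 => //; first by apply: measurable_funeneg; exact/measurable_EFinP.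
    move=> x _; rewrite gee0_abs ?funeneg_ge0// funenegE /= ger0_norm; last first.
      by rewrite divr_ge0 ?expR_ge0// ltW.
    rewrite ge_max; apply/andP; split.
      by have := Young (cst 0) 0 x; rewrite /cst /L lee_fin; lra.
    by rewrite lee_fin divr_ge0 ?expR_ge0// ltW.
  have nfin := integrable_lty measurableT In.
  have pfin : (\int[nu]_x ((EFin \o L)^\+)%E x < +oo)%E.
    rewrite integralE in Hfin.
    have fn : (\int[nu]_x ((EFin \o L)^\-)%E x)%E \is a fin_num.
      exact: integrable_fin_num.
    by move: Hfin; rewrite -(fineK fn) lteBlDr.
  apply/integrableP; split; first exact/measurable_EFinP.
  rewrite (_ : (fun x => _) = ((EFin \o L)^\+ \+ (EFin \o L)^\-)%E); last first.
    exact: fune_abse.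
  have mLE : measurable_fun setT (EFin \o L) by exact/measurable_EFinP.
  rewrite ge0_integralD//; first exact: lte_add_pinfty.
  - exact: measurable_funepos.
  - exact: measurable_funeneg.
exists (\int[nu]_x L x); split; first exact: Rexpect_EFin.
move=> g c gc; have [mg _] := gc; have [Iq lq] := expect_q gc.
have I1 : nu.-integrable setT (EFin \o (fun x => L x + (expR (g x - c) / k x - 1) + c)).
  apply: integrable_EFinD; last exact: (prob_integrable_cst nu c).
  apply: integrable_EFinD => //; apply: integrable_EFinB => //.
  exact: (prob_integrable_cst nu 1).
split=> [g0|Ig].
  by apply: integrable_le I1 => // x; rewrite ger0_norm//; exact: Young.
apply: (@le_trans _ _ (\int[nu]_x (L x + (expR (g x - c) / k x - 1) + c))).
  by apply: le_Rintegral => // x _; exact: Young.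
have Ec (r : R) : \int[nu]_x r = r by exact: (Rexpect_cst nu r).
have Icst (r : R) : nu.-integrable setT (EFin \o (fun=> r)) by exact: (prob_integrable_cst nu r).
rewrite RintegralD//; last by apply: integrable_EFinD => //; exact: integrable_EFinB.
rewrite Ec lerD2r RintegralD//; last exact: integrable_EFinB.
rewrite gerDl RintegralB// Ec; lra.
Qed.

End DonskerVaradhan.

(* One direction of the Bobkov-Götze theorem. *)
Lemma transport_entropy_of_mgf_le (R : realType) (d : nat)
    (mu : probability (borel_cV R d) R) (Phi : R -> \bar R) (r0 : R) :
  mu.-integrable setT (EFin \o (fun x : borel_cV R d => hsnorm (x : 'cV[R]_d))) ->
  (0 <= Phi 0%R)%E -> 0 < r0 -> Phi r0 <> +oo%E ->
  (forall r, 0 < r -> Phi r <> +oo%E ->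
    exists K : R, Phi r = K%:E /\ forall f : 'cV[R]_d -> R, lipschitz1 f ->
    mgf_le mu (fun x => r * f x) (r * (\int[mu]_x f x) + K)) ->
  transport_entropy (legendre Phi) mu.
Proof.
move=> Imu Phi0 r00 Phir0 HPhi nu; rewrite /rel_entropy.
case: ifPn => [/asboolP numu|_]; last exact: leey.
set Hent := (X in (_ <= X)%E).
have [->|/eqP Hfin] := eqVneq Hent +oo%E; first exact: leey.
have [H [HE DV]] := DonskerVaradhan numu (ltac:(by rewrite ltey; exact/eqP) : (Hent < +oo)%E).
rewrite /Hent HE.
have H0 : 0 <= H.
  have [_ h] := DV _ _ (mgf_le_cst mu 0).
  have := h (prob_integrable_cst nu 0); rewrite addr0; apply: le_trans.
  by rewrite (Rexpect_cst nu 0).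
(* Finiteness of [Phi] at one positive point gives an exponential moment of the norm under [mu],
   hence its integrability under [nu], which duality requires. *)
have [K0 [_ hK0]] := HPhi r0 r00 Phir0.
have [In _] := DV _ _ (hK0 _ (@hsnorm_lipschitz1 R d)).
have Inu : nu.-integrable setT (EFin \o (fun x : borel_cV R d => hsnorm (x : 'cV[R]_d))).
  have := integrable_EFinZ r0^-1 (In (fun x => mulr_ge0 (ltW r00) (hsnorm_ge0 _))).
  rewrite (_ : (fun t => _) = (fun x : borel_cV R d => hsnorm (x : 'cV[R]_d)))//.
  by apply/funext => x; rewrite mulKf ?gt_eqF.
apply: ge_ereal_sup => _ [r /= r_ge0 <-].
(* At [r = 0] the product with [W1] is 0, so only the signs of [Phi 0] and of the entropy matter. *)
have [->|rn0] := eqVneq r 0.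
  by rewrite mule0 sub0e (@le_trans _ _ 0%E) ?lee_fin// leeNl oppe0.
have r_gt0 : 0 < r by rewrite lt_neqAle eq_sym rn0.
have [->|/eqP Pr] := eqVneq (Phi r) +oo%E; first by rewrite addeNy leNye.
have [K [-> hK]] := HPhi r r_gt0 Pr.
have W : (W1 nu mu <= ((H + K) / r)%:E)%E.
  apply: Kantorovich_Rubinstein_le => // f lf.
  have [_ h] := DV _ _ (hK f lf).
  have If := lipschitz1_integrable Inu lf.
  have := h (integrable_EFinZ r If).
  rewrite RintegralZl// ler_pdivlMr//; lra.
rewrite leeBlDr// -EFinD.
have -> : H + K = (H + K) / r * r by rewrite mulfVK// gt_eqF.
by rewrite [leRHS]EFinM; apply: lee_wpmul2r => //; rewrite lee_fin ltW.
Qed.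

(** * Moments and concentration of the innovations *)

Section expR_quadratic.
Context {R : realType}.

(** After integration the linear term becomes a mean and the other a square-exponential moment, with
    no first-order loss at 0. *)
Lemma expR_le_expR_sqr (t : R) : expR t <= t + expR (t ^+ 2).
Proof.
have [t0|t0] := leP t 0.
  have [t1|t1] := leP t (-1).
    have h1 : expR t <= 1 by rewrite expR_le1.
    have h2 := expR_ge1Dx (t ^+ 2).
    have : 0 <= (- t) * (- t - 1) by rewrite mulr_ge0; lra.
    lra.
  have h2 := expR_ge1Dx (t ^+ 2); have h3 := expR_ge1Dx (- t).
  have : expR t * expR (- t) = 1 by rewrite -expRD subrr expR0.
  have := expR_gt0 t; set e := expR t; set e' := expR (- t) => e0 ee'.
  (* [e^t <= 1 / (1 - t) <= 1 + t + t^2] *)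
  have h4 : e * (1 - t) <= 1 by rewrite -[leRHS]ee' ler_pM2l//; lra.
  have h5 : (1 - t) * (1 + t + t ^+ 2) = 1 - t ^+ 3 by ring.
  have h6 : t ^+ 3 <= 0 by rewrite exprS mulr_le0_ge0// sqr_ge0.
  have : e <= 1 + t + t ^+ 2.
    rewrite -(ler_pM2r (ltac:(lra) : 0 < 1 - t)); lra.
  lra.
have [t1|t1] := leP t 1; last first.
  have : expR t <= expR (t ^+ 2) by rewrite ler_expR expr2; nra.
  lra.
(* On [(0, 1]], [exp t] is replaced by [(1 - t/4)^-4] and [exp (t^2)] by [(1 + t^2/2)^2]. Both keep
   the right order near 0, where the two sides of the claim differ only by about [t^2 / 2]. *)
have q0 : 0 < 1 - t / 4 by lra.
have h1 : expR t * (1 - t / 4) ^+ 4 <= 1.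
  have -> : expR t = expR (t / 4) ^+ 4 by rewrite -expRM_natl; congr expR; field.
  rewrite -exprMn -[leRHS](expr1n R 4%N) ler_pXn2r ?nnegrE ?mulr_ge0 ?expR_ge0//; last exact: ltW.
  have := expR_ge1Dx (- (t / 4)).
  have : expR (t / 4) * expR (- (t / 4)) = 1 by rewrite -expRD subrr expR0.
  have := expR_gt0 (t / 4); set e := expR _; set e' := expR _ => e0 ee' h.
  by rewrite -[leRHS]ee' ler_pM2l//; lra.
have h2 : 1 + t ^+ 2 + t ^+ 4 / 4 <= expR (t ^+ 2).
  have -> : expR (t ^+ 2) = expR (t ^+ 2 / 2) ^+ 2 by rewrite -expRM_natl; congr expR; field.
  have -> : 1 + t ^+ 2 + t ^+ 4 / 4 = (1 + t ^+ 2 / 2) ^+ 2 by field.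
  have := sqr_ge0 t => ?.
  by rewrite ler_pXn2r ?nnegrE ?expR_ge0 ?expR_ge1Dx//; lra.
suff h3 : 1 <= (1 - t / 4) ^+ 4 * (1 + t + t ^+ 2 + t ^+ 4 / 4).
  have : expR t <= 1 + t + t ^+ 2 + t ^+ 4 / 4.
    by rewrite -(ler_pM2l (exprn_gt0 4 q0)) mulrC; exact: le_trans h1 h3.
  lra.
rewrite -subr_ge0.
(* After division by [t^2], the remainder is written in the Bernstein basis of degree 6 on [[0, 1]],
   where all its coefficients are positive. *)
have -> : (1 - t / 4) ^+ 4 * (1 + t + t ^+ 2 + t ^+ 4 / 4) - 1 = t ^+ 2 * (
  3 / 8 * (t ^+ 0 * (1 - t) ^+ 6) + 25 / 16 * (t ^+ 1 * (1 - t) ^+ 5) + 705 / 256 * (t ^+ 2 * (1 - t) ^+ 4) + 661 / 256 * (t ^+ 3 * (1 - t) ^+ 3) + 169 / 128 * (t ^+ 4 * (1 - t) ^+ 2) + 85 / 256 * (t ^+ 5 * (1 - t) ^+ 1) + 29 / 1024 * (t ^+ 6 * (1 - t) ^+ 0)) by field.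
have t1' : 0 <= 1 - t by lra.
have t0' := ltW t0.
have p (c c' : nat) k l : 0 <= c%:R / c'%:R * (t ^+ k * (1 - t) ^+ l).
  by apply: mulr_ge0; [exact: divr_ge0|apply: mulr_ge0; exact: exprn_ge0].
apply: mulr_ge0; first exact: exprn_ge0.
by do 6!(apply: addr_ge0; last exact: p); exact: p.
Qed.

(** 32/45 lies just below 205/288, the largest value that the regime [x > 1] of
    [concentration_of_exp_sq_moment] tolerates. The bound comes from [1 + 1/45 <= exp (1/45)] by
    five squarings, rounding down to a simple fraction each time. *)
Lemma ln2_le : ln 2 <= 32 / 45 :> R.
Proof.
rewrite -[leRHS]expRK ler_ln ?posrE ?expR_gt0//.
have sq (a b c : R) : 0 <= b -> b <= expR a -> c <= b * b -> c <= expR (2 * a).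
  move=> b0 ba /le_trans; apply; rewrite expRM_natl expr2.
  by apply: ler_pM.
have h1 : 46 / 45 <= expR (1 / 45 : R) by have := expR_ge1Dx (1 / 45 : R); lra.
have h2 : 70 / 67 <= expR (2 * (1 / 45) : R) by apply: (sq _ (46 / 45)) => //; lra.
have h3 : 12 / 11 <= expR (2 * (2 * (1 / 45)) : R) by apply: (sq _ (70 / 67)) => //; lra.
have h4 : 119 / 100 <= expR (2 * (2 * (2 * (1 / 45))) : R) by apply: (sq _ (12 / 11)) => //; lra.
have h5 : 99 / 70 <= expR (2 * (2 * (2 * (2 * (1 / 45)))) : R) by apply: (sq _ (119 / 100)) => //; lra.
have -> : 32 / 45 = 2 * (2 * (2 * (2 * (2 * (1 / 45))))) :> R by lra.
by apply: (sq _ (99 / 70)) => //; lra.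
Qed.

End expR_quadratic.

Lemma Rexpect_sum (R : realType) dT (T : measurableType dT) (P : probability T R)
    (I : Type) (r : seq I) (F : I -> T -> R) :
  (forall i, P.-integrable setT (EFin \o F i)) ->
  P.-integrable setT (EFin \o (fun t => \sum_(i <- r) F i t)) /\
  \int[P]_t (\sum_(i <- r) F i t) = \sum_(i <- r) \int[P]_t F i t.
Proof.
move=> IF; elim: r => [|i r [IH1 IH2]].
  have e : (fun t : T => \sum_(i <- [::]) F i t) = cst 0 by apply/funext => t; rewrite big_nil.
  by rewrite e big_nil; split; [exact: prob_integrable_cst|exact: Rexpect_cst].
have e : (fun t : T => \sum_(j <- i :: r) F j t) = (fun t => F i t + \sum_(j <- r) F j t).
  by apply/funext => t; rewrite big_cons.
rewrite e big_cons; split; first exact: integrable_EFinD.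
by rewrite RintegralD// IH2.
Qed.

Lemma lipschitz_hs_measurable (R : realType) (d : nat) (L : R) (f : 'cV[R]_d -> R) :
  lipschitz_hs L f -> measurable_fun [set: borel_cV R d] f.
Proof.
by move=> lf; apply: continuous_borel_measurable; exact: lipschitz_hs_continuous lf.
Qed.

Lemma lipschitz_hs_integrable (R : realType) (d : nat) (P : probability (borel_cV R d) R)
    (L : R) (f : 'cV[R]_d -> R) :
  P.-integrable setT (EFin \o (fun x : borel_cV R d => hsnorm (x : 'cV[R]_d))) ->
  lipschitz_hs L f -> P.-integrable setT (EFin \o (f : borel_cV R d -> R)).
Proof.
move=> IP lf; have I0 := integrable_EFinD (prob_integrable_cst P `|f 0|) (integrable_EFinZ L IP).
apply: integrable_le I0; first exact: lipschitz_hs_measurable lf.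
move=> x; have := lf x 0; rewrite subr0 /cst => h.
have := ler_normD (f 0) (f x - f 0); rewrite addrC subrK; lra.
Qed.

Section innovation_moments.
Context {R : realType} {q : nat} (mu : probability (borel_cV R q) R).
Hypothesis hmean : centered mu.
Hypothesis hcov : unit_covariance mu.
Local Notation E := (borel_cV R q).

Let co (i : 'I_q) (u : E) : R := (u : 'cV[R]_q) i ord0.

Let mco i : measurable_fun setT (co i).
Proof.
apply: (@continuous_borel_measurable _ _ _ (fun x : 'cV[R]_q => x i ord0)).
exact: coord_continuous.
Qed.

Let co_sqr_integrable i : mu.-integrable setT (EFin \o (fun u => co i u * co i u)).
Proof.
apply/integrableP; split; first by apply/measurable_EFinP; exact: measurable_funM.
rewrite (eq_integral (fun u : E => (co i u * co i u)%:E)); last first.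
  by move=> u _ /=; rewrite ger0_norm// -expr2 sqr_ge0.
by rewrite hcov ltry.
Qed.

Let co_integrable i : mu.-integrable setT (EFin \o co i).
Proof.
apply: integrable_le (integrable_EFinD (prob_integrable_cst mu 1) (co_sqr_integrable i)) => // u.
by rewrite ler_norml /cst; apply/andP; split; nra.
Qed.

Let coM_integrable i j : mu.-integrable setT (EFin \o (fun u => co i u * co j u)).
Proof.
apply: integrable_le (integrable_EFinD (co_sqr_integrable i) (co_sqr_integrable j)) => [|u].
  exact: measurable_funM.
by rewrite ler_norml; apply/andP; split; nra.
Qed.

Let co_mean i : \int[mu]_u co i u = 0.
Proof. by rewrite /Rintegral hmean. Qed.

Let co_cov i j : \int[mu]_u (co i u * co j u) = (1%:M : 'M[R]_q) i j.
Proof. by rewrite /Rintegral hcov. Qed.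

Lemma innovation_linear (c : 'cV[R]_q) :
  mu.-integrable setT (EFin \o (fun u : E => \sum_i c i ord0 * (u : 'cV[R]_q) i ord0)) /\
  \int[mu]_u (\sum_i c i ord0 * (u : 'cV[R]_q) i ord0) = 0.
Proof.
have [I1 ->] := @Rexpect_sum _ _ _ mu _ (index_enum 'I_q) (fun i u => c i ord0 * co i u)
  (fun i => integrable_EFinZ (c i ord0) (co_integrable i)).
by split=> //; rewrite big1// => i _; rewrite RintegralZl// co_mean mulr0.
Qed.

Let affine_sqr (y : R) (a : 'I_q -> R) :
  mu.-integrable setT (EFin \o (fun u : E => (y + \sum_i a i * co i u) ^+ 2)) /\
  \int[mu]_u ((y + \sum_i a i * co i u) ^+ 2) = y ^+ 2 + \sum_i a i ^+ 2.
Proof.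
have [I1 E1] := @Rexpect_sum _ _ _ mu _ (index_enum 'I_q) (fun i u => a i * co i u)
  (fun i => integrable_EFinZ (a i) (co_integrable i)).
have [I2 E2] := @Rexpect_sum _ _ _ mu _ (index_enum ('I_q * 'I_q)%type)
  (fun ij u => a ij.1 * a ij.2 * (co ij.1 u * co ij.2 u))
  (fun ij => integrable_EFinZ (a ij.1 * a ij.2) (coM_integrable ij.1 ij.2)).
have e u : (y + \sum_i a i * co i u) ^+ 2 = y ^+ 2 + (2 * y * (\sum_i a i * co i u) +
    \sum_ij a ij.1 * a ij.2 * (co ij.1 u * co ij.2 u)).
  have -> : \sum_ij a ij.1 * a ij.2 * (co ij.1 u * co ij.2 u) = (\sum_i a i * co i u) ^+ 2.
    rewrite -(pair_bigA _ (fun i j => a i * a j * (co i u * co j u)))/= expr2 mulr_suml.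
    by apply: eq_bigr => i _; rewrite mulr_sumr; apply: eq_bigr => j _; ring.
  ring.
have {}e := funext e; rewrite e.
have I0 := prob_integrable_cst mu (y ^+ 2).
have I3 := integrable_EFinZ (2 * y) I1.
split; first by apply: integrable_EFinD => //; exact: integrable_EFinD.
rewrite RintegralD//; last exact: integrable_EFinD.
rewrite RintegralD// RintegralZl// E1 E2 (Rexpect_cst mu (y ^+ 2)); congr (_ + _).
rewrite big1 ?mulr0 ?add0r; last by move=> i _; rewrite RintegralZl// co_mean mulr0.
rewrite -(pair_bigA _ (fun i j => \int[mu]_u (a i * a j * (co i u * co j u))))/=.
apply: eq_bigr => i _; rewrite (bigD1 i)//= RintegralZl// co_cov mxE eqxx mulr1 -expr2.
rewrite big1 ?addr0// => j ji; rewrite RintegralZl// co_cov mxE eq_sym (negbTE ji).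
by rewrite mulr0.
Qed.

Lemma innovation_second_moment m (y : 'cV[R]_m) (A : 'M[R]_(m, q)) :
  mu.-integrable setT (EFin \o (fun u : E => hsnorm (y + A *m (u : 'cV[R]_q)) ^+ 2)) /\
  \int[mu]_u (hsnorm (y + A *m (u : 'cV[R]_q)) ^+ 2) = hsnorm y ^+ 2 + hsnorm A ^+ 2.
Proof.
have e : (fun u : E => hsnorm (y + A *m (u : 'cV[R]_q)) ^+ 2) =
    (fun u => \sum_k (y k ord0 + \sum_i A k i * co i u) ^+ 2).
  apply/funext => u; rewrite hsnorm_col_sqr; apply: eq_bigr => k _.
  by rewrite !mxE.
have [I1 E1] := @Rexpect_sum _ _ _ mu _ (index_enum 'I_m)
  (fun k u => (y k ord0 + \sum_i A k i * co i u) ^+ 2)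
  (fun k => (affine_sqr (y k ord0) (A k)).1).
rewrite e; split => //; rewrite E1 hsnorm_col_sqr hsnorm_sqr.
rewrite -(pair_bigA _ (fun k i => A k i ^+ 2))/= -big_split/=.
by apply: eq_bigr => k _; exact: (affine_sqr _ _).2.
Qed.

Lemma innovation_sqr_integrable :
  mu.-integrable setT (EFin \o (fun u : E => hsnorm (u : 'cV[R]_q) ^+ 2)).
Proof.
have := (innovation_second_moment 0 1%:M).1.
by rewrite (_ : (fun _ => _) = (fun u : E => hsnorm (u : 'cV[R]_q) ^+ 2))//; apply/funext => u; rewrite mul1mx add0r.
Qed.

Lemma innovation_norm_integrable :
  mu.-integrable setT (EFin \o (fun u : E => hsnorm (u : 'cV[R]_q))).
Proof.
apply: integrable_le (integrable_EFinD (prob_integrable_cst mu 1) innovation_sqr_integrable) => [|u].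
  exact: lipschitz1_measurable (@hsnorm_lipschitz1 _ _).
rewrite ger0_norm ?hsnorm_ge0// /cst; have := hsnorm_ge0 (u : 'cV[R]_q).
by set x := hsnorm _; nra.
Qed.

End innovation_moments.

Section concentration.
Context {R : realType} {q : nat} (mu : probability (borel_cV R q) R).
Local Notation E := (borel_cV R q).
Hypothesis IU : mu.-integrable setT (EFin \o (fun u : E => hsnorm (u : 'cV[R]_q))).

Let hsm : measurable_fun setT (fun u : E => hsnorm (u : 'cV[R]_q)).
Proof. exact: lipschitz1_measurable (@hsnorm_lipschitz1 _ _). Qed.

(** The hypothesis is applied to [f / L] with parameter [L]; a constant [f], the case [L = 0], is
    separate. *)
Lemma concentration_lipschitz_hs (beta L : R) (f : 'cV[R]_q -> R) :
  gaussian_concentration mu beta -> 0 <= L -> lipschitz_hs L f ->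
  mgf_le mu f ((\int[mu]_u f u) + beta * L ^+ 2 / 4).
Proof.
move=> hGC; rewrite le_eqVlt => /predU1P[<-|L0] lf.
  have -> : f = cst (f 0).
    by apply/funext => u; apply/eqP; rewrite -subr_eq0 -normr_le0 (le_trans (lf u 0))// mul0r.
  by rewrite (Rexpect_cst mu) expr0n/= mulr0 mul0r addr0; exact: mgf_le_cst.
have lf1 : lipschitz1 (fun u => L^-1 * f u).
  move=> u v; rewrite -mulrBr normrM gtr0_norm ?invr_gt0// mulrC ler_pdivrMr//.
  by rewrite mulrC; exact: lf.
split; first exact: lipschitz_hs_measurable lf.
have := hGC _ L lf1 (ltW L0).
rewrite RintegralZl//; last exact: lipschitz_hs_integrable lf.
by rewrite mulVKf ?gt_eqF//; under eq_integral do rewrite mulVKf ?gt_eqF//.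
Qed.

Let sum_geometric_le (N : nat) : \sum_(i < N) expR (- i%:R) <= (1 - expR (- 1))^-1 :> R.
Proof.
have x1 : expR (- 1) < 1 :> R by rewrite expR_lt1 ltrN10.
have x0 := expR_gt0 (- 1 : R); set x := expR (-1) in x1 x0 *.
rewrite (eq_bigr (fun i : 'I_N => x ^+ i)); last first.
  by move=> i _; rewrite /x -expRM_natl mulrN1.
have h : (1 - x) * (\sum_(i < N) x ^+ i) = 1 - x ^+ N.
  by rewrite -opprB mulNr -subrX1 opprB.
rewrite -[leRHS]mul1r ler_pdivlMr ?subr_gt0// mulrC h gerBl.
by rewrite exprn_ge0// ltW.
Qed.

(* [exp (r^2 / (2 beta))] is dominated by a series of exponentials
   [exp (n r - beta n^2 / 2)] in which concentration applies term by term. *)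
Lemma concentration_exp_sq_moment (beta : R) : 0 < beta ->
  gaussian_concentration mu beta ->
  (exp_sq_moment mu (1 / (2 * beta)) < +oo)%E.
Proof.
move=> b0 hGC.
pose m := \int[mu]_u hsnorm (u : 'cV[R]_q).
pose F (n : nat) (u : E) : R := expR (n%:R * hsnorm (u : 'cV[R]_q) - beta * n%:R ^+ 2 / 2).
have mF n : measurable_fun setT (fun u => (F n u)%:E).
  apply/measurable_EFinP; apply: (measurableT_comp (@measurable_expR R)).
  by apply: measurable_funB => //; exact: measurable_funM.
have F0 n u : (0 <= (F n u)%:E)%E by rewrite lee_fin expR_ge0.
pose c := expR ((m + 1) ^+ 2 / beta).
have Fint n : (\int[mu]_u (F n u)%:E <= (c * expR (- n%:R))%:E)%E.
  have h := concentration_lipschitz_hs hGC (ler0n R n)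
    (f := fun u => n%:R * hsnorm u) _.
  have ln : lipschitz_hs n%:R (fun u : 'cV[R]_q => n%:R * hsnorm u).
    by move=> u v; rewrite -mulrBr normrM ger0_norm// ler_wpM2l// ler_hsnorm_dist.
  have [_] := mgf_leD (- (beta * n%:R ^+ 2 / 2)) (h ln).
  move=> /le_trans; apply; rewrite lee_fin -expRD ler_expR RintegralZl// -/m.
  (* Concentration costs [beta n^2 / 4] out of the available [beta n^2 / 2]. Completing the square
     shows that the rest beats [n * m] and still leaves a factor [exp (- n)], which is summable. *)
  have : 0 <= (beta * n%:R / 2 - (m + 1)) ^+ 2 / beta by rewrite divr_ge0 ?sqr_ge0 ?ltW.
  have -> : (beta * n%:R / 2 - (m + 1)) ^+ 2 / beta =
    beta * n%:R ^+ 2 / 4 - n%:R * (m + 1) + (m + 1) ^+ 2 / beta by field; rewrite gt_eqF.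
  lra.
apply: (@le_lt_trans _ _ (\int[mu]_u ((expR (beta / 2))%:E * (\sum_(0 <= n <oo) (F n u)%:E))%E)%E).
  apply: ge0_le_integral => //.
  - apply/measurable_EFinP; apply: (measurableT_comp (@measurable_expR R)).
    by apply: measurable_funM => //; exact: measurable_funX.
  - apply: emeasurable_funM => //.
    exact: ge0_emeasurable_sum.
  - move=> u _; set r := hsnorm _.
    have r0 : 0 <= r / beta by rewrite divr_ge0 ?hsnorm_ge0// ltW.
    (* The exponent [n r - beta n^2 / 2] is maximal at [n = r / beta]; rounding down to an integer
       loses at most [beta / 2]. *)
    have [n /andP[n1 n2]] : exists n : nat, n%:R <= r / beta < n.+1%:R.
      by exists (Num.truncn (r / beta)); rewrite truncn_itv.
    apply: (@le_trans _ _ ((expR (beta / 2))%:E * (F n u)%:E)%E).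
      rewrite -EFinM lee_fin -expRD ler_expR -/r.
      have : (r / beta - n%:R) ^+ 2 <= 1.
        rewrite -natr1 in n2; rewrite expr2; nra.
      move=> /(ler_wpM2l (ltW b0)).
      have -> : beta * (r / beta - n%:R) ^+ 2 = r ^+ 2 / beta - 2 * n%:R * r + beta * n%:R ^+ 2.
        by field; rewrite gt_eqF.
      have -> : 1 / (2 * beta) * r ^+ 2 = r ^+ 2 / beta / 2 by field; rewrite gt_eqF.
      lra.
    apply: lee_wpmul2l; first by rewrite lee_fin expR_ge0.
    apply: le_trans (nneseries_lim_ge n.+1 _) => //.
    by rewrite big_nat_recr//= leeDr// sume_ge0.
rewrite ge0_integralZl//; last 2 first.
- exact: ge0_emeasurable_sum.
- by move=> u _; exact: nneseries_ge0.
apply: lte_mul_pinfty => //; rewrite ?lee_fin ?expR_ge0//.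
rewrite integral_nneseries//.
apply: (@le_lt_trans _ _ (c * (1 - expR (- 1))^-1)%:E); last exact: ltry.
apply: lime_le; first by apply: is_cvg_nneseries => n _ _; exact: integral_ge0.
apply: nearW => N; rewrite big_mkord.
apply: (@le_trans _ _ (\sum_(i < N) (c * expR (- i%:R))%:E)%E).
  by apply: lee_sum => i _; exact: Fint.
by rewrite sumEFin lee_fin -mulr_sumr ler_wpM2l ?expR_ge0//.
Qed.

(** With [A s] the mean of [exp (s l h)], Jensen gives [A (-1) >= exp (- l m)], so it suffices to
    bound [A 1 * A (-1)] by [exp (27/16 * x)] where [x = l^2 / kappa]. In this product the
    first-order terms [l m] and [- l m] cancel up to a negative square, so the mean costs
    nothing. *)
Lemma concentration_of_exp_sq_moment (kappa : R) : 0 < kappa ->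
  (exp_sq_moment mu kappa <= 2%:E)%E ->
  gaussian_concentration mu (27 / (4 * kappa)).
Proof.
move=> k0 hk f l lf l0.
pose h u := f u - f 0; pose x := l ^+ 2 / kappa.
have x0 : 0 <= x by rewrite divr_ge0 ?sqr_ge0 ?ltW.
have If := lipschitz1_integrable IU lf.
have Ih : mu.-integrable setT (EFin \o (h : E -> R)).
  by apply: integrable_EFinB => //; exact: (prob_integrable_cst mu (f 0)).
have hu u : `|h u| <= hsnorm u by have := lf u 0; rewrite subr0.
have mh := integrable_measurable Ih.
have mU2 : measurable_fun setT (fun u : E => kappa * hsnorm (u : 'cV[R]_q) ^+ 2).
  by apply: measurable_funM => //; exact: measurable_funX.
have hk2 : mgf_le mu (fun u => kappa * hsnorm (u : 'cV[R]_q) ^+ 2) (ln 2).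
  by split=> //; rewrite lnK// posrE.
pose m := \int[mu]_u h u.
pose P := (mgf_le mu (fun u => l * h u) (l * m + 27 / 16 * x)).
suff [_ le] : P.
  have Efh : \int[mu]_u f u = m + f 0.
    by rewrite /m RintegralB//; [rewrite (Rexpect_cst mu) subrK|exact: (prob_integrable_cst mu (f 0))].
  have : mgf_le mu (fun u => l * h u + l * f 0) (l * m + 27 / 16 * x + l * f 0).
    by apply: mgf_leD; split => //; exact: measurable_funM.
  move=> [_]; under eq_integral do rewrite /h mulrBr subrK.
  move=> /le_trans; apply; rewrite lee_fin ler_expR Efh /x.
  have -> : 27 / (4 * kappa) * l ^+ 2 / 4 = 27 / 16 * (l ^+ 2 / kappa).
    by field; rewrite gt_eqF.
  lra.
have x2 : l ^+ 2 = x * kappa by rewrite /x mulfVK// gt_eqF.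
(* For large [x], the product [l |u|] is split by Young's inequality with the fraction 3/5 of the
   exponent [kappa |u|^2], leaving [5/12 * x]. Doubling both parts must stay below [27/16 * x] for
   [x > 1]. *)
have mgf6 (s : R) : s ^+ 2 = 1 ->
    mgf_le mu (fun u => s * l * h u) (3 / 5 * ln 2 + 5 / 12 * x).
  move=> s1; have h6 := mgf_leZ (ltac:(lra) : 0 <= (3 / 5 : R) <= 1) hk2.
  apply: mgf_le_le (mgf_leD (5 / 12 * x) h6) => [|u]; first exact: measurable_funM.
  apply: (@le_trans _ _ (l * hsnorm u)).
    apply: le_trans (ler_norm _) _; rewrite !normrM (ger0_norm l0).
    have -> : `|s| = 1 by apply/eqP; rewrite -sqrp_eq1// real_normK ?num_real// s1.
    by rewrite mul1r ler_wpM2l.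
  set r := hsnorm u.
  have : 0 <= (3 / 5 * kappa * r - l / 2) ^+ 2 / (3 / 5 * kappa).
    by rewrite divr_ge0 ?sqr_ge0// mulr_ge0// ltW.
  have -> : (3 / 5 * kappa * r - l / 2) ^+ 2 / (3 / 5 * kappa) =
    3 / 5 * (kappa * r ^+ 2) - l * r + 5 / 12 * x.
    by rewrite /x; field; rewrite gt_eqF.
  lra.
have sq1 : (1 : R) ^+ 2 = 1 by rewrite expr1n.
have sqN1 : (-1 : R) ^+ 2 = 1 by rewrite sqrrN expr1n.
pose A (s : R) := \int[mu]_u expR (s * l * h u).
have mA s : measurable_fun [set: E] (fun u : E => s * l * h u) by exact: measurable_funM.
have IA s : s ^+ 2 = 1 -> mu.-integrable setT (EFin \o (fun u : E => expR (s * l * h u))).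
  by move=> s1; exact: mgf_le_integrable (mgf6 s s1).
have A_ge0 s : 0 <= A s by exact: (@Rintegral_ge0 _ E R mu setT _ (fun u _ => expR_ge0 _)).
have AB : A 1 * A (-1) <= expR (27 / 16 * x).
  have ln2 := @ln2_le R.
  have [x1|x1] := leP x 1; last first.
    have A6 s : s ^+ 2 = 1 -> A s <= expR (3 / 5 * ln 2 + 5 / 12 * x).
      by move=> s1; exact: ((integrable_expR_mgf_le mu _ (mA s)).2 (mgf6 s s1)).2.
    apply: (@le_trans _ _ (expR (3 / 5 * ln 2 + 5 / 12 * x) * expR (3 / 5 * ln 2 + 5 / 12 * x))).
      by apply: ler_pM => //; exact: A6.
    rewrite -expRD ler_expR; lra.
  (* For [x <= 1], [l^2 h^2] is at most [x * kappa |u|^2], and the moment bound 2 may be raised to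
     the power [x]. *)
  have hx := mgf_leZ (introT andP (conj x0 x1)) hk2.
  have [Ix lx] := (integrable_expR_mgf_le mu _ hx.1).2 hx.
  have As s : s ^+ 2 = 1 -> A s <= s * l * m + expR (x * ln 2).
    move=> s1; have Is := integrable_EFinZ (s * l) Ih.
    apply: (@le_trans _ _ (\int[mu]_u (s * l * h u + expR (x * (kappa * hsnorm u ^+ 2))))).
      apply: le_Rintegral => //; [exact: IA|exact: integrable_EFinD|].
      move=> u _; apply: le_trans (expR_le_expR_sqr _) _; rewrite lerD2l ler_expR.
      rewrite !exprMn s1 mul1r x2 -mulrA ler_wpM2l// (ler_wpM2l (ltW k0))//.
      have -> : h u ^+ 2 = `|h u| ^+ 2 by rewrite real_normK// num_real.
      by rewrite ler_pXn2r ?nnegrE ?hsnorm_ge0.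
    by rewrite RintegralD// RintegralZl// lerD2l.
  have a1 := As 1 sq1; have a2 := As (-1) sqN1.
  apply: (@le_trans _ _ ((1 * l * m + expR (x * ln 2)) * (-1 * l * m + expR (x * ln 2)))).
    exact: ler_pM.
  apply: (@le_trans _ _ (expR (x * ln 2) * expR (x * ln 2))).
    by rewrite -subr_ge0 (_ : _ - _ = (l * m) ^+ 2) ?sqr_ge0//; ring.
  rewrite -expRD ler_expR.
  have := ler_wpM2l x0 ln2; lra.
(* Jensen's inequality for [exp (- l h)]. *)
have B1 : expR (- (l * m)) <= A (-1).
  have A0 : 0 < A (-1).
    rewrite lt_neqAle A_ge0 andbT; apply/eqP => A0.
    have : mgf_le mu (fun u => -1 * l * h u) (- (l * m) - 1).
      apply/(integrable_expR_mgf_le mu _ (mA _)); split; first exact: IA.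
      by rewrite -/(A _) -A0 expR_ge0.
    move=> /(mgf_le_Jensen (integrable_EFinZ (-1 * l) Ih)); rewrite RintegralZl// -/m; lra.
  have : mgf_le mu (fun u => -1 * l * h u) (ln (A (-1))).
    apply/(integrable_expR_mgf_le mu _ (mA _)); split; first exact: IA.
    by rewrite lnK// posrE.
  move=> /(mgf_le_Jensen (integrable_EFinZ (-1 * l) Ih)); rewrite RintegralZl// -/m => le.
  rewrite -[leRHS]lnK ?posrE// ler_expR; lra.
have mlh : measurable_fun [set: E] (fun u : E => l * h u) by exact: measurable_funM.
apply/(integrable_expR_mgf_le mu _ mlh).
have -> : (fun u => expR (l * h u)) = (fun u => expR (1 * l * h u)).
  by apply/funext => u; rewrite mul1r.
split; first exact: IA.
rewrite -/(A 1) expRD -ler_pdivrMl ?expR_gt0// -expRN mulrC.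
by apply: le_trans AB; rewrite ler_wpM2l.
Qed.

End concentration.

(** * Independent recursions *)

Lemma measurable_preimage d1 d2 (T1 : measurableType d1) (T2 : measurableType d2)
    (f : T1 -> T2) (A : set T2) :
  measurable_fun setT f -> measurable A -> measurable (f @^-1` A).
Proof. by move=> mf mA; rewrite -[X in measurable X]setTI; exact: mf. Qed.

Section independent_recursion.
Context {R : realType} {d1 d2 : measure_display}
  {E : measurableType d1} {E' : measurableType d2}
  {dO : measure_display} {Omega : measurableType dO} (P : probability Omega R).
Variables (N : nat) (U : nat -> {RV P >-> E'}) (X : nat -> {RV P >-> E}) (x : E).
Variables (mu : probability E' R) (F : nat -> E * E' -> E).
Hypothesis Ulaw : forall i A, measurable A -> P (U i @^-1` A) = mu A.
Hypothesis Uind : forall (s : seq nat) (A : nat -> set E'), uniq s ->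
  (forall i, measurable (A i)) ->
  P (\bigcap_(i in [set` s]) (U i @^-1` A i)) = (\prod_(i <- s) P (U i @^-1` A i))%E.
Hypothesis mF : forall i, (i < N)%N -> measurable_fun setT (F i).
Hypothesis X0 : forall w, X 0%N w = x.
Hypothesis XS : forall i w, (i < N)%N -> X i.+1 w = F i (X i w, U i w).

Let XU i w := (X i w, U i w).

Let mXU i : measurable_fun setT (XU i).
Proof. by apply: measurable_fun_pair; exact: measurable_funPT. Qed.

Let XU_mixin i := isMeasurableFun.Build _ _ _ _ (XU i) (mXU i).
Let XUm i : {mfun Omega >-> (E * E')%type} := HB.pack (XU i) (XU_mixin i).

Let D (s : seq nat) (B : nat -> set E') := \bigcap_(j in [set` s]) (U j @^-1` B j).

Let mD s B : (forall i, measurable (B i)) -> measurable (D s B).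
Proof.
move=> mB; apply: bigcap_measurableType => j _; apply: measurable_preimage => //.
Qed.

(** [X i] is tested against finite cylinders of innovations of index at least [i]. The cylinder
    stays arbitrary because the induction step adds [i] to its index set. *)
Let past_independent i := forall (A : set E) (s : seq nat) (B : nat -> set E'),
  measurable A -> uniq s -> all (fun j => (i <= j)%N) s ->
  (forall j, measurable (B j)) ->
  P (X i @^-1` A `&` D s B) = (P (X i @^-1` A) * P (D s B))%E.

Let law i : probability E R := distribution P (X i).

Let joint_past_independent i : past_independent i ->
  forall (C : set (E * E')) (s : seq nat) (B : nat -> set E'),
  measurable C -> uniq s -> all (fun j => (i < j)%N) s ->
  (forall j, measurable (B j)) ->
  P (XU i @^-1` C `&` D s B) = ((law i \x mu) C * P (D s B))%E.
Proof.
move=> Hi C s B mC us s_gt mB.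
have cfin : P (D s B) \is a fin_num by rewrite fin_num_measure//; exact: mD.
have c0 : 0 <= fine (P (D s B)) by exact: fine_ge0.
(* The product law is scaled by [P (D s B)] rather than conditioned, which also covers a null
   cylinder. Both measures agree on rectangles, so uniqueness of product measures identifies
   them. *)
pose c := NngNum c0.
pose m1' : {measure set (E * E') -> \bar R} := pushforward (mrestr P (mD s mB)) (XU i).
pose m1 := m1' (mXU i).
pose m2 : {measure set (E * E') -> \bar R} := mscale c (law i \x mu)%E.
pose m3 : {finite_measure set E -> \bar R} := mscale c (law i).
have m3E A : m3 A = (P (X i @^-1` A) * P (D s B))%E.
  change (((fine (P (D s B)))%:E * P (X i @^-1` A))%E = (P (X i @^-1` A) * P (D s B))%E).
  by rewrite fineK// muleC.
have e1 A B0 : measurable A -> measurable B0 -> m1 (A `*` B0) = (m3 A * mu B0)%E.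
  move=> mA mB0; change (P (XU i @^-1` (A `*` B0) `&` D s B) = (m3 A * mu B0)%E).
  have ins : i \notin s by apply/negP => /(allP s_gt); rewrite ltnn.
  pose B' j := if j == i then B0 else B j.
  have -> : XU i @^-1` (A `*` B0) `&` D s B = X i @^-1` A `&` D (i :: s) B'.
    apply/seteqP; split=> w /=.
      move=> [[XA UB] sB]; split=> // j /=; rewrite inE /B' => /orP[/eqP ->|js].
        by rewrite eqxx.
      have [ji|_] := eqVneq j i; last exact: sB.
      by rewrite ji in js; rewrite js in ins.
    move=> [XA sB]; split; first split => //.
      by have := sB i; rewrite /= mem_head /B' eqxx => /(_ isT).
    move=> j /= js; have := sB j; rewrite /= inE js orbT /B' => /(_ isT).
    by case: eqP => // ji; rewrite ji in js; rewrite js in ins.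
  have mB' j : measurable (B' j) by rewrite /B'; case: ifP.
  rewrite Hi//; last 2 first.
    by rewrite /= ins.
    by rewrite /= leqnn/=; apply: sub_all s_gt => j; exact: ltnW.
  rewrite Uind//; last by rewrite /= ins.
  rewrite big_cons {1}/B' eqxx Ulaw// m3E Uind// -muleA; congr (_ * _)%E.
  rewrite muleC; congr (_ * _)%E.
  apply: eq_big_seq => j js; rewrite /B'; case: eqP => // ji.
  by rewrite ji in js; rewrite js in ins.
have e2 A B0 : measurable A -> measurable B0 -> m2 (A `*` B0) = (m3 A * mu B0)%E.
  move=> mA mB0; change ((c%:num)%:E * (law i \x mu) (A `*` B0) = (c%:num)%:E * law i A * mu B0)%E.
  by rewrite product_measure1E// muleA.
have := product_measure_unique e1 mC.
rewrite (product_measure_unique e2 mC).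
change (((fine (P (D s B)))%:E * (law i \x mu) C = P (XU i @^-1` C `&` D s B) ->
  P (XU i @^-1` C `&` D s B) = (law i \x mu) C * P (D s B))%E).
by rewrite fineK// => <-; exact: muleC.
Qed.

Let past_independentP i : (i <= N)%N -> past_independent i.
Proof.
elim: i => [_|i IH iN] A s B mA us si mB.
  have [xA|xA] := pselect (A x).
    have -> : X 0%N @^-1` A = setT by apply/seteqP; split=> w //= _; rewrite X0.
    by rewrite setTI probability_setT mul1e.
  have -> : X 0%N @^-1` A = set0 by apply/seteqP; split=> w //=; rewrite X0.
  by rewrite set0I measure0 mul0e.
have Hi := IH (ltnW iN).
have mFA : measurable (F i @^-1` A) by apply: measurable_preimage => //; exact: mF.
have e : X i.+1 @^-1` A = XU i @^-1` (F i @^-1` A).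
  by apply/seteqP; split=> w /=; rewrite XS.
rewrite e (joint_past_independent Hi)//.
have := joint_past_independent Hi mFA (s := [::]) (B := fun=> setT) isT isT (fun=> measurableT).
have -> : D [::] (fun=> setT) = setT by apply/seteqP; split.
by rewrite setIT probability_setT mule1 => ->.
Qed.

Let joint_law i : (i < N)%N -> forall C, measurable C ->
  P (XU i @^-1` C) = ((law i \x mu) C)%E.
Proof.
move=> iN C mC; have Hi := past_independentP (ltnW iN).
have := joint_past_independent Hi mC (s := [::]) (B := fun=> setT) isT isT (fun=> measurableT).
have -> : D [::] (fun=> setT) = setT by apply/seteqP; split.
by rewrite setIT probability_setT mule1.
Qed.

(** Since [X i] and [U i] have a product law, Tonelli integrates out the innovation first. *)
Lemma recursion_step i (g : E -> \bar R) : (i < N)%N ->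
  measurable_fun setT g -> (forall y, 0 <= g y)%E ->
  (\int[P]_w g (X i.+1 w) = \int[P]_w \int[mu]_u g (F i (X i w, u)))%E.
Proof.
move=> iN mg g0.
have mgF : measurable_fun setT (g \o F i) by apply: measurableT_comp => //; exact: mF.
transitivity (\int[P]_w ((g \o F i) \o XUm i) w)%E.
  by apply: eq_integral => w _; rewrite /= XS.
rewrite -(ge0_integral_distribution (P := P) (XUm i))//; last by move=> y; exact: g0.
rewrite (@eq_measure_integral _ _ _ setT (law i \x mu)%E (distribution P (XUm i))); last first.
  by move=> C mC _; exact: joint_law.
rewrite fubini_tonelli1//; last by move=> y; exact: g0.
rewrite (ge0_integral_distribution (P := P) (X i))//.
  by apply: measurable_fun_fubini_tonelli_F => // z; exact: g0.
by move=> y; apply: integral_ge0 => u _; exact: g0.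
Qed.

Lemma recursion_le (G : nat -> E -> \bar R) :
  (forall i, (i <= N)%N -> measurable_fun setT (G i)) -> (forall i y, 0 <= G i y)%E ->
  (forall i y, (i < N)%N -> \int[mu]_u G i.+1 (F i (y, u)) <= G i y)%E ->
  (\int[P]_w G N (X N w) <= G 0%N x)%E.
Proof.
move=> mG G0 GF.
suff h i : (i <= N)%N -> (\int[P]_w G i (X i w) <= G 0%N x)%E by exact: h.
elim: i => [_|i IH iN].
  rewrite (eq_integral (cst (G 0%N x))); last by move=> w _; rewrite X0.
  by rewrite integral_cst// [X in (_ * X)%E]probability_setT mule1.
apply: le_trans (IH (ltnW iN)); rewrite (recursion_step iN)//; last exact: mG.
apply: ge0_le_integral => //.
- by move=> w _; exact: integral_ge0.
- have mgF : measurable_fun setT (G i.+1 \o F i) by apply: measurableT_comp; [exact: mG|exact: mF].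
  have mFub : measurable_fun setT (fubini_F mu (G i.+1 \o F i)).
    by apply: measurable_fun_fubini_tonelli_F => // z; exact: G0.
  exact: (measurableT_comp mFub (measurable_funPT (X i))).
- by apply: measurableT_comp; [exact: (mG _ (ltnW iN))|exact: measurable_funPT].
- by move=> w _; exact: GF.
Qed.

Lemma recursion_eq (G : nat -> E -> \bar R) :
  (forall i, (i <= N)%N -> measurable_fun setT (G i)) -> (forall i y, 0 <= G i y)%E ->
  (forall i y, (i < N)%N -> \int[mu]_u G i.+1 (F i (y, u)) = G i y)%E ->
  (\int[P]_w G N (X N w) = G 0%N x)%E.
Proof.
move=> mG G0 GF.
suff h i : (i <= N)%N -> (\int[P]_w G i (X i w) = G 0%N x)%E by exact: h.
elim: i => [_|i IH iN].
  rewrite (eq_integral (cst (G 0%N x))); last by move=> w _; rewrite X0.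
  by rewrite integral_cst// [X in (_ * X)%E]probability_setT mule1.
rewrite -(IH (ltnW iN)) (recursion_step iN)//; last exact: mG.
by apply: eq_integral => w _; exact: GF.
Qed.

End independent_recursion.

(** * Euler scheme *)

Definition euler_map (R : realType) (d q : nat) (Delta : R)
    (b : 'cV[R]_d -> 'cV[R]_d) (s : 'cV[R]_d -> 'M[R]_(d, q))
    (yu : 'cV[R]_d * 'cV[R]_q) : 'cV[R]_d :=
  yu.1 + Delta *: b yu.1 + Num.sqrt Delta *: (s yu.1 *m yu.2).

Section euler_map.
Context {R : realType} {d q : nat} (mu : probability (borel_cV R q) R).
Hypothesis hmean : centered mu.
Hypothesis hcov : unit_covariance mu.
Variables (Delta lb ls : R) (b : 'cV[R]_d -> 'cV[R]_d) (s : 'cV[R]_d -> 'M[R]_(d, q)).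
Hypothesis Delta0 : 0 <= Delta.
Hypothesis lb0 : 0 <= lb.
Hypothesis ls0 : 0 <= ls.
Hypothesis blip : forall y z, hsnorm (b y - b z) <= lb * hsnorm (y - z).
Hypothesis slip : forall y z, hsnorm (s y - s z) <= ls * hsnorm (y - z).
Local Notation E := (borel_cV R d).
Local Notation E' := (borel_cV R q).
Local Notation F := (euler_map Delta b s).

Let coord_lip m n (g : 'cV[R]_d -> 'M[R]_(m, n)) (L : R) i j :
  (forall y z, hsnorm (g y - g z) <= L * hsnorm (y - z)) ->
  lipschitz_hs L (fun y => g y i j).
Proof.
move=> gl y z; apply: le_trans (gl y z).
by have := norm_coord_le_hsnorm (g y - g z) i j; rewrite !mxE.
Qed.

Lemma euler_map_measurable : measurable_fun setT (F : (E * E')%type -> E).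
Proof.
apply: measurable_coord_cV => i.
rewrite (_ : (fun _ => _) = (fun yu : (E * E')%type =>
  (yu.1 : 'cV[R]_d) i ord0 + Delta * b yu.1 i ord0 +
  Num.sqrt Delta * \sum_k s yu.1 i k * (yu.2 : 'cV[R]_q) k ord0)); last first.
  by apply/funext => yu; rewrite /euler_map !mxE.
have m1 : measurable_fun setT (fst : (E * E')%type -> E) by exact: measurable_fst.
have m2 : measurable_fun setT (snd : (E * E')%type -> E') by exact: measurable_snd.
have mc n k : measurable_fun setT (fun y : borel_cV R n => (y : 'cV[R]_n) k ord0).
  apply: (@continuous_borel_measurable _ _ _ (fun x : 'cV[R]_n => x k ord0)).
  exact: coord_continuous.
apply: measurable_funD; first apply: measurable_funD.
- exact: (measurableT_comp (mc d i) m1).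
- apply: measurable_funM => //.
  exact: (measurableT_comp (lipschitz_hs_measurable (coord_lip i ord0 blip)) m1).
- apply: measurable_funM => //; apply: measurable_sum => k; apply: measurable_funM.
    exact: (measurableT_comp (lipschitz_hs_measurable (coord_lip i k slip)) m1).
  exact: (measurableT_comp (mc q k) m2).
Qed.

Lemma euler_mapB y z u : F (y, u) - F (z, u) =
  (y - z + Delta *: (b y - b z)) + (Num.sqrt Delta *: (s y - s z)) *m u.
Proof.
rewrite /euler_map /= -scalemxAl mulmxBl; apply/matrixP => i j; rewrite !mxE; ring.
Qed.

Lemma euler_map_lipschitz_innovation y (v : 'cV[R]_d -> R) (L : R) : 0 <= L ->
  lipschitz_hs L v -> lipschitz_hs (L * (Num.sqrt Delta * hsnorm (s y))) (fun u => v (F (y, u))).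
Proof.
move=> L0 lv u w; apply: le_trans (lv _ _) _; rewrite -mulrA ler_wpM2l//.
rewrite /euler_map /= opprD addrACA subrr add0r -scalerBr -mulmxBr.
rewrite hsnormZ ger0_norm ?sqrtr_ge0// -mulrA ler_wpM2l ?sqrtr_ge0//.
exact: hsnorm_mulmx.
Qed.

Local Notation kappa := (Num.sqrt (1 + CDelta lb ls Delta * Delta)).

Lemma CDelta_ge0 : 0 <= CDelta lb ls Delta.
Proof. by rewrite /CDelta !addr_ge0 ?mulr_ge0 ?sqr_ge0. Qed.

(** The two schemes share the innovation, so centring removes the cross term and the second moment
    grows by [(1 + Delta * lb)^2 + Delta * ls^2 = 1 + C * Delta]. *)
Lemma euler_map_contraction y z :
  mu.-integrable setT (EFin \o (fun u : E' => hsnorm (F (y, u) - F (z, u)))) /\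
  \int[mu]_u hsnorm (F (y, u : 'cV[R]_q) - F (z, u)) <= kappa * hsnorm (y - z).
Proof.
have CD : 0 <= CDelta lb ls Delta * Delta by rewrite mulr_ge0// CDelta_ge0.
have [->|yz] := eqVneq y z.
  rewrite (_ : (fun u : E' => _) = cst 0); last first.
    by apply/funext => u; rewrite subrr hsnorm0.
  rewrite (Rexpect_cst mu) subrr hsnorm0 mulr0; split => //.
  exact: prob_integrable_cst.
set Z := fun u => hsnorm (F (y, u) - F (z, u)).
have [I2 E2] := innovation_second_moment hmean hcov (y - z + Delta *: (b y - b z))
  (Num.sqrt Delta *: (s y - s z)).
have eZ : (fun u : E' => hsnorm (y - z + Delta *: (b y - b z)
    + Num.sqrt Delta *: (s y - s z) *m (u : 'cV[R]_q)) ^+ 2) = (fun u => Z u ^+ 2).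
  by apply/funext => u; rewrite /Z euler_mapB.
rewrite eZ in I2 E2.
have D0 : 0 < hsnorm (y - z) by rewrite hsnorm_gt0 subr_eq0.
pose a := kappa * hsnorm (y - z).
have a0 : 0 < a by rewrite mulr_gt0// sqrtr_gt0; lra.
have a2 : a ^+ 2 = (1 + CDelta lb ls Delta * Delta) * hsnorm (y - z) ^+ 2.
  by rewrite exprMn sqr_sqrtr//; lra.
have E2le : \int[mu]_u (Z u ^+ 2) <= a ^+ 2.
  rewrite E2 a2 hsnormZ exprMn (ger0_norm (sqrtr_ge0 _)) [Num.sqrt Delta ^+ 2]sqr_sqrtr//.
  have h1 : hsnorm (y - z + Delta *: (b y - b z)) <= (1 + Delta * lb) * hsnorm (y - z).
    apply: le_trans (ler_hsnormD _ _) _; rewrite hsnormZ ger0_norm// mulrDl mul1r lerD2l.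
    by rewrite -mulrA ler_wpM2l.
  have h1' : hsnorm (y - z + Delta *: (b y - b z)) ^+ 2 <= ((1 + Delta * lb) * hsnorm (y - z)) ^+ 2.
    by rewrite ler_pXn2r ?nnegrE ?hsnorm_ge0// mulr_ge0// ?addr_ge0 ?mulr_ge0// ltW.
  have h2 : hsnorm (s y - s z) ^+ 2 <= (ls * hsnorm (y - z)) ^+ 2.
    by rewrite ler_pXn2r ?nnegrE ?hsnorm_ge0// mulr_ge0// ltW.
  have h3 := ler_wpM2l Delta0 h2.
  apply: le_trans (lerD h1' h3) _; rewrite /CDelta le_eqVlt; apply/orP; left; apply/eqP; ring.
have mZ : measurable_fun setT (Z : E' -> R).
  have mF : measurable_fun setT ((fun u : E' => F (y, u) - F (z, u)) : E' -> E).
    apply: measurable_coord_cV => i.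
    rewrite (_ : (fun _ => _) = (fun u : E' => F (y, u) i ord0 - F (z, u) i ord0)); last first.
      by apply/funext => u; rewrite !mxE.
    have mc : measurable_fun setT (fun y : E => (y : 'cV[R]_d) i ord0).
      apply: (@continuous_borel_measurable _ _ _ (fun x : 'cV[R]_d => x i ord0)).
      exact: coord_continuous.
    have mFy w : measurable_fun setT (fun u : E' => F (w, u) i ord0).
      have mFw : measurable_fun setT (fun u : E' => F (w, u) : E).
        exact: (@measurable_fun_pair2 _ _ _ E E' E F w euler_map_measurable).
      exact: (measurableT_comp mc mFw).
    exact: measurable_funB.
  exact: (measurableT_comp (lipschitz1_measurable (@hsnorm_lipschitz1 R d)) mF).
have Ib : mu.-integrable setT (EFin \o (fun u : E' => a / 2 + (2 * a)^-1 * Z u ^+ 2)).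
  by apply: integrable_EFinD; [exact: (prob_integrable_cst mu (a / 2))|exact: integrable_EFinZ].
(* Passing from the second moment to the first by this arithmetic-geometric bound also yields
   integrability of [Z]. *)
have Zb u : Z u <= a / 2 + (2 * a)^-1 * Z u ^+ 2.
  have : 0 <= (Z u - a) ^+ 2 / (2 * a) by rewrite divr_ge0 ?sqr_ge0// mulr_ge0// ltW.
  have -> : (Z u - a) ^+ 2 / (2 * a) = (2 * a)^-1 * Z u ^+ 2 - Z u + a / 2.
    by field; rewrite gt_eqF.
  lra.
have IZ : mu.-integrable setT (EFin \o (Z : E' -> R)).
  by apply: integrable_le Ib => // u; rewrite ger0_norm ?hsnorm_ge0.
split=> //; apply: (@le_trans _ _ (\int[mu]_u (a / 2 + (2 * a)^-1 * Z u ^+ 2))).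
  by apply: le_Rintegral => // u _; exact: Zb.
rewrite RintegralD//; last 2 first.
- exact: (prob_integrable_cst mu (a / 2)).
- exact: integrable_EFinZ.
rewrite (Rexpect_cst mu (a / 2)) RintegralZl//.
have i0 : 0 <= (2 * a)^-1 by rewrite invr_ge0 mulr_ge0// ltW.
have := ler_wpM2l i0 E2le; have -> : (2 * a)^-1 * a ^+ 2 = a / 2 by field; rewrite gt_eqF.
rewrite -/a; lra.
Qed.

Lemma euler_map_integrable y (v : 'cV[R]_d -> R) (L : R) : 0 <= L -> lipschitz_hs L v ->
  mu.-integrable setT (EFin \o (fun u : E' => v (F (y, u)))).
Proof.
move=> L0 lv.
exact: lipschitz_hs_integrable (innovation_norm_integrable hmean hcov)
  (euler_map_lipschitz_innovation y L0 lv).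
Qed.

Lemma euler_map_value_lipschitz (v : 'cV[R]_d -> R) (L : R) : 0 <= L -> lipschitz_hs L v ->
  lipschitz_hs (kappa * L) (fun y => \int[mu]_u v (F (y, u : 'cV[R]_q))).
Proof.
move=> L0 lv; apply: le_lipschitz_hs => y z.
have [IZ EZ] := euler_map_contraction y z.
have Iy := euler_map_integrable y L0 lv; have Iz := euler_map_integrable z L0 lv.
rewrite -RintegralB//.
apply: (@le_trans _ _ (\int[mu]_u (L * hsnorm (F (y, u : 'cV[R]_q) - F (z, u))))).
  apply: le_Rintegral => //; [exact: integrable_EFinB|exact: integrable_EFinZ|].
  by move=> u _; exact: le_trans (ler_norm _) (lv _ _).
by rewrite RintegralZl// mulrAC [leRHS]mulrC ler_wpM2l.
Qed.

End euler_map.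

Section euler_scheme_law.
Context {R : realType} {d q : nat} (mu : probability (borel_cV R q) R).
Hypothesis hmean : centered mu.
Hypothesis hcov : unit_covariance mu.
Local Notation E := (borel_cV R d).
Local Notation E' := (borel_cV R q).
Context {dO : measure_display} {Omega : measurableType dO} (P : probability Omega R).
Variables (N : nat) (U : nat -> {RV P >-> E'}) (X : nat -> {RV P >-> E}) (x : 'cV[R]_d).
Variables (Delta lb ls : R) (b : nat -> 'cV[R]_d -> 'cV[R]_d)
  (s : nat -> 'cV[R]_d -> 'M[R]_(d, q)).
Local Notation F i := (euler_map Delta (b i) (s i)).
Hypothesis Delta0 : 0 <= Delta.
Hypothesis lb0 : 0 <= lb.
Hypothesis ls0 : 0 <= ls.
Hypothesis blip : forall i y z, (i < N)%N -> hsnorm (b i y - b i z) <= lb * hsnorm (y - z).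
Hypothesis slip : forall i y z, (i < N)%N -> hsnorm (s i y - s i z) <= ls * hsnorm (y - z).
Hypothesis hU : iid_with_law U mu.
Hypothesis X0 : forall w, X 0%N w = x.
Hypothesis XS : forall i w, (i < N)%N -> X i.+1 w = F i (X i w : 'cV[R]_d, U i w : 'cV[R]_q).

Let C := CDelta lb ls Delta.
Let kappa := Num.sqrt (1 + C * Delta).
Let CD0 : 0 <= C * Delta. Proof. by rewrite mulr_ge0// CDelta_ge0. Qed.
Let kappa0 : 0 <= kappa. Proof. exact: sqrtr_ge0. Qed.

Let mF i : (i < N)%N -> measurable_fun setT (F i : (E * E')%type -> E).
Proof.
by move=> iN; exact: (euler_map_measurable _ (fun y z => blip y z iN) (fun y z => slip y z iN)).
Qed.

(* [value f n y] is the conditional expectation of [f (X N)] given [X (N - n) = y]. *)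
Fixpoint value (f : 'cV[R]_d -> R) (n : nat) (y : 'cV[R]_d) : R :=
  if n is n'.+1 then \int[mu]_u value f n' (F (N - n) (y, u : 'cV[R]_q)) else f y.

Let subN i n : (n < N)%N -> i = (N - n.+1)%N -> (i < N)%N.
Proof. by move=> nN ->; rewrite ltn_subrL (leq_ltn_trans _ nN). Qed.

Lemma value_lipschitz f L n : 0 <= L -> lipschitz_hs L f -> (n <= N)%N ->
  lipschitz_hs (kappa ^+ n * L) (value f n).
Proof.
move=> L0 lf; elim: n => [_|n IH nN]; first by rewrite expr0 mul1r.
have iN := subN nN erefl; rewrite exprS -mulrA /=.
apply: (euler_map_value_lipschitz hmean hcov Delta0 lb0 ls0 (fun y z => blip y z iN)
  (fun y z => slip y z iN) _ (IH (ltnW nN))).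
by rewrite mulr_ge0// exprn_ge0.
Qed.

Lemma value_integrable f L n i y : 0 <= L -> lipschitz_hs L f -> (n < N)%N ->
  mu.-integrable setT (EFin \o (fun u : E' => value f n (F i (y, u : 'cV[R]_q)))).
Proof.
move=> L0 lf nN.
apply: (@euler_map_integrable _ _ _ mu hmean hcov _ _ _ _ _ (kappa ^+ n * L)).
  by rewrite mulr_ge0// exprn_ge0.
by apply: value_lipschitz => //; exact: ltnW.
Qed.

Lemma value_ge0 f n y : (forall z, 0 <= f z) -> 0 <= value f n y.
Proof.
by move=> f0; elim: n y => [//|n IH] y /=; apply: Rintegral_ge0 => u _; exact: IH.
Qed.

Lemma valueD f g Lf Lg n y : 0 <= Lf -> lipschitz_hs Lf f -> 0 <= Lg -> lipschitz_hs Lg g ->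
  (n <= N)%N -> value (fun z => f z + g z) n y = value f n y + value g n y.
Proof.
move=> Lf0 lf Lg0 lg; elim: n y => [//|n IH] y nN /=.
rewrite -RintegralD//; last 2 first.
- exact: value_integrable lf nN.
- exact: value_integrable lg nN.
by apply: eq_Rintegral => u _; exact: IH (ltnW nN).
Qed.

Local Notation muN := (distribution P (X N)).

Lemma value_step f i y : (i < N)%N ->
  value f (N - i) y = \int[mu]_u value f (N - i.+1) (F i (y, u : 'cV[R]_q)).
Proof.
move=> iN; have e : (N - (N - i.+1).+1)%N = i by rewrite subnSK// subKn// ltnW.
rewrite -(subnSK iN) [LHS]/=.
by rewrite e.
Qed.

Lemma value_mean_ge0 f L : 0 <= L -> lipschitz_hs L f -> (forall z, 0 <= f z) ->
  (\int[muN]_y (f y)%:E = (value f N x)%:E)%E.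
Proof.
move=> L0 lf f0; rewrite ge0_integral_distribution; last 2 first.
- by apply/measurable_EFinP; exact: lipschitz_hs_measurable lf.
- by move=> y; rewrite lee_fin.
rewrite -[in RHS](subn0 N) -(@recursion_eq _ _ _ E E' _ _ P N U X x mu (fun i => F i) hU.1 hU.2 mF X0 XS
  (fun i y => (value f (N - i) y)%:E))//.
- by apply: eq_integral => w _ /=; rewrite subnn.
- move=> i iN; apply/measurable_EFinP.
  exact: lipschitz_hs_measurable (value_lipschitz L0 lf (leq_subr i N)).
- by move=> i y; rewrite lee_fin value_ge0.
- move=> i y iN; rewrite value_step// Rexpect_EFin//.
  by apply: value_integrable lf _ => //; apply: (subN iN).
Qed.

(** The integrated recursion handles only nonnegative functions, so [f] is written as a difference
    of two nonnegative Lipschitz functions, the subtracted one being [|f 0| + |y|]. *)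
Lemma value_mean f : lipschitz1 f ->
  muN.-integrable setT (EFin \o (f : E -> R)) /\ \int[muN]_y f y = value f N x.
Proof.
move=> /lipschitz1P lf.
pose h (y : 'cV[R]_d) := `|f 0| + hsnorm y; pose g y := f y + h y.
have lh : lipschitz_hs 1 h.
  move=> u v; rewrite mul1r /h (_ : _ - _ = hsnorm u - hsnorm v); last by ring.
  exact: hsnorm_lipschitz1.
have lg : lipschitz_hs 2 g.
  move=> u v; rewrite /g (_ : _ - _ = (f u - f v) + (h u - h v)); last by ring.
  have := lf u v; have := lh u v; have := ler_normD (f u - f v) (h u - h v); lra.
have h0 z : 0 <= h z by rewrite addr_ge0 ?hsnorm_ge0.
have g0 z : 0 <= g z.
  have := lf z 0; rewrite subr0 /g /h => fz; have := ler_norm (f z - f 0).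
  have := ler_norm (f 0 - f z); rewrite distrC; have := ler_norm (- f 0); rewrite normrN; lra.
have fin k L : lipschitz_hs L k -> 0 <= L -> (forall z, 0 <= k z) ->
    muN.-integrable setT (EFin \o (k : E -> R)) /\ \int[muN]_y k y = value k N x.
  move=> lk L0 k0; have vk := value_mean_ge0 L0 lk k0; split; last by rewrite /Rintegral vk.
  apply/integrableP; split; first by apply/measurable_EFinP; exact: lipschitz_hs_measurable lk.
  rewrite (eq_integral (fun y : E => (k y)%:E)) ?vk ?ltry// => y _ /=.
  by rewrite ger0_norm.
have [Ih Eh] := fin _ _ lh ler01 h0; have [Ig Eg] := fin _ _ lg (ler0n _ 2) g0.
have fE : f = (fun y => g y - h y) by apply/funext => y; rewrite /g addrK.
split; first by rewrite fE; exact: integrable_EFinB.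
rewrite {1}fE RintegralB// Eh Eg /g (valueD x ler01 lf ler01 lh (leqnn N)) addrK//.
Qed.

(** Cauchy-Schwarz doubles both exponents. Doubling [lam v] costs [beta (lam L)^2] by concentration,
    with [L] the Lipschitz constant in the innovation. Half of this survives the square root, and it
    is exactly what [H / 2] gives up in one step. *)
Lemma euler_mgf_le (beta lam : R) (H : nat -> 'cV[R]_d -> R) (f : 'cV[R]_d -> R) :
  gaussian_concentration mu beta -> 0 <= lam -> lipschitz1 f ->
  (forall i, (i <= N)%N -> measurable_fun setT (H i : E -> R)) -> (forall y, 0 <= H N y) ->
  (forall i y, (i < N)%N -> mgf_le mu (fun u : E' => H i.+1 (F i (y, u : 'cV[R]_q)))
     (H i y - beta * lam ^+ 2 * (1 + C * Delta) ^+ (N - i.+1) * Delta * hsnorm (s i y) ^+ 2)) ->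
  mgf_le muN (fun y : E => lam * f y) (lam * (\int[muN]_y f y) + 1 / 2 * H 0%N x).
Proof.
move=> hGC lam0 /[dup] lf1 /lipschitz1P lf mH HN HF.
have vl i : (i <= N)%N -> lipschitz_hs (kappa ^+ i) (value f i).
  by move=> iN; have := value_lipschitz ler01 lf iN; rewrite mulr1.
pose G i (y : E) := expR (lam * value f (N - i) y + 1 / 2 * H i y).
have mG i : (i <= N)%N -> measurable_fun setT (G i).
  move=> iN; apply: measurableT_comp => //; apply: measurable_funD; apply: measurable_funM => //.
    exact: lipschitz_hs_measurable (vl _ (leq_subr i N)).
  exact: mH.
have mf : measurable_fun setT (fun y : E => lam * f y).
  by apply: measurable_funM => //; exact: lipschitz_hs_measurable lf.
split=> //; rewrite (value_mean lf1).2.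
rewrite ge0_integral_distribution//; last first.
  by apply/measurable_EFinP; exact: measurableT_comp.
have rl := (@recursion_le _ _ _ E E' _ _ P N U X x mu (fun i => F i) hU.1 hU.2 mF X0 XS
  (fun i y => (G i y)%:E)).
apply: (@le_trans _ _ (G 0%N x)%:E); last by rewrite /G subn0.
apply: le_trans (rl _ _ _).
- apply: ge0_le_integral => //.
  + by move=> w _; rewrite /= lee_fin expR_ge0.
  + apply/measurable_EFinP; apply: measurableT_comp => //.
    exact: (measurableT_comp mf (measurable_funPT (X N))).
  + apply/measurable_EFinP; exact: (measurableT_comp (mG N (leqnn N)) (measurable_funPT (X N))).
  + move=> w _ /=; rewrite lee_fin ler_expR subnn /= lerDl.
    by apply: mulr_ge0; [lra|exact: HN].
- by move=> i iN; apply/measurable_EFinP; exact: mG.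
- by move=> i y; rewrite lee_fin expR_ge0.
move=> i y iN; rewrite /G.
pose L := kappa ^+ (N - i.+1) * (Num.sqrt Delta * hsnorm (s i y)).
have L0 : 0 <= L by rewrite !mulr_ge0 ?exprn_ge0 ?hsnorm_ge0 ?sqrtr_ge0.
have l1 : lipschitz_hs L (fun u : 'cV[R]_q => value f (N - i.+1) (F i (y, u))).
  apply: euler_map_lipschitz_innovation; first by rewrite exprn_ge0.
  exact: vl (leq_subr _ N).
have l2 : lipschitz_hs (2 * lam * L) (fun u : 'cV[R]_q => 2 * (lam * value f (N - i.+1) (F i (y, u)))).
  move=> u v; rewrite !(mulrA 2 lam) -mulrBr normrM ger0_norm; last by rewrite mulr_ge0.
  by rewrite -(mulrA (2 * lam)) ler_wpM2l// mulr_ge0.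
have IU := innovation_norm_integrable hmean hcov.
have m1 := concentration_lipschitz_hs IU hGC (mulr_ge0 (mulr_ge0 (ler0n _ 2) lam0) L0) l2.
have kE : beta * (2 * lam * L) ^+ 2 / 4 = beta * lam ^+ 2 * (1 + C * Delta) ^+ (N - i.+1) * Delta * hsnorm (s i y) ^+ 2.
  rewrite /L !exprMn -exprM mulnC exprM sqr_sqrtr; last by rewrite addr_ge0.
  by rewrite sqr_sqrtr//; field.
have lf_int : mu.-integrable setT (EFin \o (fun u : E' => value f (N - i.+1) (F i (y, u : 'cV[R]_q)))).
  exact: lipschitz_hs_integrable IU l1.
have := m1; rewrite kE.
have -> : \int[mu]_u (2 * (lam * value f (N - i.+1) (F i (y, u : 'cV[R]_q)))) = 2 * (lam * value f (N - i) y).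
  by rewrite RintegralZl//; [rewrite RintegralZl// value_step|exact: integrable_EFinZ].
set K := beta * _ * _ * _ * _ => m1'.
have m2 : mgf_le mu (fun u : E' => 2 * (1 / 2 * H i.+1 (F i (y, u : 'cV[R]_q)))) (2 * (1 / 2 * (H i y - K))).
  have := HF i y iN; rewrite (_ : 2 * (1 / 2 * (H i y - K)) = H i y - K); last by lra.
  congr mgf_le; apply/funext => u; lra.
have m1'' : mgf_le mu (fun u : E' => 2 * (lam * value f (N - i.+1) (F i (y, u : 'cV[R]_q)))) (2 * (lam * value f (N - i) y + 1 / 2 * K)).
  rewrite (_ : 2 * (_ + _) = 2 * (lam * value f (N - i) y) + K)//; lra.
have [_] := mgf_le_CauchySchwarz m1'' m2.
by rewrite (_ : _ + 1 / 2 * K + _ = lam * value f (N - i) y + 1 / 2 * H i y)//; lra.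
Qed.

End euler_scheme_law.

(** * Lyapunov weights *)

(** Concavity of the power, deduced from convexity of [expR] between [ln (a / m)] and 0 and then
    rescaled by [m]. *)
Lemma powR_le_tangent (R : realType) (alpha a m : R) : 0 <= alpha <= 1 -> 0 < a -> 0 < m ->
  a `^ alpha <= m `^ alpha + alpha * m `^ (alpha - 1) * (a - m).
Proof.
move=> al a0 m0; have m1 : 0 < a / m by rewrite divr_gt0.
have h : (a / m) `^ alpha <= 1 + alpha * (a / m - 1).
  have := convex_expR_le (ln (a / m)) 0 al.
  by rewrite mulr0 addr0 expR0 lnK ?posrE// /powR gt_eqF//; lra.
have -> : a `^ alpha = m `^ alpha * (a / m) `^ alpha.
  by rewrite -powRM ?ltW// mulrC divfK// gt_eqF.
apply: le_trans (ler_wpM2l (powR_ge0 m alpha) h) _.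
rewrite (_ : m `^ (alpha - 1) = m `^ alpha / m); last first.
  by rewrite powRD ?powR_inv1 ?(ltW m0)// (gt_eqF m0) implybT.
by rewrite le_eqVlt; apply/orP; left; apply/eqP; field; rewrite gt_eqF.
Qed.

Lemma sqrt_le_tangent (R : realType) (a m : R) : 0 <= a -> 0 < m ->
  Num.sqrt a <= Num.sqrt m + (a - m) / (2 * Num.sqrt m).
Proof.
move=> a0 m0; have := sqr_sqrtr a0; have := sqr_sqrtr (ltW m0).
have : 0 < Num.sqrt m by rewrite sqrtr_gt0.
set x := Num.sqrt a; set z := Num.sqrt m => z0 <- <-.
have : 0 <= (x - z) ^+ 2 / (2 * z) by rewrite divr_ge0 ?sqr_ge0// mulr_ge0// ltW.
have -> : (x - z) ^+ 2 / (2 * z) = z + (x ^+ 2 - z ^+ 2) / (2 * z) - x by field; rewrite gt_eqF.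
lra.
Qed.

Section lyapunov_step.
Context {R : realType} {d q : nat} (mu : probability (borel_cV R q) R).
Hypothesis hmean : centered mu.
Hypothesis hcov : unit_covariance mu.
Local Notation E := (borel_cV R d).
Local Notation E' := (borel_cV R q).
Variables (V : 'cV[R]_d -> R) (Delta eta CV Cb Csigma : R).
Variables (b : 'cV[R]_d -> 'cV[R]_d) (s : 'cV[R]_d -> 'M[R]_(d, q)).
Local Notation F := (euler_map Delta b s).
Hypothesis mV : measurable_fun setT (V : E -> R).
Hypothesis V0 : forall y, 0 < V y.
Hypothesis taylor : forall y h,
  V (y + h) <= V y + \sum_i h i ord0 * gradient V y i ord0 + eta * hsnorm h ^+ 2.
Hypothesis grad : forall y, hsnorm (gradient V y) ^+ 2 <= CV * V y.
Hypothesis Delta0 : 0 < Delta.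
Hypothesis eta0 : 0 <= eta.
Hypothesis CV0 : 0 < CV.
Hypothesis Cb0 : 0 < Cb.
Hypothesis Csigma0 : 0 < Csigma.
Hypothesis hb : forall y, hsnorm (b y) ^+ 2 <= Cb * V y.

Let A := constK Delta CV Cb eta.
Let A0 : 0 <= A.
Proof. by rewrite addr_ge0 ?sqrtr_ge0// !mulr_ge0// ltW. Qed.

Lemma drift_le y : V (y + Delta *: b y) <= V y * (1 + A * Delta).
Proof.
apply: le_trans (taylor _ _) _.
have Vy := V0 y; have D0 := ltW Delta0.
have h1 : \sum_i (Delta *: b y) i ord0 * gradient V y i ord0 <= Delta * (Num.sqrt (CV * Cb) * V y).
  apply: le_trans (le_dot_hsnorm_col _ _) _; rewrite hsnormZ (ger0_norm D0) -mulrA ler_wpM2l//.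
  rewrite -(ler_pXn2r (n := 2)) ?nnegrE ?mulr_ge0 ?hsnorm_ge0 ?sqrtr_ge0 ?(ltW Vy)//.
  rewrite !exprMn [Num.sqrt (CV * Cb) ^+ 2]sqr_sqrtr ?mulr_ge0 ?(ltW CV0) ?(ltW Cb0)//.
  have := ler_pM (sqr_ge0 _) (sqr_ge0 _) (hb y) (grad y); lra.
have h2 : eta * hsnorm (Delta *: b y) ^+ 2 <= eta * (Delta ^+ 2 * (Cb * V y)).
  by rewrite hsnormZ exprMn real_normK ?num_real// ler_wpM2l// ler_wpM2l// sqr_ge0.
rewrite /A /constK; apply: le_trans (lerD (lerD (lexx _) h1) h2) _.
by rewrite le_eqVlt; apply/orP; left; apply/eqP; ring.
Qed.

(** The point at which concave powers of [V] are linearised. It dominates the drifted value, for the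
    increment bound, and [V y], so that the diffusion bound [V y ^ (1 - alpha)] cancels against the
    slope [m y ^ (alpha - 1)]. *)
Let m y := Num.max (V (y + Delta *: b y)) (V y).

Let le_m y : V y <= m y. Proof. by rewrite le_max lexx orbT. Qed.
Let le_m' y : V (y + Delta *: b y) <= m y. Proof. by rewrite le_max lexx. Qed.
Let m0 y : 0 < m y. Proof. exact: lt_le_trans (le_m y). Qed.
Let m_le y : m y <= V y * (1 + A * Delta).
Proof.
by rewrite ge_max drift_le/= ler_peMr ?(ltW (V0 y))// lerDl mulr_ge0// ltW.
Qed.

Let c y : 'cV[R]_q := Num.sqrt Delta *: ((s y)^T *m gradient V (y + Delta *: b y)).

Lemma lyapunov_increment y (u : 'cV[R]_q) : V (F (y, u)) <=
  m y + \sum_k c y k ord0 * u k ord0 + eta * Delta * (hsnorm (s y) ^+ 2 * hsnorm u ^+ 2).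
Proof.
apply: le_trans (taylor _ _) _; set G := gradient V _; apply: lerD; first apply: lerD => //.
  rewrite le_eqVlt; apply/orP; left; apply/eqP.
  rewrite (eq_bigr (fun i => \sum_k Num.sqrt Delta * (s y i k * u k ord0 * G i ord0))); last first.
    by move=> i _; rewrite !mxE -mulrA mulr_suml mulr_sumr.
  rewrite exchange_big /=; apply: eq_bigr => k _.
  rewrite /c -/G !mxE mulr_sumr mulr_suml; apply: eq_bigr => i _; rewrite !mxE; ring.
rewrite -mulrA ler_wpM2l// hsnormZ exprMn real_normK ?num_real// [Num.sqrt Delta ^+ 2]sqr_sqrtr; last exact: ltW.
rewrite ler_wpM2l//; first exact: ltW.
by rewrite -exprMn ler_pXn2r ?nnegrE ?hsnorm_ge0 ?mulr_ge0 ?hsnorm_ge0// hsnorm_mulmx.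
Qed.

Lemma euler_map_measurable_innovation y : measurable_fun setT ((fun u => F (y, u)) : E' -> E).
Proof.
apply: measurable_coord_cV => i.
have l1 : lipschitz_hs 1 (fun z : 'cV[R]_d => z i ord0).
  by move=> z z'; rewrite mul1r; have := norm_coord_le_hsnorm (z - z') i ord0; rewrite !mxE.
exact: lipschitz_hs_measurable (euler_map_lipschitz_innovation Delta b s y ler01 l1).
Qed.

Let mVF y : measurable_fun setT (fun u : E' => V (F (y, u : 'cV[R]_q))).
Proof. exact: (measurableT_comp mV (euler_map_measurable_innovation y)). Qed.

Let m2 : R := sq_moment mu.

(** [sqrt V] is Lipschitz, so concentration applies to it directly along the innovation. Only its
    mean needs the Taylor bound, through the tangent of the square root at [m y]. *)
Lemma sqrt_lyapunov_step (b0 r : R) y : gaussian_concentration mu b0 -> 0 <= b0 -> 0 <= r ->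
  hsnorm (s y) ^+ 2 <= Csigma * Num.sqrt (V y) ->
  mgf_le mu (fun u : E' => r * Num.sqrt (V (F (y, u : 'cV[R]_q))))
    (r * (Num.sqrt (V y) * (1 + 1 / 2 * A * Delta) + 1 / 2 * eta * Csigma * m2 * Delta)
     + b0 / 4 * r ^+ 2 * eta * Csigma * Delta * Num.sqrt (V y)).
Proof.
move=> hGC b00 r0 hs; set v := Num.sqrt (V y).
have D0 := ltW Delta0; have v0 : 0 < v by rewrite sqrtr_gt0.
have IU := innovation_norm_integrable hmean hcov.
have lV : lipschitz_hs (Num.sqrt eta) (fun y => Num.sqrt (V y)).
  apply: le_lipschitz_hs => z z'; rewrite lerBlDl.
  by have := sqrt_lyapunov_lip V0 taylor eta0 z' (z - z'); rewrite addrC subrK.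
have lW := euler_map_lipschitz_innovation Delta b s y (sqrtr_ge0 eta) lV.
set L := _ * _ in lW.
have L0 : 0 <= L by rewrite !mulr_ge0 ?sqrtr_ge0 ?hsnorm_ge0.
have IW := lipschitz_hs_integrable IU lW.
have lrW : lipschitz_hs (r * L) (fun u => r * Num.sqrt (V (F (y, u)))).
  by move=> u w; rewrite -mulrBr normrM ger0_norm// -mulrA ler_wpM2l.
apply: mgf_leW (concentration_lipschitz_hs IU hGC (mulr_ge0 r0 L0) lrW).
apply: lerD; last first.
  have -> : b0 * (r * L) ^+ 2 / 4 = b0 / 4 * r ^+ 2 * eta * Delta * hsnorm (s y) ^+ 2.
    by rewrite /L !exprMn [Num.sqrt eta ^+ 2]sqr_sqrtr// [Num.sqrt Delta ^+ 2]sqr_sqrtr//; ring.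
  have k0 : 0 <= b0 / 4 * r ^+ 2 * eta * Delta by rewrite !mulr_ge0 ?sqr_ge0// invr_ge0.
  by have := ler_wpM2l k0 hs; rewrite /v; lra.
rewrite RintegralZl// ler_wpM2l//.
set z := Num.sqrt (m y); have z0 : 0 < z by rewrite sqrtr_gt0.
have [Ic Ec] := innovation_linear hmean hcov (c y).
have Iq := innovation_sqr_integrable hmean hcov.
set k := eta * Delta * hsnorm (s y) ^+ 2.
have Ikq := integrable_EFinZ k Iq.
have IB := integrable_EFinD (prob_integrable_cst mu z)
  (integrable_EFinZ (2 * z)^-1 (integrable_EFinD Ic Ikq)).
apply: (@le_trans _ _ (\int[mu]_u (cst z u + (2 * z)^-1 *
   ((\sum_i c y i ord0 * (u : 'cV[R]_q) i ord0) + k * hsnorm (u : 'cV[R]_q) ^+ 2)))).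
  apply: le_Rintegral => // u _; apply: le_trans (sqrt_le_tangent (ltW (V0 _)) (m0 y)) _.
  rewrite -/z lerD2l [leRHS]mulrC ler_pM2r ?invr_gt0 ?mulr_gt0//.
  by have := lyapunov_increment y u; rewrite /k; lra.
rewrite RintegralD//; last 2 first.
- exact: prob_integrable_cst.
- exact: integrable_EFinZ (integrable_EFinD Ic Ikq).
rewrite (Rexpect_cst mu z) RintegralZl//; last exact: integrable_EFinD.
rewrite RintegralD// Ec add0r RintegralZl// -/(sq_moment mu) -/m2.
have m20 : 0 <= m2 by apply: Rintegral_ge0 => u _; exact: sqr_ge0.
apply: lerD.
  rewrite -(ler_pXn2r (n := 2)) ?nnegrE ?mulr_ge0 ?addr_ge0 ?sqrtr_ge0//; last first.
    by rewrite !mulr_ge0//; lra.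
  rewrite exprMn [z ^+ 2]sqr_sqrtr ?(ltW (m0 y))// [v ^+ 2]sqr_sqrtr ?(ltW (V0 y))//; apply: le_trans (m_le y) _; rewrite ler_wpM2l//.
    exact: ltW.
  have := sqr_ge0 (A * Delta); nra.
have vz : v <= z by rewrite ler_wsqrtr.
rewrite mulrC ler_pdivrMr ?mulr_gt0// /k.
have k0 : 0 <= eta * Delta * m2 by rewrite !mulr_ge0.
have h1 := ler_wpM2l k0 hs; have h2 := ler_wpM2l (mulr_ge0 k0 (ltW Csigma0)) vz.
rewrite -/v in h1; lra.
Qed.

(** The tangent bound makes the power at most a quadratic polynomial in the innovation. The linear
    part is handled by concentration, the quadratic part by the moment bound [ell], and
    Cauchy-Schwarz separates them. *)
Lemma powR_lyapunov_step (b0 r ell alpha : R) y : 0 < alpha <= 1 ->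
  gaussian_concentration mu b0 -> 0 <= b0 -> 0 <= r ->
  hsnorm (s y) ^+ 2 <= Csigma * V y `^ (1 - alpha) ->
  mgf_le mu (fun u : E' => 2 * r * alpha * eta * Delta * Csigma * hsnorm (u : 'cV[R]_q) ^+ 2) ell ->
  mgf_le mu (fun u : E' => r * V (F (y, u : 'cV[R]_q)) `^ alpha)
    ((r + 2 * b0 * r ^+ 2 * alpha ^+ 2 * eta * Csigma * Delta)
       * (V y `^ alpha * (1 + alpha * A * Delta)) + 1 / 2 * ell).
Proof.
move=> /andP[al0 al1] hGC b00 r0 hs hell.
have D0 := ltW Delta0; have Vy := V0 y; have my := m0 y.
have IU := innovation_norm_integrable hmean hcov.
have al01 : 0 <= alpha <= 1 by rewrite (ltW al0).
have p1 : m y `^ (alpha - 1) * m y `^ (1 - alpha) = 1.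
  by rewrite -powRD ?(gt_eqF my) ?implybT// (_ : _ + _ = 0); [rewrite powRr0|ring].
have p2 : m y `^ (alpha - 1) * m y = m y `^ alpha.
  by rewrite -[X in _ * X](powRr1 (ltW my)) -powRD ?(gt_eqF my) ?implybT// subrK.
have q0 := powR_ge0 (m y) (alpha - 1).
have [a aE] : exists a, a = alpha * m y `^ (alpha - 1) by eexists.
have a0 : 0 <= a by rewrite aE mulr_ge0// ltW.
have hs' : hsnorm (s y) ^+ 2 <= Csigma * m y `^ (1 - alpha).
  apply: le_trans hs _; rewrite ler_wpM2l//; first exact: ltW.
  by apply: ge0_ler_powR; rewrite ?nnegrE ?subr_ge0 ?(ltW Vy) ?(ltW my).
set g := fun u : 'cV[R]_q => \sum_k c y k ord0 * u k ord0.
have [Ic Ec] := innovation_linear hmean hcov (c y).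
have lg : lipschitz_hs (hsnorm (c y)) g.
  apply: le_lipschitz_hs => u w; apply: le_trans (le_dot_hsnorm_col (c y) (u - w)).
  rewrite /g -sumrB le_eqVlt; apply/orP; left; apply/eqP; apply: eq_bigr => k _.
  by rewrite [(u - w) _ _]mxE [(- w) _ _]mxE; ring.
have lag : lipschitz_hs (2 * r * a * hsnorm (c y)) (fun u => 2 * (r * a * g u)).
  have k0 : 0 <= 2 * (r * a) by exact: mulr_ge0 (ler0n _ 2) (mulr_ge0 r0 a0).
  move=> u w; rewrite (_ : _ - _ = 2 * (r * a) * (g u - g w)); last by ring.
  by rewrite normrM (ger0_norm k0); have := ler_wpM2l k0 (lg u w); lra.
have ag0 : 0 <= 2 * r * a * hsnorm (c y) by apply: mulr_ge0 (hsnorm_ge0 _); rewrite -mulrA; exact: mulr_ge0 (ler0n _ 2) (mulr_ge0 r0 a0).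
have h1 := concentration_lipschitz_hs IU hGC ag0 lag.
have cle : hsnorm (c y) ^+ 2 <= 4 * eta * Delta * Csigma * (m y `^ (1 - alpha) * m y).
  apply: (@le_trans _ _ (Delta * (hsnorm (s y) ^+ 2 * hsnorm (gradient V (y + Delta *: b y)) ^+ 2))).
    rewrite /c hsnormZ exprMn real_normK ?num_real// [Num.sqrt Delta ^+ 2]sqr_sqrtr// ler_wpM2l// -exprMn.
    rewrite ler_pXn2r ?nnegrE ?mulr_ge0 ?hsnorm_ge0//; apply: le_trans (hsnorm_mulmx _ _) _.
    rewrite (_ : hsnorm (s y)^T = hsnorm (s y))//.
    rewrite /hsnorm exchange_big /=; congr Num.sqrt; apply: eq_bigr => i _.
    by apply: eq_bigr => j _; rewrite mxE.
  have g1 := gradient_sqr_le V0 taylor eta0 (y + Delta *: b y).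
  have g2 : hsnorm (gradient V (y + Delta *: b y)) ^+ 2 <= 4 * eta * m y.
    by apply: le_trans g1 _; rewrite ler_wpM2l// mulr_ge0.
  have := ler_wpM2l D0 (ler_pM (sqr_ge0 _) (sqr_ge0 _) hs' g2); lra.
have h2 : mgf_le mu (fun u : E' => 2 * (r * a * g u)) (2 * (2 * b0 * r ^+ 2 * alpha ^+ 2 * eta * Csigma * Delta * m y `^ alpha)).
  apply: mgf_leW h1; rewrite RintegralZl//; last exact: integrable_EFinZ.
  rewrite RintegralZl// Ec !mulr0 add0r.
  have k0 : 0 <= b0 * r ^+ 2 * a ^+ 2 by rewrite !mulr_ge0 ?sqr_ge0.
  have := ler_wpM2l k0 cle.
  have -> : b0 * r ^+ 2 * a ^+ 2 * (4 * eta * Delta * Csigma * (m y `^ (1 - alpha) * m y)) =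
    4 * b0 * r ^+ 2 * alpha ^+ 2 * eta * Csigma * Delta
     * ((m y `^ (alpha - 1) * m y `^ (1 - alpha)) * (m y `^ (alpha - 1) * m y)).
    by rewrite aE; ring.
  rewrite p1 p2; lra.
have h3 : mgf_le mu (fun u : E' => 2 * (r * alpha * eta * Delta * Csigma * hsnorm (u : 'cV[R]_q) ^+ 2)) (2 * (1 / 2 * ell)).
  rewrite (_ : 2 * (1 / 2 * ell) = ell); last by lra.
  by move: hell; congr mgf_le; apply/funext => u; ring.
have h4 := mgf_leD (r * m y `^ alpha) (mgf_le_CauchySchwarz h2 h3).
have h5 : mgf_le mu (fun u : E' => r * V (F (y, u : 'cV[R]_q)) `^ alpha)
   ((r + 2 * b0 * r ^+ 2 * alpha ^+ 2 * eta * Csigma * Delta) * m y `^ alpha + 1 / 2 * ell).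
  apply: mgf_le_le (mgf_leW _ h4); last by lra.
    by apply: measurable_funM => //; exact: (measurableT_comp (measurable_powR alpha) (mVF y)).
  move=> u /=.
  have t1 := powR_le_tangent al01 (V0 (F (y, u))) my.
  have t2 := ler_wpM2l a0 (lyapunov_increment y u).
  have t3 : a * (eta * Delta * (hsnorm (s y) ^+ 2 * hsnorm u ^+ 2)) <=
      alpha * eta * Delta * Csigma * hsnorm u ^+ 2.
    have k0 : 0 <= a * (eta * Delta * hsnorm u ^+ 2) by rewrite !mulr_ge0 ?sqr_ge0 ?hsnorm_ge0.
    have := ler_wpM2l k0 hs'.
    have -> : a * (eta * Delta * hsnorm u ^+ 2) * (Csigma * m y `^ (1 - alpha)) =
      alpha * eta * Delta * Csigma * hsnorm u ^+ 2 * (m y `^ (alpha - 1) * m y `^ (1 - alpha)).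
      by rewrite aE; ring.
    rewrite p1; lra.
  have t4 : V (F (y, u)) `^ alpha <= m y `^ alpha + a * g u + alpha * eta * Delta * Csigma * hsnorm u ^+ 2.
    rewrite -aE in t1; move: t1 t2 t3; rewrite /g; lra.
  have := ler_wpM2l r0 t4; lra.
apply: mgf_leW h5; rewrite lerD2r ler_wpM2l//.
  rewrite addr_ge0// !mulr_ge0 ?sqr_ge0//; exact: ltW.
have AD : 0 <= A * Delta by rewrite mulr_ge0.
apply: (@le_trans _ _ ((V y * (1 + A * Delta)) `^ alpha)).
  apply: ge0_ler_powR; rewrite ?nnegrE ?m_le ?(ltW al0)// ?(ltW my)//.
  by rewrite mulr_ge0 ?addr_ge0// ltW.
rewrite powRM ?addr_ge0 ?(ltW Vy)// ler_wpM2l ?powR_ge0//.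
(* The tangent at 1 gives the Bernoulli bound [(1 + A Delta)^alpha <= 1 + alpha A Delta]. *)
have := powR_le_tangent al01 (ltac:(lra) : 0 < 1 + A * Delta) ltr01.
rewrite !powR1; lra.
Qed.

End lyapunov_step.

Section lip_modulus.
Context {R : realType} {d : nat} (T : R) (m n : nat) (g : R -> 'cV[R]_d -> 'M[R]_(m, n)).
Hypothesis gL : unif_lipschitz T g.

Lemma lip_modulus_le t y z : 0 <= t <= T ->
  hsnorm (g t y - g t z) <= lip_modulus T g * hsnorm (y - z).
Proof.
move=> tT; have [->|yz] := eqVneq y z; first by rewrite !subrr !hsnorm0 mulr0.
rewrite -ler_pdivrMr ?hsnorm_gt0 ?subr_eq0//; apply: ub_le_sup => //.
by exists t, y, z.
Qed.

Lemma lip_modulus_ge0 : (0 < d)%N -> 0 <= T -> 0 <= lip_modulus T g.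
Proof.
(* A quotient in the supremum needs two distinct points, here the all-ones vector and 0. *)
move=> d0 T0; pose y : 'cV[R]_d := const_mx 1.
have y0 : y != 0.
  by apply/eqP => /matrixP /(_ (Ordinal d0) ord0); rewrite !mxE => /eqP; rewrite oner_eq0.
have T00 : (0 : R) <= 0 <= T by rewrite lexx.
have := lip_modulus_le y 0 T00.
by move=> /(le_trans (hsnorm_ge0 _)); rewrite pmulr_lge0// subr0 hsnorm_gt0.
Qed.

End lip_modulus.

(** * Scalar inequalities *)

Section scalar.
Context {R : realType}.
Implicit Types (alpha rho w v : R).

(** Convexity of [expR] with weight [(1 - alpha) / alpha]. The powers of [rho] in the two exponents
    are chosen to cancel in the product, and their remainder is the first term of [Psi2]. *)
Lemma powR_Young alpha rho w v : 1 / 2 < alpha <= 1 -> 0 < rho -> 0 < w -> 0 < v ->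
  w * v `^ (1 - alpha) <= rho * ((1 - alpha) / alpha) * v `^ alpha
    + w `^ (alpha / (2 * alpha - 1))
      * (rho `^ (- ((1 - alpha) / (2 * alpha - 1))) * ((2 * alpha - 1) / alpha)).
Proof.
move=> /andP[al1 al2] r0 w0 v0; pose th := (1 - alpha) / alpha.
have al0 : 0 < alpha by lra.
have d0 : 2 * alpha - 1 != 0 by rewrite gt_eqF//; lra.
have th01 : 0 <= th <= 1.
  by rewrite divr_ge0 ?subr_ge0 ?(ltW al0)//= ler_pdivrMr//; lra.
have := convex_expR_le (ln rho + alpha * ln v)
  ((alpha / (2 * alpha - 1)) * ln w - (1 - alpha) / (2 * alpha - 1) * ln rho) th01.
have -> : th * (ln rho + alpha * ln v) + (1 - th) *
  ((alpha / (2 * alpha - 1)) * ln w - (1 - alpha) / (2 * alpha - 1) * ln rho)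
  = ln w + (1 - alpha) * ln v.
  by rewrite /th; field; rewrite (gt_eqF al0) d0.
rewrite !expRD !lnK ?posrE// -(mulNr ((1 - alpha) / (2 * alpha - 1))) /powR !gt_eqF// => /le_trans; apply.
have -> : 1 - th = (2 * alpha - 1) / alpha by rewrite /th; field; rewrite gt_eqF.
by rewrite le_eqVlt; apply/orP; left; apply/eqP; rewrite /th; ring.
Qed.

Lemma expr_le_expR (x : R) n : 0 <= x -> (1 + x) ^+ n <= expR (n%:R * x).
Proof.
move=> x0; rewrite expRM_natl lerXn2r ?nnegrE ?expR_ge0 ?expR_ge1Dx//.
by rewrite addr_ge0.
Qed.

(** With [e = exp (C n Delta)], the claim reduces to [e - 1 <= 4/27 * e^3], sharp at [e = 3/2],
    because [4 e^3 - 27 e + 27 = (2 e - 3)^2 (e + 3)]. *)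
Lemma variance_sum_le (C Delta : R) n : 0 < C -> 0 < Delta ->
  ((1 + C * Delta) ^+ n - 1) / C <=
  16 / 27 * ((1 + C * Delta) / (4 * C) * expR (3 * C * (n%:R * Delta))).
Proof.
move=> C0 D0; have x0 : 0 <= C * Delta by rewrite mulr_ge0// ltW.
have := expr_le_expR n x0; set z := (1 + _) ^+ _.
have -> : n%:R * (C * Delta) = C * (n%:R * Delta) by ring.
rewrite -(mulrA 3) (expRM_natl 3); have := expR_ge0 (C * (n%:R * Delta)).
set e := expR _ => e0 ze.
rewrite ler_pdivrMr// [leRHS](_ : _ = 4 / 27 * ((1 + C * Delta) * e ^+ 3)); last first.
  by field; rewrite gt_eqF.
apply: (@le_trans _ _ (4 / 27 * e ^+ 3)).
  have : 0 <= (2 * e - 3) ^+ 2 * (e + 3) by rewrite mulr_ge0 ?sqr_ge0 ?addr_ge0.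
  lra.
by rewrite ler_wpM2l// ?divr_ge0// ler_peMl ?exprn_ge0// lerDl.
Qed.

Lemma expR_eighth_le : expR (1 / 8) <= 27 / 16 :> R.
Proof.
have := expR_ge1Dx (- (1 / 8) : R); rewrite expRN => h.
have e0 := expR_gt0 (1 / 8 : R).
have := ler_wpM2r (ltW e0) h; rewrite mulVf ?gt_eqF//.
lra.
Qed.

(** As long as [k * rr <= dl], the quadratic Riccati term is no worse than exponential growth at the
    extra rate [dl]. *)
Lemma growth_step_le (rr k Delta dl a v : R) : 0 <= rr -> 0 <= v -> 0 <= Delta ->
  0 <= a -> 0 <= dl -> k * rr <= dl ->
  (rr + k * rr ^+ 2 * Delta) * (v * (1 + a * Delta)) <=
  rr * expR ((a + dl) * Delta) * v.
Proof.
move=> r0 v0 D0 a0 d0 kr.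
have rv : 0 <= rr * v by rewrite mulr_ge0.
have aD : 0 <= a * Delta by rewrite mulr_ge0.
have dD : 0 <= dl * Delta by rewrite mulr_ge0.
have h1 : (1 + k * rr * Delta) * (1 + a * Delta) <= expR ((a + dl) * Delta).
  apply: (@le_trans _ _ ((1 + dl * Delta) * (1 + a * Delta))).
    by rewrite ler_wpM2r ?addr_ge0// lerD2l ler_wpM2r.
  rewrite (mulrDl a) expRD [leRHS]mulrC.
  by apply: ler_pM; rewrite ?addr_ge0 ?expR_ge1Dx.
have := ler_wpM2l rv h1; rewrite expr2; lra.
Qed.

(** Only one of the minimum and the maximum differs from 1, so the product is either [p r^2] or its
    power, and each is bounded by the matching branches. *)
Lemma min_max_powR_le alpha (p r : R) : 1 / 2 < alpha -> 0 < p -> 0 < r ->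
  Num.min (p * r ^+ 2) 1 * (Num.max (p * r ^+ 2) 1) `^ (alpha / (2 * alpha - 1)) <=
  Num.max p (p `^ (alpha / (2 * alpha - 1)))
    * Num.max (r ^+ 2) (r `^ (2 * alpha / (2 * alpha - 1))).
Proof.
move=> al p0 r0; have r2 : 0 <= r ^+ 2 by exact: sqr_ge0.
case: (leP (p * r ^+ 2) 1) => _.
  by rewrite powR1 mulr1 ler_pM ?(ltW p0)// le_max lexx.
rewrite mul1r powRM ?(ltW p0)//.
have -> : (r ^+ 2) `^ (alpha / (2 * alpha - 1)) = r `^ (2 * alpha / (2 * alpha - 1)).
  by rewrite -(mulrA 2) [in RHS]powRrM powR_mulrn// ltW.
by rewrite ler_pM ?powR_ge0// le_max lexx orbT.
Qed.

(** Discrete form of the fact that [1 / (1 - G t)] solves [y' = G y^2]: lowering the denominator [z]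
    by [G * Delta] absorbs the quadratic term, since [(1 + t) (1 - t) <= 1] with
    [t = G * Delta / z]. *)
Lemma riccati_step_le (s p e a g G Delta z : R) : 0 <= s -> 0 <= p -> 1 <= e ->
  0 <= a -> 0 <= Delta -> 0 <= G -> g * (s * e) <= G -> G * Delta < z -> z <= 1 ->
  s * e / z * (1 + a * Delta) + g * (s * e / z) ^+ 2 * Delta + p <=
  (s + p) * (e * expR (a * Delta)) / (z - G * Delta).
Proof.
move=> s0 p0 e1 a0 D0 G0 gG Gz z1.
have GD : 0 <= G * Delta by rewrite mulr_ge0.
have z0 : 0 < z by exact: le_lt_trans GD Gz.
have x0 : 0 < z - G * Delta by rewrite subr_gt0.
have x1 : z - G * Delta <= 1 by lra.
have k1 : 1 <= expR (a * Delta) by rewrite -[leLHS]expR0 ler_expR mulr_ge0.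
have k2 := expR_ge1Dx (a * Delta); set k := expR _ in k1 k2 *.
have se : 0 <= s * e / z by rewrite divr_ge0 ?(ltW z0)// mulr_ge0// (le_trans ler01).
have i0 : 0 <= (z - G * Delta)^-1 by rewrite invr_ge0 ltW.
have i1 : 1 <= (z - G * Delta)^-1 by rewrite -[leLHS]invr1 lef_pV2 ?posrE.
have h1 : g * (s * e / z) * Delta <= G * Delta / z.
  by rewrite mulrA !(mulrAC _ z^-1) ler_wpM2r ?invr_ge0 ?(ltW z0)// ler_wpM2r.
have GDz : 0 <= G * Delta / z by rewrite divr_ge0// ltW.
have h2 : 1 + a * Delta + g * (s * e / z) * Delta <= k * (1 + G * Delta / z).
  by have := ler_wpM2r GDz k1; lra.
have h3 : (1 + G * Delta / z) / z <= (z - G * Delta)^-1.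
  rewrite -[leRHS]div1r ler_pdivlMr//.
  have -> : (1 + G * Delta / z) / z * (z - G * Delta) = 1 - (G * Delta / z) ^+ 2.
    by field; rewrite gt_eqF.
  by rewrite gerBl sqr_ge0.
have seek : 0 <= s * e * k.
  by rewrite mulr_ge0 ?(le_trans ler01 k1)// mulr_ge0 ?(le_trans ler01 e1).
have h4 := ler_wpM2l seek h3.
have h5 := ler_wpM2l se h2.
have ek : 1 <= e * k by apply: mulr_ege1.
have h6 : p <= p * (e * k * (z - G * Delta)^-1) by rewrite ler_peMr// mulr_ege1.
have -> : (s + p) * (e * k) / (z - G * Delta) =
  s * e * k * (z - G * Delta)^-1 + p * (e * k * (z - G * Delta)^-1) by ring.
apply: lerD => //; apply: le_trans h4.
have -> : s * e * k * ((1 + G * Delta / z) / z) = s * e / z * (k * (1 + G * Delta / z)) by ring.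
by apply: le_trans h5; rewrite expr2; lra.
Qed.

End scalar.

Section rho_low.
Context {R : realType}.
Variables (T Delta alpha beta CV Cb Csigma eta eps : R).
Hypothesis T0 : 0 < T.
Hypothesis alpha0 : 0 < alpha.
Hypothesis Csigma0 : 0 < Csigma.
Hypothesis eta0 : 0 <= eta.
Hypothesis eps0 : 0 < eps.
Local Notation rho := (rho_low T Delta alpha beta CV Cb Csigma eta eps).
Local Notation cC := (constC Delta alpha beta CV Cb Csigma eta).

Lemma rho_low_gt0 : 0 < rho.
Proof.
rewrite /rho_low; have [e0|e0] := eqVneq eta 0; first by lra.
have ep : 0 < eta by rewrite lt_neqAle eq_sym e0.
rewrite mulr_gt0 ?divr_gt0// lt_min ltr01 divr_gt0//.
by rewrite !mulr_gt0 ?expR_gt0.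
Qed.

(** The factor 1/2 in [rho_low] becomes the [eps / 2] here, which makes the exponent of
    [half_log_moment] appear in [r_moment]. *)
Lemma rho_low_le : rho * (2 * eta * alpha * Csigma * T * expR (cC * T)) <= eps / 2.
Proof.
rewrite /rho_low; have [->|e0] := eqVneq eta 0.
  by rewrite mulr0 !mul0r mulr0 divr_ge0// ltW.
have ep : 0 < eta by rewrite lt_neqAle eq_sym e0.
set Z := _ * expR _; have Z0 : 0 < Z by rewrite !mulr_gt0 ?expR_gt0.
rewrite -ler_pdivlMr//.
have : Num.min 1 (eps * Z^-1) <= eps * Z^-1 by rewrite ge_min lexx orbT.
by set m := Num.min _ _; lra.
Qed.

End rho_low.

Section half_log_moment.
Context {R : realType} {q : nat} (mu : probability (borel_cV R q) R) (alpha eps : R).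
Hypothesis halpha : 1 / 2 <= alpha <= 1.
Hypothesis eps0 : 0 < eps.
Hypothesis heps : (exp_sq_moment mu eps < +oo)%E.
Local Notation E' := (borel_cV R q).
Local Notation kap := (eps * (1 - alpha) / (2 * alpha)).

Let msq (k : R) : measurable_fun setT (fun u : E' => k * hsnorm (u : 'cV[R]_q) ^+ 2).
Proof.
apply: measurable_funM => //; apply: measurable_funX.
exact: lipschitz1_measurable (@hsnorm_lipschitz1 _ _).
Qed.

Let kap_ge0 : 0 <= kap.
Proof.
move/andP: halpha => [a1 a2]; rewrite divr_ge0 ?mulr_ge0 ?subr_ge0 ?(ltW eps0)//; lra.
Qed.

Let kap_le : kap <= eps.
Proof.
move/andP: halpha => [a1 a2]; rewrite ler_pdivrMr; last by lra.
by rewrite ler_wpM2l ?(ltW eps0)//; lra.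
Qed.

Let fin : exp_sq_moment mu kap \is a fin_num.
Proof.
rewrite ge0_fin_numE; last by apply: integral_ge0 => u _; rewrite lee_fin expR_ge0.
apply: le_lt_trans heps; apply: ge0_le_integral => //.
- by apply/measurable_EFinP; apply: measurableT_comp => //; exact: msq.
- by apply/measurable_EFinP; apply: measurableT_comp => //; exact: msq.
- by move=> u _; rewrite lee_fin ler_expR ler_wpM2r ?sqr_ge0.
Qed.

Let ge1 : 1 <= fine (exp_sq_moment mu kap).
Proof.
rewrite -lee_fin fineK//.
have -> : 1%:E = (\int[mu]_u (cst (1 : R) u)%:E)%E.
  by rewrite (eq_integral (cst (1 : R)%:E))// integral_cst// [X in (_ * X)%E](probability_setT mu) mule1.
apply: ge0_le_integral => //.
- exact: (@measurable_cst _ _ _ _ _ 1%:E).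
- by apply/measurable_EFinP; apply: measurableT_comp => //; exact: msq.
- by move=> u _; rewrite lee_fin /cst -[leLHS]expR0 ler_expR; apply: mulr_ge0 (sqr_ge0 _).
Qed.

Lemma half_log_moment_ge0 : 0 <= half_log_moment alpha mu eps.
Proof. by rewrite /half_log_moment mulr_ge0// ln_ge0. Qed.

Lemma mgf_le_half_log_moment :
  mgf_le mu (fun u : E' => kap * hsnorm (u : 'cV[R]_q) ^+ 2) (2 * half_log_moment alpha mu eps).
Proof.
split; first exact: msq.
rewrite /half_log_moment mulrA (_ : 2 * (1 / 2) = 1) ?mul1r; last by lra.
by rewrite lnK ?posrE ?(lt_le_trans ltr01 ge1)// fineK.
Qed.

End half_log_moment.

(** * The weights along the scheme, in the two regimes of [alpha] *)

Section scheme_bounds.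
Context {R : realType} {q : nat} (mu : probability (borel_cV R q) R).
Hypothesis hmean : centered mu.
Hypothesis hcov : unit_covariance mu.
Variables (beta : R) (d : nat) (T : R) (N : nat) (x : 'cV[R]_d).
Variables (b : R -> 'cV[R]_d -> 'cV[R]_d) (sigma : R -> 'cV[R]_d -> 'M[R]_(d, q)).
Variables (alpha : R) (V : 'cV[R]_d -> R) (CV Cb Csigma : R).
Hypothesis hbeta : 0 < beta.
Hypothesis hGC : gaussian_concentration mu beta.
Hypothesis hd : (0 < d)%N.
Hypothesis hT : 0 < T.
Hypothesis hN : (0 < N)%N.
Hypothesis hbL : unif_lipschitz T b.
Hypothesis hsL : unif_lipschitz T sigma.
Hypothesis halpha : 1 / 2 <= alpha <= 1.
Hypothesis hHD : HD T b sigma alpha V CV Cb Csigma.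
Context {dO : measure_display} {Omega : measurableType dO} (P : probability Omega R).
Variables (U : nat -> {RV P >-> borel_cV R q}) (X : nat -> {RV P >-> borel_cV R d}).
Hypothesis hU : iid_with_law U mu.
Local Notation Delta := (T / N%:R).
Hypothesis hX : euler_scheme b sigma x Delta N U X.
Local Notation lb := (lip_modulus T b).
Local Notation ls := (lip_modulus T sigma).
Local Notation eta := (half_hessian_sup V).
Local Notation phi := (varphi Csigma beta lb ls Delta T).
Local Notation muT := (distribution P (X N)).
Local Notation C := (CDelta lb ls Delta).
Hypothesis hC : C != 0.
Local Notation E := (borel_cV R d).
Local Notation E' := (borel_cV R q).
Local Notation F i := (euler_map Delta (b (i%:R * Delta)) (sigma (i%:R * Delta))).

Let N0 : 0 < N%:R :> R. Proof. by rewrite ltr0n. Qed.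
Let D0 : 0 < Delta. Proof. by rewrite divr_gt0. Qed.
Let ND : N%:R * Delta = T. Proof. by rewrite mulrC divfK// gt_eqF. Qed.
Let tT i : (i < N)%N -> 0 <= i%:R * Delta <= T.
Proof.
by move=> iN; rewrite mulr_ge0 ?(ltW D0)//= -[leRHS]ND ler_wpM2r ?(ltW D0)// ler_nat ltnW.
Qed.
Let lb0 : 0 <= lb. Proof. exact: lip_modulus_ge0 hbL hd (ltW hT). Qed.
Let ls0 : 0 <= ls. Proof. exact: lip_modulus_ge0 hsL hd (ltW hT). Qed.
Let C0 : 0 < C.
Proof. by rewrite lt_neqAle eq_sym hC CDelta_ge0// ltW. Qed.
Let Cb0 := HD_Cb hHD.
Let CV0 := HD_CV hHD.
Let Cs0 := HD_Csigma hHD.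
Let V0 := HD_pos hHD.

Let phi0 : 0 < phi.
Proof.
have C40 : 0 < 4 * C by rewrite mulr_gt0.
by rewrite !mulr_gt0 ?invr_gt0 ?expR_gt0// addr_gt0// mulr_gt0.
Qed.

Let eta_ub y : hsnorm (hessian V y) <= 2 * eta.
Proof.
rewrite mulrC divfK ?pnatr_eq0//; apply: ub_le_sup; first exact: HD_hess hHD.
by exists y.
Qed.

Let eta0 : 0 <= eta.
Proof. by have := le_trans (hsnorm_ge0 _) (eta_ub 0); lra. Qed.

Let taylor := C2_taylor (HD_C2 hHD) eta_ub.

Let mV : measurable_fun setT (V : E -> R).
Proof. by apply: continuous_borel_measurable; exact: (HD_C2 hHD).1. Qed.

Let hsig i y : (i < N)%N ->
  hsnorm (sigma (i%:R * Delta) y) ^+ 2 <= Csigma * V y `^ (1 - alpha).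
Proof. by move=> iN; rewrite -mxtrace_mulmx_tr; exact: HD_sigma hHD _ _ (tT iN). Qed.

Let kk (lam : R) (i : nat) := beta * lam ^+ 2 * Csigma * (1 + C * Delta) ^+ (N - i.+1) * Delta.
(** The sum of the costs [kk] from step [i] on, in the closed form of a geometric series. *)
Let SS (lam : R) (i : nat) := beta * lam ^+ 2 * Csigma * (((1 + C * Delta) ^+ (N - i) - 1) / C).

Let CD1 : 1 <= 1 + C * Delta. Proof. by rewrite lerDl mulr_ge0// ltW. Qed.

Let kk_ge0 lam i : 0 <= kk lam i.
Proof.
rewrite /kk mulr_ge0 ?(ltW D0)// mulr_ge0 ?exprn_ge0 ?(le_trans ler01 CD1)//.
by rewrite mulr_ge0 ?(ltW Cs0)// mulr_ge0 ?sqr_ge0// ltW.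
Qed.

Let SS_step lam i : (i < N)%N -> SS lam i = SS lam i.+1 + kk lam i.
Proof.
move=> iN; rewrite /SS /kk -(subnSK iN) (exprS (1 + C * Delta)).
by field; rewrite hC gt_eqF.
Qed.

Let SS_ge0 lam i : 0 <= SS lam i.
Proof.
rewrite /SS mulr_ge0//; first by rewrite mulr_ge0 ?(ltW Cs0)// mulr_ge0 ?sqr_ge0// ltW.
by rewrite divr_ge0 ?(ltW C0)// subr_ge0 exprn_ege1.
Qed.

Let SS_le lam i : SS lam i <= SS lam 0%N.
Proof.
have k0 : 0 <= beta * lam ^+ 2 * Csigma.
  by rewrite mulr_ge0 ?(ltW Cs0)// mulr_ge0 ?sqr_ge0// ltW.
rewrite /SS ler_wpM2l// ler_pM2r ?invr_gt0// lerD2r ler_weXn2l//.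
by rewrite subn0 leq_subr.
Qed.

Let SS_N lam : SS lam N = 0.
Proof. by rewrite /SS subnn expr0 subrr mul0r mulr0. Qed.

Let SS0_le lam : SS lam 0%N <= 16 / 27 * (phi * lam ^+ 2).
Proof.
have k0 : 0 <= beta * lam ^+ 2 * Csigma.
  by rewrite mulr_ge0 ?(ltW Cs0)// mulr_ge0 ?sqr_ge0// ltW.
rewrite /SS subn0; have := ler_wpM2l k0 (variance_sum_le N C0 D0).
rewrite ND => /le_trans; apply.
by rewrite le_eqVlt; apply/orP; left; apply/eqP; rewrite /varphi; ring.
Qed.

Let blip i y z : (i < N)%N ->
  hsnorm (b (i%:R * Delta) y - b (i%:R * Delta) z) <= lb * hsnorm (y - z).
Proof. by move=> iN; exact: (lip_modulus_le hbL y z (tT iN)). Qed.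

Let slip i y z : (i < N)%N ->
  hsnorm (sigma (i%:R * Delta) y - sigma (i%:R * Delta) z) <= ls * hsnorm (y - z).
Proof. by move=> iN; exact: (lip_modulus_le hsL y z (tT iN)). Qed.

Let integrable_muT : muT.-integrable setT (EFin \o (fun y : E => hsnorm (y : 'cV[R]_d))).
Proof.
exact: (value_mean hmean hcov (ltW D0) lb0 ls0 blip slip hU hX.1 hX.2
  (@hsnorm_lipschitz1 R d)).1.
Qed.

Let chain_mgf_le (lam : R) (H : nat -> 'cV[R]_d -> R) (f : 'cV[R]_d -> R) :
  0 <= lam -> lipschitz1 f ->
  (forall i, (i <= N)%N -> measurable_fun setT (H i : E -> R)) -> (forall y, 0 <= H N y) ->
  (forall i y, (i < N)%N -> mgf_le mu (fun u : E' => H i.+1 (F i (y, u : 'cV[R]_q)))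
     (H i y - kk lam i * V y `^ (1 - alpha))) ->
  mgf_le muT (fun y : E => lam * f y) (lam * (\int[muT]_y f y) + 1 / 2 * H 0%N x).
Proof.
move=> lam0 lf mH HN HF.
apply: (euler_mgf_le hmean hcov (ltW D0) lb0 ls0 blip slip hU hX.1 hX.2 hGC) => // i y iN.
apply: mgf_leW (HF i y iN); rewrite lerD2l lerN2.
have k0 : 0 <= beta * lam ^+ 2 * (1 + C * Delta) ^+ (N - i.+1) * Delta.
  rewrite mulr_ge0 ?(ltW D0)// mulr_ge0 ?exprn_ge0 ?(le_trans ler01 CD1)//.
  by rewrite mulr_ge0 ?sqr_ge0// ltW.
have := ler_wpM2l k0 (hsig y iN); rewrite /kk; lra.
Qed.

Local Notation A := (constK Delta CV Cb eta).
Local Notation cC := (constC Delta alpha beta CV Cb Csigma eta).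

Let al0 : 0 < alpha. Proof. by move/andP: halpha => [h _]; lra. Qed.

Let A0 : 0 <= A.
Proof. by rewrite addr_ge0 ?sqrtr_ge0// mulr_ge0 ?(ltW D0)// mulr_ge0 ?(ltW Cb0). Qed.

Let C1_le : alpha * A <= cC.
Proof.
rewrite /constC /constK.
have : 0 <= beta * Csigma * alpha ^+ 2 * (1 + 2 * eta * Delta) ^+ 2 * (CV + Cb).
  apply: mulr_ge0; last by rewrite addr_ge0 ?(ltW CV0) ?(ltW Cb0).
  apply: mulr_ge0 (sqr_ge0 _); apply: mulr_ge0 (sqr_ge0 _).
  by rewrite mulr_ge0 ?(ltW hbeta) ?(ltW Cs0).
lra.
Qed.

Let tau (i : nat) : R := (N - i)%:R * Delta.

Let tau_ge0 i : 0 <= tau i. Proof. by rewrite mulr_ge0// ltW. Qed.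

Let tau_step i : (i < N)%N -> tau i = tau i.+1 + Delta.
Proof. by move=> iN; rewrite /tau -(subnSK iN) -natr1 mulrDl mul1r. Qed.

Let tau_le i : tau i <= T.
Proof. by rewrite -[leRHS]ND /tau ler_wpM2r ?(ltW D0)// ler_nat leq_subr. Qed.

Section case_super.
Variables (b0 eps lam : R) (f : 'cV[R]_d -> R).
Hypothesis alpha_gt : 1 / 2 < alpha.
Hypothesis b00 : 0 < b0.
Hypothesis hGC0 : gaussian_concentration mu b0.
Hypothesis epsE : eps = 1 / (2 * b0).
Hypothesis lam0 : 0 < lam.
Hypothesis lf : lipschitz1 f.
Local Notation rho := (rho_low T Delta alpha beta CV Cb Csigma eta eps).
Local Notation hl := (half_log_moment alpha mu eps).
(** [w] is factored as [om * W] with [om <= 1 <= W]. The weights are multiplied by [om], which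
    amounts to taking a power at most 1 of an exponential bound, while [W] enters Young's
    inequality. *)
Let w := phi * lam ^+ 2.
Let om := Num.min w 1.
Let W := Num.max w 1.
Let rhob := rho * ((1 - alpha) / alpha).
(** Extra growth rate that absorbs the quadratic Riccati term; over the whole horizon it costs only
    [exp (1/8)]. *)
Let dl := 1 / (8 * T).
Let D := W `^ (alpha / (2 * alpha - 1)) *
  (rho `^ (- ((1 - alpha) / (2 * alpha - 1))) * ((2 * alpha - 1) / alpha)).
Let s i := SS lam i / w.
Let r i := s i * rhob * expR ((alpha * A + dl) * tau i).
(** The three terms pay for what remains after time [i]: [r i] for the growth of [V^alpha], [hl] for
    the squared innovations at [hl / N] per step, and [D * s i] for the constants left by Young's
    inequality. *)
Let H i y := om * (r i * V y `^ alpha + (N - i)%:R / N%:R * hl + D * s i).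

Let al2 : 0 < 2 * alpha - 1. Proof. by rewrite subr_gt0 -ltr_pdivrMl// mulrC. Qed.
Let al1 : alpha <= 1. Proof. by case/andP: halpha. Qed.
Let eps0 : 0 < eps. Proof. by rewrite epsE divr_gt0// mulr_gt0. Qed.
Let heps : (exp_sq_moment mu eps < +oo)%E.
Proof.
rewrite epsE; exact: (concentration_exp_sq_moment (innovation_norm_integrable hmean hcov) b00 hGC0).
Qed.
Let w0 : 0 < w. Proof. by rewrite mulr_gt0// exprn_gt0. Qed.
Let wE : w = om * W.
Proof. by rewrite /om /W; case: (leP w 1) => _; rewrite ?mulr1 ?mul1r. Qed.
Let om01 : 0 <= om <= 1. Proof. by rewrite le_min (ltW w0) ler01 ge_min lexx orbT. Qed.
Let W1 : 1 <= W. Proof. by rewrite le_max lexx orbT. Qed.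
Let rho0 : 0 < rho. Proof. exact: rho_low_gt0. Qed.
Let rhob0 : 0 <= rhob.
Proof. by rewrite mulr_ge0 ?(ltW rho0)// divr_ge0 ?subr_ge0// ltW. Qed.
Let s0 i : 0 <= s i. Proof. by rewrite divr_ge0// ltW. Qed.
Let s_le i : s i <= 16 / 27.
Proof. by rewrite ler_pdivrMr// (le_trans (SS_le lam i)). Qed.
Let D_ge0 : 0 <= D.
Proof.
by rewrite /D mulr_ge0 ?powR_ge0// mulr_ge0 ?powR_ge0// divr_ge0 ?(ltW al0) ?(ltW al2).
Qed.
Let dl0 : 0 <= dl. Proof. by rewrite divr_ge0// mulr_ge0// ltW. Qed.
Let r0 i : 0 <= r i. Proof. by rewrite mulr_ge0 ?expR_ge0// mulr_ge0. Qed.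

(** The factor 16/27 in [s_le] compensates the growth [exp (dl * T) <= 27/16]. *)
Let r_le i : r i <= rhob * expR (cC * T).
Proof.
have e1 : expR ((alpha * A + dl) * tau i) <= expR (cC * T) * (27 / 16).
  apply: (@le_trans _ _ (expR (cC * T + 1 / 8))); last first.
    by rewrite expRD ler_wpM2l ?expR_ge0// expR_eighth_le.
  rewrite ler_expR; apply: (@le_trans _ _ ((alpha * A + dl) * T)).
    by rewrite ler_wpM2l// addr_ge0// mulr_ge0// ltW.
  rewrite mulrDl lerD// ?ler_wpM2r ?(ltW hT)//.
  by rewrite /dl le_eqVlt; apply/orP; left; apply/eqP; field; rewrite gt_eqF.
have e2 : s i * expR ((alpha * A + dl) * tau i) <= 16 / 27 * (expR (cC * T) * (27 / 16)).
  by rewrite ler_pM ?expR_ge0.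
rewrite /r mulrAC [leRHS]mulrC ler_wpM2r//; apply: le_trans e2 _; lra.
Qed.

Let r_moment i : 2 * r i * alpha * eta * T * Csigma <= eps * (1 - alpha) / (2 * alpha).
Proof.
have k0 : 0 <= 2 * alpha * eta * T * Csigma.
  by rewrite mulr_ge0 ?(ltW Cs0)// mulr_ge0 ?(ltW hT)// mulr_ge0// mulr_ge0 ?(ltW al0).
have th0 : 0 <= (1 - alpha) / alpha by rewrite divr_ge0 ?subr_ge0// ltW.
have h1 := ler_wpM2l k0 (r_le i).
have h2 := ler_wpM2r th0 (rho_low_le Delta beta CV Cb hT al0 Cs0 eta0 eps0).
have e : eps / 2 * ((1 - alpha) / alpha) = eps * (1 - alpha) / (2 * alpha).
  by field; rewrite gt_eqF.
rewrite -e; move: h1 h2; rewrite /rhob; set ee := expR _; set k := rho; lra.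
Qed.

(** The choice [eps = 1 / (2 * b0)] converts the moment bound on [r i] into the growth bound, with
    the factor [2 * (1 - alpha) <= 1] to spare. *)
Let r_growth i : 2 * b0 * alpha ^+ 2 * eta * Csigma * r i <= dl.
Proof.
have k0 : 0 <= b0 * alpha / T by rewrite divr_ge0 ?mulr_ge0 ?(ltW hT) ?(ltW al0) ?(ltW b00).
have := ler_wpM2l k0 (r_moment i).
have -> : b0 * alpha / T * (2 * r i * alpha * eta * T * Csigma) =
  2 * b0 * alpha ^+ 2 * eta * Csigma * r i by field; rewrite gt_eqF.
move=> /le_trans; apply.
have -> : b0 * alpha / T * (eps * (1 - alpha) / (2 * alpha)) = (1 - alpha) * 2 * dl.
  by rewrite epsE /dl; field; rewrite !gt_eqF.
rewrite -[leRHS]mul1r ler_wpM2r//; have := al2; lra.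
Qed.

Let mH i : measurable_fun setT (H i : E -> R).
Proof.
apply: measurable_funM => //; apply: measurable_funD => //; apply: measurable_funD => //.
apply: measurable_funM => //; exact: (measurableT_comp (measurable_powR alpha) mV).
Qed.

Let H_step i y : (i < N)%N -> mgf_le mu (fun u : E' => H i.+1 (F i (y, u : 'cV[R]_q)))
  (H i y - kk lam i * V y `^ (1 - alpha)).
Proof.
move=> iN.
have hb' z : hsnorm (b (i%:R * Delta) z) ^+ 2 <= Cb * V z by exact: HD_b hHD _ _ (tT iN).
have hell : mgf_le mu (fun u : E' => 2 * r i.+1 * alpha * eta * Delta * Csigma *
    hsnorm (u : 'cV[R]_q) ^+ 2) (N%:R^-1 * (2 * hl)).
  (* One step uses the fraction [1 / N = Delta / T] of the exponent, so the moment bound is taken to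
     the power [1 / N]. *)
  have Ni : 0 <= (N%:R^-1 : R) <= 1.
    apply/andP; split; first by rewrite invr_ge0 ltW.
    by rewrite -[leRHS]invr1 lef_pV2 ?posrE ?ltr01// ler1n.
  apply: mgf_le_le (mgf_leZ Ni (mgf_le_half_log_moment halpha eps0 heps)).
    apply: measurable_funM => //; apply: measurable_funX.
    exact: lipschitz1_measurable (@hsnorm_lipschitz1 _ _).
  move=> u; rewrite [leRHS]mulrA ler_wpM2r ?sqr_ge0//.
  have Ni0 : 0 <= N%:R^-1 :> R by case/andP: Ni.
  have := ler_wpM2l Ni0 (r_moment i.+1); lra.
have al01 : 0 < alpha <= 1 by rewrite al0.
have st := powR_lyapunov_step hmean hcov mV V0 taylor (HD_grad hHD) D0 eta0 CV0 Cb0 Cs0 hb'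
  al01 hGC0 (ltW b00) (r0 i.+1) (hsig y iN) hell.
have := mgf_leZ om01 (mgf_leD ((N - i.+1)%:R / N%:R * hl + D * s i.+1) st).
have -> : (fun u : E' => om * (r i.+1 * V (F i (y, u : 'cV[R]_q)) `^ alpha +
   ((N - i.+1)%:R / N%:R * hl + D * s i.+1))) = (fun u : E' => H i.+1 (F i (y, u : 'cV[R]_q))).
  by apply/funext => u; rewrite /H addrA.
apply: mgf_leW.
have vp := powR_ge0 (V y) alpha.
have g := growth_step_le (r0 i.+1) vp (ltW D0) (mulr_ge0 (ltW al0) A0) dl0 (r_growth i.+1).
have eT := tau_step iN; have eS := SS_step lam iN.
pose p := kk lam i / w.
have p0 : 0 <= p by rewrite divr_ge0// ltW.
have sE : s i = s i.+1 + p by rewrite /s eS mulrDl.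
have kE : kk lam i = om * (p * W) by rewrite mulrCA -wE divfK// gt_eqF.
have al12 : 1 / 2 < alpha <= 1 by rewrite alpha_gt.
have Y := ler_wpM2l p0 (powR_Young al12 rho0 (lt_le_trans ltr01 W1) (V0 y)).
rewrite -/rhob -/D in Y.
rewrite kE -[X in _ <= _ - X]mulrA /H -mulrBr ler_wpM2l//; first by case/andP: om01.
have eN : (N - i)%:R = (N - i.+1)%:R + 1 :> R by rewrite natr1 subnSK.
rewrite eN.
(* Young's inequality charges [p * rhob] times [V^alpha] without the exponential factor that [r i]
   carries; that factor is at least 1. *)
have e1 : 1 <= expR ((alpha * A + dl) * tau i).
  by rewrite -[leLHS]expR0 ler_expR mulr_ge0// addr_ge0// mulr_ge0// ltW.
have e2 := ler_wpM2l (mulr_ge0 (mulr_ge0 p0 rhob0) vp) e1.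
have rE : r i.+1 * expR ((alpha * A + dl) * Delta) = s i.+1 * rhob * expR ((alpha * A + dl) * tau i).
  by rewrite /r eT (mulrDr (alpha * A + dl)) expRD; ring.
rewrite rE in g.
rewrite [r i]/r sE; move: g Y e2; set e := expR ((_ + _) * tau i).
set a1 := r i.+1; set n := (N - i.+1)%:R; set v := V y `^ _; set v' := V y `^ _.
move: (half_log_moment _ _ _) => h0.
lra.
Qed.

Lemma super_mgf_le : mgf_le muT (fun y : E => lam * f y) (lam * (\int[muT]_y f y) +
   om * (rhob * expR (cC * T) * V x `^ alpha + hl + D)).
Proof.
have HN y : 0 <= H N y.
  by rewrite /H /r /s SS_N subnn !mul0r !(mulr0, addr0, mul0r).
apply: mgf_leW (chain_mgf_le (ltW lam0) lf (fun i _ => mH i) HN (fun i y iN => H_step y iN)).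
rewrite lerD2l /H subn0 divff ?gt_eqF// mul1r.
have hl0 : 0 <= hl by exact: half_log_moment_ge0.
have vp := powR_ge0 (V x) alpha.
have /andP[omge0 _] := om01.
have rV := ler_wpM2r vp (r_le 0).
have Ds : D * s 0%N <= D * 1 by rewrite ler_wpM2l// (le_trans (s_le 0))//; lra.
have rV0 : 0 <= r 0%N * V x `^ alpha by rewrite mulr_ge0.
have Ds0 : 0 <= D * s 0%N by rewrite mulr_ge0.
have := ler_wpM2l omge0 (ltac:(lra) : 1 / 2 * (r 0%N * V x `^ alpha + hl + D * s 0%N) <= 
  rhob * expR (cC * T) * V x `^ alpha + hl + D).
lra.
Qed.

End case_super.

Lemma transport_entropy_super (b0 eps : R) : 1 / 2 < alpha -> 0 < b0 ->
  gaussian_concentration mu b0 -> eps = 1 / (2 * b0) ->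
  transport_entropy (legendre (Phi_super alpha
    (K31 T Delta alpha beta CV Cb Csigma eta mu (V x) eps) phi)) muT.
Proof.
move=> alpha_gt b00 hGC0 epsE; set K := K31 _ _ _ _ _ _ _ _ _ _ _.
have eps0 : 0 < eps by rewrite epsE divr_gt0// mulr_gt0.
have heps : (exp_sq_moment mu eps < +oo)%E.
  rewrite epsE.
  exact: (concentration_exp_sq_moment (innovation_norm_integrable hmean hcov) b00 hGC0).
have rho0 : 0 < rho_low T Delta alpha beta CV Cb Csigma eta eps by exact: rho_low_gt0.
have hl0 := half_log_moment_ge0 halpha eps0 heps.
have al1 : alpha <= 1 by case/andP: halpha.
have al2 : 0 < 2 * alpha - 1 by rewrite subr_gt0 -ltr_pdivrMl// mulrC.
set rho := rho_low _ _ _ _ _ _ _ _ _ in rho0.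
set hl := half_log_moment _ _ _ in hl0.
pose Pt := rho * ((1 - alpha) / alpha) * expR (cC * T) * V x `^ alpha + hl.
pose Qt := rho `^ (- ((1 - alpha) / (2 * alpha - 1))) * ((2 * alpha - 1) / alpha).
have P0 : 0 <= Pt.
  rewrite addr_ge0// mulr_ge0 ?powR_ge0// mulr_ge0 ?expR_ge0// mulr_ge0 ?(ltW rho0)//.
  by rewrite divr_ge0 ?subr_ge0// ltW.
have Q0 : 0 <= Qt by rewrite mulr_ge0 ?powR_ge0// divr_ge0// ltW.
(* [Psi2] is exactly [Pt + Qt]: the bound of [super_mgf_le] with the power of [W] set apart. *)
have KPQ : Pt + Qt <= K.
  rewrite /K /K31 le_max; apply/orP; right.
  by rewrite /Psi2 -/rho -/hl /Pt /Qt; set a1 := _ * _ * _ * _; set a2 := _ * _; lra.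
have K0 : 0 <= K by apply: le_trans KPQ; rewrite addr_ge0.
have M0 r : 0 <= Num.max phi (phi `^ (alpha / (2 * alpha - 1))) *
    Num.max (r ^+ 2) (r `^ (2 * alpha / (2 * alpha - 1))).
  by rewrite mulr_ge0// le_max ?sqr_ge0// (ltW phi0).
apply: (transport_entropy_of_mgf_le (r0 := 1)) => //.
  by rewrite /Phi_super lee_fin -mulrA mulr_ge0.
move=> r r0 _; eexists; split; first by [].
move=> f lf; apply: mgf_leW (super_mgf_le alpha_gt b00 hGC0 epsE r0 lf).
rewrite lerD2l -/rho -/hl -/Pt -/Qt -mulrA.
have := min_max_powR_le alpha_gt phi0 r0.
set w := phi * r ^+ 2.
have om0 : 0 <= Num.min w 1 by rewrite le_min ler01 andbT mulr_ge0 ?sqr_ge0 ?(ltW phi0).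
have W1 : 1 <= (Num.max w 1) `^ (alpha / (2 * alpha - 1)).
  apply: (@le_trans _ _ (1 `^ (alpha / (2 * alpha - 1)))); first by rewrite powR1.
  apply: ge0_ler_powR; rewrite ?nnegrE//.
  - by rewrite divr_ge0 ?(ltW al0) ?(ltW al2).
  - by rewrite le_max ler01 orbT.
  - by rewrite le_max lexx orbT.
set W := _ `^ _ in W1 *; set M := Num.max _ _ * _ => WM.
apply: (@le_trans _ _ (Num.min w 1 * W * (Pt + Qt))).
  rewrite -mulrA ler_wpM2l// mulrDr lerD2r.
  by rewrite ler_peMl.
have WM' := ler_wpM2r K0 WM; apply: (@le_trans _ _ (Num.min w 1 * W * K)).
  by rewrite ler_wpM2l// mulr_ge0// (le_trans ler01).
by apply: le_trans WM' _; rewrite mulrC.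
Qed.

Section case_half.
Variables (b0 lam r : R) (f : 'cV[R]_d -> R).
Hypothesis alphaE : alpha = 1 / 2.
Hypothesis b00 : 0 <= b0.
Hypothesis hGC0 : gaussian_concentration mu b0.
Hypothesis lam0 : 0 < lam.
Hypothesis b0_le : b0 * eta * Csigma / 4 * T * lam ^+ 2 * expR (cC * T) <= 27 / 16.
Hypothesis r0 : 0 < r.
Let u := r * Num.sqrt phi / lam.
Hypothesis u1 : u < 1.
Hypothesis lf : lipschitz1 f.
Local Notation m2 := (sq_moment mu).
Let a := alpha * A.
Let g := b0 * eta * Csigma / 4.
(** [g] is the quadratic coefficient of the Riccati recursion, and [G] multiplies it by the largest
    numerator of [rr], so that [1 - G * tau i] is a valid denominator for all steps at once. *)
Let G := g * (SS r 0 * expR (a * T)).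
Let rr i := SS r i * expR (a * tau i) / (1 - G * tau i).
Let rmax := SS r 0 * expR (a * T) / (1 - G * T).
(** The second term pays for the constant drift of [sqrt V] over the remaining time, with [rr]
    bounded uniformly by [rmax]. *)
Let H i y := rr i * Num.sqrt (V y) + 1 / 2 * eta * Csigma * m2 * rmax * tau i.

Let a0 : 0 <= a. Proof. by rewrite mulr_ge0 ?(ltW al0). Qed.
Let g0 : 0 <= g.
Proof. by rewrite divr_ge0// mulr_ge0 ?(ltW Cs0)// mulr_ge0. Qed.
Let G0 : 0 <= G. Proof. by rewrite mulr_ge0// mulr_ge0 ?expR_ge0. Qed.
Let u0 : 0 < u. Proof. by rewrite divr_gt0// mulr_gt0// sqrtr_gt0. Qed.

Let u2E : phi * r ^+ 2 = u ^+ 2 * lam ^+ 2.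
Proof.
rewrite /u expr_div_n exprMn [Num.sqrt _ ^+ 2]sqr_sqrtr ?(ltW phi0)//.
by field; rewrite gt_eqF.
Qed.

Let SS0_le' : SS r 0 <= 16 / 27 * (u ^+ 2 * lam ^+ 2).
Proof. by rewrite -u2E. Qed.

Let eaT_le : expR (a * T) <= expR (cC * T).
Proof. by rewrite ler_expR ler_wpM2r// ltW. Qed.

Let u21 : u ^+ 2 < 1. Proof. by rewrite expr_lt1// ltW. Qed.

(** The factors 16/27 of the variance and 27/16 of [b0_le] cancel, so the Riccati solution stays
    finite whenever [u < 1]. *)
Let GT_le : G * T <= u ^+ 2.
Proof.
have h1 : SS r 0 * expR (a * T) <= 16 / 27 * (u ^+ 2 * lam ^+ 2) * expR (cC * T).
  by rewrite ler_pM ?expR_ge0.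
have gT : 0 <= g * T by rewrite mulr_ge0// ltW.
have h2 := ler_wpM2l gT h1.
have k0 : 0 <= 16 / 27 * u ^+ 2 by rewrite mulr_ge0 ?sqr_ge0// divr_ge0.
have h3 := ler_wpM2l k0 b0_le; rewrite -/g in h3.
rewrite /G; move: h2 h3; set e1 := expR _; set e2 := expR _; lra.
Qed.

Let den_gt0 : 0 < 1 - G * T.
Proof. by rewrite subr_gt0 (le_lt_trans GT_le). Qed.

Let den_le i : 1 - G * T <= 1 - G * tau i.
Proof. by rewrite lerD2l lerN2 ler_wpM2l. Qed.

Let rr_ge0 i : 0 <= rr i.
Proof.
rewrite divr_ge0 ?(le_trans _ (den_le i)) ?(ltW den_gt0)//.
by rewrite mulr_ge0 ?expR_ge0.
Qed.

Let rr_le i : rr i <= rmax.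
Proof.
rewrite /rr /rmax ler_pM//.
- by rewrite mulr_ge0 ?expR_ge0.
- by rewrite invr_ge0 (le_trans _ (den_le i)) ?(ltW den_gt0).
- by rewrite ler_pM ?expR_ge0// ler_expR ler_wpM2l.
- by rewrite lef_pV2 ?posrE ?(lt_le_trans den_gt0 (den_le i)) ?den_gt0.
Qed.

Let m20 : 0 <= m2. Proof. by apply: Rintegral_ge0 => v _; exact: sqr_ge0. Qed.

Let rmax0 : 0 <= rmax. Proof. exact: le_trans (rr_ge0 0) (rr_le 0). Qed.

Let c0 : 0 <= 1 / 2 * eta * Csigma * m2.
Proof. by rewrite mulr_ge0// mulr_ge0 ?(ltW Cs0)// mulr_ge0// divr_ge0. Qed.

Let mH i : measurable_fun setT (H i : E -> R).
Proof.
apply: measurable_funD => //; apply: measurable_funM => //.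
apply: (@continuous_borel_measurable _ _ _ (fun y : 'cV[R]_d => Num.sqrt (V y))) => y.
by apply: continuous_comp; [exact: (HD_C2 hHD).1|exact: sqrt_continuous].
Qed.

Let V_half y : V y `^ (1 - alpha) = Num.sqrt (V y).
Proof.
rewrite -powR12_sqrt ?(ltW (V0 y))//; congr powR; rewrite alphaE; lra.
Qed.

Let H_step i y : (i < N)%N -> mgf_le mu (fun u : E' => H i.+1 (F i (y, u : 'cV[R]_q)))
  (H i y - kk r i * V y `^ (1 - alpha)).
Proof.
move=> iN; rewrite V_half.
have hb' z : hsnorm (b (i%:R * Delta) z) ^+ 2 <= Cb * V z by exact: HD_b hHD _ _ (tT iN).
have hs' : hsnorm (sigma (i%:R * Delta) y) ^+ 2 <= Csigma * Num.sqrt (V y).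
  by rewrite -V_half; exact: hsig.
have st := sqrt_lyapunov_step hmean hcov V0 taylor (HD_grad hHD) D0 eta0 CV0 Cb0 Cs0 hb'
  hGC0 b00 (rr_ge0 i.+1) hs'.
apply: mgf_leW (mgf_leD (1 / 2 * eta * Csigma * m2 * rmax * tau i.+1) st).
have eT := tau_step iN.
have e1 : 1 <= expR (a * tau i.+1) by rewrite -[leLHS]expR0 ler_expR mulr_ge0.
have gG : g * (SS r i.+1 * expR (a * tau i.+1)) <= G.
  by rewrite ler_wpM2l// ler_pM ?expR_ge0// ler_expR ler_wpM2l.
have Gz : G * Delta < 1 - G * tau i.+1.
  have := lt_le_trans den_gt0 (den_le i); rewrite eT mulrDr; lra.
have z1 : 1 - G * tau i.+1 <= 1 by rewrite gerBl mulr_ge0.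
have := riccati_step_le (SS_ge0 r i.+1) (kk_ge0 r i) e1 a0 (ltW D0) G0 gG Gz z1.
rewrite -SS_step// -expRD -mulrDr -eT.
have -> : 1 - G * tau i.+1 - G * Delta = 1 - G * tau i by rewrite eT; ring.
rewrite -/(rr i) -/(rr i.+1) => ric.
have v0 : 0 <= Num.sqrt (V y) by exact: sqrtr_ge0.
have h1 := ler_wpM2r v0 ric.
have h2 := ler_wpM2l (mulr_ge0 c0 (ltW D0)) (rr_le i.+1).
rewrite /H eT; move: h1 h2.
rewrite -[1 / 2 * A](_ : a = _); last by rewrite /a alphaE.
have gE : b0 / 4 * rr i.+1 ^+ 2 * eta * Csigma * Delta = g * rr i.+1 ^+ 2 * Delta.
  by rewrite /g; ring.
rewrite gE; set k := kk r i; set v := Num.sqrt _.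
set x1 := rr i; set x2 := rr i.+1; set m := sq_moment mu.
set x3 := rmax; set t := tau _.
lra.
Qed.

Lemma half_mgf_le : mgf_le muT (fun y : E => r * f y) (r * (\int[muT]_y f y) +
   K32 T Delta alpha beta CV Cb Csigma eta mu (V x) lam * (u ^+ 2 / (1 - u))).
Proof.
have HN y : 0 <= H N y.
  by rewrite /H /rr /tau SS_N subnn !mul0r !(mulr0, addr0, mul0r).
apply: mgf_leW (chain_mgf_le (ltW r0) lf (fun i _ => mH i) HN (fun i y iN => H_step y iN)).
rewrite lerD2l /H.
have t0 : tau 0 = T by rewrite /tau subn0.
rewrite /rr t0 -/rmax.
have -> : K32 T Delta alpha beta CV Cb Csigma eta mu (V x) lam =
  lam ^+ 2 * expR (cC * T) * (2 * (Num.sqrt (V x) + 1 / 2 * eta * Csigma * m2 * T)).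
  rewrite /K32 -powR12_sqrt ?(ltW (V0 x))// div1r alphaE; ring.
set q0 := Num.sqrt (V x) + _.
have q00 : 0 <= q0 by rewrite addr_ge0 ?sqrtr_ge0// mulr_ge0// ltW.
have -> : 1 / 2 * (rmax * Num.sqrt (V x) + 1 / 2 * eta * Csigma * m2 * rmax * T) =
  1 / 2 * rmax * q0 by rewrite /q0; ring.
have rm : rmax <= 16 / 27 * (u ^+ 2 * lam ^+ 2) * expR (cC * T) / (1 - u).
  rewrite /rmax; apply: ler_pM.
  - by rewrite mulr_ge0 ?expR_ge0.
  - by rewrite invr_ge0 (ltW den_gt0).
  - by rewrite ler_pM ?expR_ge0.
  (* The Riccati denominator [1 - u^2] is weakened to the stated [1 - u]. *)
  - rewrite lef_pV2 ?posrE ?subr_gt0 ?(le_lt_trans GT_le)// lerD2l lerN2 (le_trans GT_le)//.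
    by rewrite expr2 ler_piMr ?(ltW u0) ?(ltW u1).
have h := ler_wpM2r q00 rm.
have p0 : 0 <= u ^+ 2 * lam ^+ 2 * expR (cC * T) / (1 - u) * q0.
  rewrite mulr_ge0// divr_ge0 ?subr_ge0 ?(ltW u1)// mulr_ge0 ?expR_ge0//.
  by rewrite mulr_ge0 ?sqr_ge0.
move: h p0; set e := expR _; set i1 := (1 - u)^-1; lra.
Qed.

End case_half.

Lemma transport_entropy_half (lam : R) : alpha = 1 / 2 -> 0 < lam ->
  (exp_sq_moment mu
     (lam ^+ 2 * lam32_exponent T Delta alpha beta CV Cb Csigma eta) <= 2%:E)%E ->
  transport_entropy (legendre (Phi_half
    (K32 T Delta alpha beta CV Cb Csigma eta mu (V x) lam) lam phi)) muT.
Proof.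
move=> alphaE lam0 hlam.
have sp : 0 < Num.sqrt phi by rewrite sqrtr_gt0.
have [b0 [b00 hGC0 b0_le]] : exists b0, [/\ 0 <= b0, gaussian_concentration mu b0 &
    b0 * eta * Csigma / 4 * T * lam ^+ 2 * expR (cC * T) <= 27 / 16].
  (* For [eta = 0] the moment condition is void, but the quadratic Riccati term vanishes too, and
     [beta] itself can serve as [b0]. *)
  have [e0|en0] := eqVneq eta 0.
    exists beta; split=> //; first exact: ltW.
    by rewrite {1}e0 mulr0 !mul0r divr_ge0.
  have ep : 0 < eta by rewrite lt_neqAle eq_sym en0.
  set kap := _ * lam32_exponent _ _ _ _ _ _ _ _ in hlam.
  have kapE : kap = lam ^+ 2 * (eta * Csigma * T * expR (cC * T)).
    by rewrite /kap /lam32_exponent alphaE; field.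
  have kap0 : 0 < kap.
    rewrite kapE mulr_gt0 ?exprn_gt0// mulr_gt0 ?expR_gt0// mulr_gt0//.
    by rewrite mulr_gt0.
  exists (27 / (4 * kap)); split.
  - by rewrite divr_ge0// mulr_ge0// ltW.
  - exact: concentration_of_exp_sq_moment (innovation_norm_integrable hmean hcov) _ kap0 hlam.
  have cE c : c * eta * Csigma / 4 * T * lam ^+ 2 * expR (cC * T) = c * kap / 4.
    by rewrite kapE; ring.
  rewrite cE.
  by rewrite le_eqVlt; apply/orP; left; apply/eqP; field; rewrite gt_eqF.
have lt_u r : (r < (Num.sqrt phi)^-1 * lam) = (r * Num.sqrt phi / lam < 1).
  by rewrite ltr_pdivrMr// mul1r mulrC -ltr_pdivlMr// mulrC.
have t0 : 0 < (Num.sqrt phi)^-1 * lam by rewrite mulr_gt0// invr_gt0.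
apply: (transport_entropy_of_mgf_le (r0 := (Num.sqrt phi)^-1 * lam / 2)) => //.
- by rewrite /Phi_half lexx t0/= !mul0r expr0n/= mul0r mulr0.
- by rewrite divr_gt0.
- rewrite /Phi_half; case: ifP => // /negP[]; apply/andP; split; last by lra.
  by rewrite divr_ge0// ltW.
move=> r r0; rewrite /Phi_half (ltW r0)/=; case: ifPn => // rlt _.
eexists; split; first by [].
by move=> f lf; apply: half_mgf_le alphaE b00 hGC0 lam0 b0_le r0 _ lf; rewrite -lt_u.
Qed.

End scheme_bounds.

Theorem theorem2p1 (R : realType) (q : nat) (hq : (0 < q)%N)
    (mu : probability (borel_cV R q) R)
    (hmean : centered mu) (hcov : unit_covariance mu)
    (hGC : exists2 beta : R, 0 < beta & gaussian_concentration mu beta) :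
  exists eps : R, [/\ 0 < eps, (exp_sq_moment mu eps < +oo)%E &
  forall (beta : R) (hbeta : 0 < beta) (hGCbeta : gaussian_concentration mu beta)
    (d : nat) (hd : (0 < d)%N) (T : R) (hT : 0 < T) (N : nat) (hN : (0 < N)%N)
    (x : 'cV[R]_d)
    (b : R -> 'cV[R]_d -> 'cV[R]_d) (sigma : R -> 'cV[R]_d -> 'M[R]_(d, q))
    (hbm : measurable_in_time T b) (hsm : measurable_in_time T sigma)
    (hbL : unif_lipschitz T b) (hsL : unif_lipschitz T sigma)
    (alpha : R) (halpha : 1 / 2 <= alpha <= 1)
    (V : 'cV[R]_d -> R) (CV Cb Csigma : R)
    (hHD : HD T b sigma alpha V CV Cb Csigma)
    (dO : measure_display) (Omega : measurableType dO) (P : probability Omega R)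
    (U : nat -> {RV P >-> borel_cV R q}) (hU : iid_with_law U mu)
    (X : nat -> {RV P >-> borel_cV R d})
    (hX : euler_scheme b sigma x (T / N%:R) N U X),
  let Delta := T / N%:R in
  let lb := lip_modulus T b in
  let ls := lip_modulus T sigma in
  let eta := half_hessian_sup V in
  let phi := varphi Csigma beta lb ls Delta T in
  let muT := distribution P (X N) in
  CDelta lb ls Delta != 0 ->
  (1 / 2 < alpha ->
    let K := K31 T Delta alpha beta CV Cb Csigma eta mu (V x) eps in
    transport_entropy (legendre (Phi_super alpha K phi)) muT) /\
  (alpha = 1 / 2 -> forall lam : R, 0 < lam ->
    (exp_sq_moment mu
       (lam ^+ 2 * lam32_exponent T Delta alpha beta CV Cb Csigma eta)
     <= 2%:E)%E ->
    let K := K32 T Delta alpha beta CV Cb Csigma eta mu (V x) lam in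
    transport_entropy (legendre (Phi_half K lam phi)) muT)].
Proof.
(* [b0] is extracted before [beta] is introduced, so [eps] depends on [mu] only. *)
have [b0 b00 hGC0] := hGC.
exists (1 / (2 * b0)); split.
- by rewrite divr_gt0// mulr_gt0.
- exact: (concentration_exp_sq_moment (innovation_norm_integrable hmean hcov) b00 hGC0).
move=> beta hbeta hGCbeta d hd T hT N hN x b sigma hbm hsm hbL hsL alpha halpha
  V CV Cb Csigma hHD dO Omega P U hU X hX Delta lb ls eta phi muT hC; split.
  by move=> alpha_gt K; exact: (transport_entropy_super hmean hcov hbeta hGCbeta hd hT hN
    hbL hsL halpha hHD hU hX hC alpha_gt b00 hGC0 erefl).
by move=> alphaE lam lam0 hlam K; exact: (transport_entropy_half hmean hcov hbeta hGCbeta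
  hd hT hN hbL hsL halpha hHD hU hX hC alphaE lam0 hlam).
Qed.
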